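(* Let $T\in\mathcal{KC}(V)$ be such that $T$ and $\overline{T}$ are operators of type $\omega\in(0,\pi)$, and let $\theta\in(\omega,\pi)$. Then for every $f\in\Psi_L^Q(S_\theta)$ (resp. $f\in\Psi_R^Q(S_\theta)$), every $\varphi\in(\omega,\theta)$ and every $J\in\mathbb{S}$, the integral $$Df(T):=\frac{-1}{\pi}\int_{\partial(S_\varphi\cap\mathbb{C}_J)}Q_{c,s}^{-1}(T)\,ds_J\,f(s)\qquad\Big(\text{resp. }(fD)(T):=\frac{-1}{\pi}\int_{\partial(S_\varphi\cap\mathbb{C}_J)}f(s)\,ds_J\,Q_{c,s}^{-1}(T)\Big)$$ is absolutely convergent, and its value depends neither on the angle $\varphi\in(\omega,\theta)$ nor on the imaginary unit $J\in\mathbb{S}$. Moreover, if $f,g\in\Psi_L^Q(S_\theta)$ satisfy $Df=Dg$ on $S_\theta$ (resp. $f,g\in\Psi_R^Q(S_\theta)$ satisfy $fD=gD$ on $S_\theta$), then $Df(T)=Dg(T)$ (resp. $(fD)(T)=(gD)(T)$).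
   Context: $\mathbb{H}$ denotes the quaternions $s=s_0+s_1e_1+s_2e_2+s_3e_3$ ($s_i\in\mathbb{R}$) with $e_1^2=e_2^2=e_3^2=-1$, $e_1e_2=-e_2e_1=e_3$, $e_2e_3=-e_3e_2=e_1$, $e_3e_1=-e_1e_3=e_2$; $\overline{s}=s_0-s_1e_1-s_2e_2-s_3e_3$, $|s|=(s_0^2+s_1^2+s_2^2+s_3^2)^{1/2}$, $\mathbb{S}=\{s\in\mathbb{H}: s_0=0,\ |s|=1\}$, and $\mathbb{C}_J=\{u+Jv:u,v\in\mathbb{R}\}$ for $J\in\mathbb{S}$. For $\omega\in(0,\pi)$ the open sector is $S_\omega=\{re^{J\phi}: r>0,\ J\in\mathbb{S},\ |\phi|<\omega\}$, $\overline{S_\omega}$ its closure and $S_\omega^c=\mathbb{H}\setminus S_\omega$. $V$ is a two-sided Banach space over $\mathbb{H}$, $\mathcal{I}$ the identity. $\mathcal{KC}(V)$ is the class of closed right-linear operators $T$ on $V$ with two-sided linear domain $\operatorname{dom}(T)$ such that $T=T_0+e_1T_1+e_2T_2+e_3T_3$ with two-sided linear operators $T_i$, $\operatorname{dom}(T_i)=\operatorname{dom}(T)$, $\operatorname{dom}(T^2)\subseteq\operatorname{dom}(T_iT_j)$ and $T_iT_j=T_jT_i$ on $\operatorname{dom}(T^2)$ for all $i,j\in\{0,1,2,3\}$. For such $T$, $\overline{T}:=T_0-e_1T_1-e_2T_2-e_3T_3$ (also in $\mathcal{KC}(V)$), $|T|^2:=T_0^2+T_1^2+T_2^2+T_3^2$,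 and for $s\in\mathbb{H}$, $Q_{c,s}(T):=s^2\mathcal{I}-2sT_0+|T|^2$ with domain $\operatorname{dom}(T^2)$. The $S$-resolvent set $\rho_S(T)$ is the set of $s\in\mathbb{H}$ for which $Q_{c,s}(T):\operatorname{dom}(T^2)\to V$ is bijective; $Q_{c,s}^{-1}(T)$ is its inverse, and $\sigma_S(T)=\mathbb{H}\setminus\rho_S(T)$ is the $S$-spectrum. For $s\in\rho_S(T)$, $S_L^{-1}(s,T):=(s\mathcal{I}-\overline{T})Q_{c,s}^{-1}(T)$ and $S_R^{-1}(s,T):=sQ_{c,s}^{-1}(T)-\sum_{i=0}^3T_iQ_{c,s}^{-1}(T)\overline{e_i}$ (with $e_0=1$). $T\in\mathcal{KC}(V)$ is of type $\omega\in(0,\pi)$ if $\sigma_S(T)\subseteq\overline{S_\omega}$ and for every $\theta\in(\omega,\pi)$ there is $C_\theta\geq0$ with $\|S_L^{-1}(s,T)\|\leq C_\theta/|s|$ and $\|S_R^{-1}(s,T)\|\leq C_\theta/|s|$ for all $s\in S_\theta^c\setminus\{0\}$. Slice hyperholomorphic functions: for an open axially symmetric $U\subseteq\mathbb{H}$ (i.e. $s_0+J|s-s_0|\in U$ for all $J\in\mathbb{S}$ whenever $s\in U$), $f:U\to\mathbb{H}$ is left (resp. right) slice hyperholomorphic if there are continuously differentiable $\alpha,\beta:\{(u,v)\in\mathbb{R}^2:u+\mathbb{S}v\subseteq U\}\to\mathbb{H}$ with $f(u+Jv)=\alpha(u,v)+J\beta(u,v)$ (resp. $=\alpha(u,v)+\beta(u,v)J$)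 for all such $(u,v)$ and all $J\in\mathbb{S}$, $\alpha(u,-v)=\alpha(u,v)$, $\beta(u,-v)=-\beta(u,v)$, $\partial_u\alpha=\partial_v\beta$ and $\partial_v\alpha=-\partial_u\beta$. $\Psi_L^Q(S_\theta)$ (resp. $\Psi_R^Q(S_\theta)$) is the set of left (resp. right) slice hyperholomorphic $f$ on $S_\theta$ for which there exist $\alpha>0$, $C_\alpha\geq0$ with $|f(s)|\leq C_\alpha|s|^{1+\alpha}/(1+|s|^{1+2\alpha})$ for all $s\in S_\theta$. Path integrals: for $J\in\mathbb{S}$ and $\varphi\in(0,\pi)$ let $\gamma(t)=-te^{J\varphi}$ for $t<0$ and $\gamma(t)=te^{-J\varphi}$ for $t>0$, and set $\int_{\partial(S_\varphi\cap\mathbb{C}_J)}F(s)\,ds_J\,G(s):=\int_{\mathbb{R}\setminus\{0\}}F(\gamma(t))\gamma'(t)J^{-1}G(\gamma(t))\,dt$. $D=\partial_{q_0}+e_1\partial_{q_1}+e_2\partial_{q_2}+e_3\partial_{q_3}$ is the Cauchy–Fueter operator acting from the left on functions of $q=q_0+q_1e_1+q_2e_2+q_3e_3$; $fD:=\partial_{q_0}f+(\partial_{q_1}f)e_1+(\partial_{q_2}f)e_2+(\partial_{q_3}f)e_3$ is its action from the right. *)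

(* Defs.v *)
From Stdlib Require Import Reals Lra ClassicalEpsilon.
From Coquelicot Require Import Coquelicot.
Open Scope R_scope.

Record quat := mkQ { q0 : R; q1 : R; q2 : R; q3 : R }.

Definition qreal (r : R) : quat := mkQ r 0 0 0.
Definition qone : quat := qreal 1.
Definition e1 : quat := mkQ 0 1 0 0.
Definition e2 : quat := mkQ 0 0 1 0.
Definition e3 : quat := mkQ 0 0 0 1.
Definition qadd (a b : quat) : quat :=
  mkQ (q0 a + q0 b) (q1 a + q1 b) (q2 a + q2 b) (q3 a + q3 b).
Definition qopp (a : quat) : quat := mkQ (- q0 a) (- q1 a) (- q2 a) (- q3 a).
Definition qsub (a b : quat) : quat := qadd a (qopp b).
Definition qscale (r : R) (a : quat) : quat :=
  mkQ (r * q0 a) (r * q1 a) (r * q2 a) (r * q3 a).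
(* Hamilton product: e1 e2 = e3, e2 e3 = e1, e3 e1 = e2, ei^2 = -1 *)
Definition qmul (a b : quat) : quat :=
  mkQ (q0 a * q0 b - q1 a * q1 b - q2 a * q2 b - q3 a * q3 b)
      (q0 a * q1 b + q1 a * q0 b + q2 a * q3 b - q3 a * q2 b)
      (q0 a * q2 b - q1 a * q3 b + q2 a * q0 b + q3 a * q1 b)
      (q0 a * q3 b + q1 a * q2 b - q2 a * q1 b + q3 a * q0 b).
Definition qconj (a : quat) : quat := mkQ (q0 a) (- q1 a) (- q2 a) (- q3 a).
Definition qnorm (a : quat) : R :=
  sqrt (q0 a ^ 2 + q1 a ^ 2 + q2 a ^ 2 + q3 a ^ 2).
Definition qinv (a : quat) : quat := qscale (/ (qnorm a ^ 2)) (qconj a).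

Definition in_S (J : quat) : Prop := q0 J = 0 /\ qnorm J = 1.

Definition qexpJ (J : quat) (phi : R) : quat := qadd (qreal (cos phi)) (qscale (sin phi) J).

Definition slice_pt (u v : R) (J : quat) : quat := qadd (qreal u) (qscale v J).

Definition in_sector (om : R) (s : quat) : Prop :=
  exists r J phi, 0 < r /\ in_S J /\ Rabs phi < om /\ s = qscale r (qexpJ J phi).

Definition in_sector_closure (om : R) (s : quat) : Prop :=
  forall eps, 0 < eps -> exists p, in_sector om p /\ qnorm (qsub s p) < eps.

Section TwoSided.
Context {V : CompleteNormedModule R_AbsRing}.

Definition two_sided (lm : quat -> V -> V) (rm : V -> quat -> V) : Prop :=
  (forall a u w, lm a (plus u w) = plus (lm a u) (lm a w)) /\
  (forall a b u, lm (qadd a b) u = plus (lm a u) (lm b u)) /\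
  (forall a b u, lm (qmul a b) u = lm a (lm b u)) /\
  (forall r u, lm (qreal r) u = scal r u) /\
  (forall a u w, rm (plus u w) a = plus (rm u a) (rm w a)) /\
  (forall a b u, rm u (qadd a b) = plus (rm u a) (rm u b)) /\
  (forall a b u, rm u (qmul a b) = rm (rm u a) b) /\
  (forall r u, rm u (qreal r) = scal r u) /\
  (forall a b u, rm (lm a u) b = lm a (rm u b)) /\
  (forall a u, norm (lm a u) = qnorm a * norm u) /\
  (forall a u, norm (rm u a) = qnorm a * norm u).

Variables (lm : quat -> V -> V) (rm : V -> quat -> V).

Definition Top (T0 T1 T2 T3 : V -> V) (v : V) : V :=
  plus (T0 v) (plus (lm e1 (T1 v)) (plus (lm e2 (T2 v)) (lm e3 (T3 v)))).

Definition Tbar (T0 T1 T2 T3 : V -> V) (v : V) : V :=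
  plus (T0 v) (opp (plus (lm e1 (T1 v)) (plus (lm e2 (T2 v)) (lm e3 (T3 v))))).

Definition dom2 (dom : V -> Prop) (T0 T1 T2 T3 : V -> V) (v : V) : Prop :=
  dom v /\ dom (Top T0 T1 T2 T3 v).

Definition two_sided_linear_on (dom : V -> Prop) (A : V -> V) : Prop :=
  (forall u w, dom u -> dom w -> A (plus u w) = plus (A u) (A w)) /\
  (forall a u, dom u -> A (lm a u) = lm a (A u)) /\
  (forall a u, dom u -> A (rm u a) = rm (A u) a).

Definition two_sided_subspace (dom : V -> Prop) : Prop :=
  dom zero /\
  (forall u w, dom u -> dom w -> dom (plus u w)) /\
  (forall a u, dom u -> dom (lm a u)) /\
  (forall a u, dom u -> dom (rm u a)).

Definition closed_op (dom : V -> Prop) (A : V -> V) : Prop :=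
  forall (vn : nat -> V) (v w : V),
    (forall n, dom (vn n)) ->
    filterlim vn eventually (locally v) ->
    filterlim (fun n => A (vn n)) eventually (locally w) ->
    dom v /\ A v = w.

Definition is_KC (dom : V -> Prop) (T0 T1 T2 T3 : V -> V) : Prop :=
  let Ts := fun A : V -> V => A = T0 \/ A = T1 \/ A = T2 \/ A = T3 in
  two_sided_subspace dom /\
  (forall Ti, Ts Ti -> two_sided_linear_on dom Ti) /\
  closed_op dom (Top T0 T1 T2 T3) /\
  (forall Ti Tj, Ts Ti -> Ts Tj ->
     forall v, dom2 dom T0 T1 T2 T3 v -> dom (Tj v) /\ Ti (Tj v) = Tj (Ti v)).

Definition Qcs (T0 T1 T2 T3 : V -> V) (s : quat) (v : V) : V :=
  plus (lm (qmul s s) v)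
   (plus (scal (-2) (lm s (T0 v)))
     (plus (T0 (T0 v)) (plus (T1 (T1 v)) (plus (T2 (T2 v)) (T3 (T3 v)))))).

Definition is_Qinv (dom : V -> Prop) (T0 T1 T2 T3 : V -> V) (s : quat) (B : V -> V) : Prop :=
  (forall u, dom2 dom T0 T1 T2 T3 (B u) /\ Qcs T0 T1 T2 T3 s (B u) = u) /\
  (forall v, dom2 dom T0 T1 T2 T3 v -> B (Qcs T0 T1 T2 T3 s v) = v).

Definition in_rhoS (dom : V -> Prop) (T0 T1 T2 T3 : V -> V) (s : quat) : Prop :=
  exists B, is_Qinv dom T0 T1 T2 T3 s B.

Definition Qinv (dom : V -> Prop) (T0 T1 T2 T3 : V -> V) (s : quat) : V -> V :=
  epsilon (inhabits (fun _ : V => zero)) (is_Qinv dom T0 T1 T2 T3 s).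

Definition SLinv dom T0 T1 T2 T3 (s : quat) (v : V) : V :=
  let w := Qinv dom T0 T1 T2 T3 s v in plus (lm s w) (opp (Tbar T0 T1 T2 T3 w)).

Definition SRinv dom T0 T1 T2 T3 (s : quat) (v : V) : V :=
  let Q := Qinv dom T0 T1 T2 T3 s in
  plus (lm s (Q v))
   (opp (plus (T0 (Q v))
     (plus (T1 (Q (lm (qconj e1) v)))
       (plus (T2 (Q (lm (qconj e2) v))) (T3 (Q (lm (qconj e3) v))))))).

Definition of_type dom T0 T1 T2 T3 (om : R) : Prop :=
  0 < om < PI /\
  (forall s, ~ in_rhoS dom T0 T1 T2 T3 s -> in_sector_closure om s) /\
  (forall th, om < th < PI -> exists C, 0 <= C /\
     forall s, ~ in_sector th s -> s <> qreal 0 ->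
       forall v, norm (SLinv dom T0 T1 T2 T3 s v) <= C / qnorm s * norm v /\
                 norm (SRinv dom T0 T1 T2 T3 s v) <= C / qnorm s * norm v).

(* Operator-valued path integrals along partial(S_phi cap C_J)          *)
Definition gamma (phi : R) (J : quat) (t : R) : quat :=
  if Rlt_dec t 0 then qscale (- t) (qexpJ J phi) else qscale t (qexpJ J (- phi)).
Definition dgamma (phi : R) (J : quat) (t : R) : quat :=
  if Rlt_dec t 0 then qopp (qexpJ J phi) else qexpJ J (- phi).

(* integrand of  int Q_{c,s}^{-1}(T) ds_J f(s) , as operator at parameter t *)
Definition KL dom T0 T1 T2 T3 (f : quat -> quat) phi J (t : R) (v : V) : V :=
  Qinv dom T0 T1 T2 T3 (gamma phi J t)
    (lm (qmul (qmul (dgamma phi J t) (qinv J)) (f (gamma phi J t))) v).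

(* integrand of  int f(s) ds_J Q_{c,s}^{-1}(T) *)
Definition KR dom T0 T1 T2 T3 (f : quat -> quat) phi J (t : R) (v : V) : V :=
  lm (qmul (qmul (f (gamma phi J t)) (dgamma phi J t)) (qinv J))
     (Qinv dom T0 T1 T2 T3 (gamma phi J t) v).

Definition bounded_op (A : V -> V) : Prop := exists C, forall v, norm (A v) <= C * norm v.
Definition opnorm (A : V -> V) : R :=
  real (Lub_Rbar (fun r => exists v, norm v <= 1 /\ r = norm (A v))).

Definition abs_conv (K : R -> V -> V) : Prop :=
  (forall t, t <> 0 -> bounded_op (K t)) /\
  ex_RInt_gen (fun t => opnorm (K t)) (Rbar_locally m_infty) (at_left 0) /\
  ex_RInt_gen (fun t => opnorm (K t)) (at_right 0) (Rbar_locally p_infty).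

Definition int_value (K : R -> V -> V) (A : V -> V) : Prop :=
  forall v, exists a1 a2,
    is_RInt_gen (fun t => K t v) (Rbar_locally m_infty) (at_left 0) a1 /\
    is_RInt_gen (fun t => K t v) (at_right 0) (Rbar_locally p_infty) a2 /\
    A v = scal (- / PI) (plus a1 a2).

End TwoSided.

Definition dU (h : R -> R -> quat) (u v : R) : quat :=
  mkQ (Derive (fun x => q0 (h x v)) u) (Derive (fun x => q1 (h x v)) u)
      (Derive (fun x => q2 (h x v)) u) (Derive (fun x => q3 (h x v)) u).
Definition dV (h : R -> R -> quat) (u v : R) : quat :=
  mkQ (Derive (fun y => q0 (h u y)) v) (Derive (fun y => q1 (h u y)) v)
      (Derive (fun y => q2 (h u y)) v) (Derive (fun y => q3 (h u y)) v).

Definition C1_on (D : R -> R -> Prop) (h : R -> R -> R) : Prop :=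
  forall u v, D u v ->
    ex_derive (fun x => h x v) u /\ ex_derive (fun y => h u y) v /\
    continuity_2d_pt (fun x y => Derive (fun x' => h x' y) x) u v /\
    continuity_2d_pt (fun x y => Derive (fun y' => h x y') y) u v.

Definition C1_on_quat (D : R -> R -> Prop) (h : R -> R -> quat) : Prop :=
  C1_on D (fun x y => q0 (h x y)) /\ C1_on D (fun x y => q1 (h x y)) /\
  C1_on D (fun x y => q2 (h x y)) /\ C1_on D (fun x y => q3 (h x y)).

Definition sector_dom (th : R) (u v : R) : Prop :=
  forall J, in_S J -> in_sector th (slice_pt u v J).

Definition slice_holo_core (th : R) (f : quat -> quat) (left : bool) : Prop :=
  exists al be : R -> R -> quat,
    C1_on_quat (sector_dom th) al /\ C1_on_quat (sector_dom th) be /\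
    (forall u v, sector_dom th u v ->
       al u (- v) = al u v /\ be u (- v) = qopp (be u v) /\
       dU al u v = dV be u v /\ dV al u v = qopp (dU be u v) /\
       (forall J, in_S J ->
          f (slice_pt u v J) =
          qadd (al u v) (if left then qmul J (be u v) else qmul (be u v) J))).

Definition left_slice_holo (th : R) (f : quat -> quat) : Prop := slice_holo_core th f true.
Definition right_slice_holo (th : R) (f : quat -> quat) : Prop := slice_holo_core th f false.

Definition decay_bound (th : R) (f : quat -> quat) : Prop :=
  exists a C, 0 < a /\ 0 <= C /\
    forall s, in_sector th s ->
      qnorm (f s) <= C * Rpower (qnorm s) (1 + a) / (1 + Rpower (qnorm s) (1 + 2 * a)).

Definition PsiL (th : R) (f : quat -> quat) : Prop := left_slice_holo th f /\ decay_bound th f.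
Definition PsiR (th : R) (f : quat -> quat) : Prop := right_slice_holo th f /\ decay_bound th f.

Definition qpartial (ek : quat) (f : quat -> quat) (q : quat) : quat :=
  mkQ (Derive (fun h => q0 (f (qadd q (qscale h ek)))) 0)
      (Derive (fun h => q1 (f (qadd q (qscale h ek)))) 0)
      (Derive (fun h => q2 (f (qadd q (qscale h ek)))) 0)
      (Derive (fun h => q3 (f (qadd q (qscale h ek)))) 0).

Definition CF_left (f : quat -> quat) (q : quat) : quat :=
  qadd (qpartial qone f q)
   (qadd (qmul e1 (qpartial e1 f q))
     (qadd (qmul e2 (qpartial e2 f q)) (qmul e3 (qpartial e3 f q)))).

Definition CF_right (f : quat -> quat) (q : quat) : quat :=
  qadd (qpartial qone f q)
   (qadd (qmul (qpartial e1 f q) e1)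
     (qadd (qmul (qpartial e2 f q) e2) (qmul (qpartial e3 f q) e3))).

(* Main.v *)
(** Write [R_s] for the inverse of [Q_{c,s}(T)].

    Decay.  With [A = (s - T0) R_s] and [N = e1 T1 + e2 T2 + e3 T3] one has
    [R_s = A A - (sum_i T_i R_s e_i) (N R_s)], and each of these four factors is half the
    sum or the difference of an S-resolvent of [T] and one of [Tbar]; hence
    [|R_s| <= M / |s|^2], which makes the integrals absolutely convergent.  The identity
    needs [T_i R_s = R_s T_i] on [dom T], obtained from the factorisation
    [Q_{c,a} = (a - T)(a - Tbar)] at the real point [a = -1].

    Independence.  On the slices, [R_{u+Jv} = E + J O] where [E] and [O] do not depend on
    [J] and commute with left multiplications.  Adding the two halves of the path gives
    [-2 Im (e^{i phi} (E + i O)(al + i be))] for the left as well as for the right integral,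
    where [al], [be] are the slice components of [f]; this no longer depends on [J], and
    Cauchy-Riemann turns its derivative in [phi] into an exact derivative along the ray.

    Determinacy.  [Df] equals [-2 be / v] at [u + J v].  So [Df = Dg] forces equal [be]'s,
    then, by Cauchy-Riemann, a difference of the [al]'s that is constant along horizontal
    lines and tends to zero at infinity: [f = g] off the real axis. *)
Require Import Defs.
From Stdlib Require Import Reals Lra Lia List Classical ClassicalEpsilon Psatz.
From Coquelicot Require Import Coquelicot.
Open Scope R_scope.

(** * Left quaternionic modules *)

(** The obstacle throughout is noncommutativity: left multiplication by [s] commutes neither with
    the units [e_i] nor, in general, with [R_p]. Only real points and points of one plane [C_J] are
    exempt. Everything else goes through the intertwining relation [p c = c s], which carries [R_s]
    to [R_p], and through uniqueness of the solution of [Q_{c,s}(T) x = w].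

    A single S-resolvent bounds only a combination such as [A + N R_s]; the type hypothesis on
    [Tbar], whose resolvent is the same [R_s], separates the two terms.

    [V] comes without a distinguished complex structure, so holomorphy is a real Cauchy-Riemann
    system for a pair of [V]-valued functions. The contour theorem is replaced by differentiating
    the integral over a truncated ray in the angle: only two boundary terms remain, at radii tending
    to zero and to infinity. *)

Lemma quat_ext (a b : quat) :
  q0 a = q0 b -> q1 a = q1 b -> q2 a = q2 b -> q3 a = q3 b -> a = b.
Proof. destruct a, b; simpl; intros; subst; reflexivity. Qed.

Ltac quat_ring :=
  apply quat_ext;
  cbv [q0 q1 q2 q3 qadd qopp qsub qscale qmul qconj qreal qone e1 e2 e3 qexpJ slice_pt];
  first [ring | field; auto with real].

Inductive hexp : Type :=
| HAtom (n : nat)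
| HZero
| HAdd (a b : hexp)
| HOpp (a : hexp)
| HScal (r : R) (a : hexp)
| HLm (q : quat) (a : hexp).

Fixpoint hcoef (n : nat) (e : hexp) : quat :=
  match e with
  | HAtom k => if Nat.eqb n k then qone else qreal 0
  | HZero => qreal 0
  | HAdd a b => qadd (hcoef n a) (hcoef n b)
  | HOpp a => qopp (hcoef n a)
  | HScal r a => qscale r (hcoef n a)
  | HLm q a => qmul q (hcoef n a)
  end.

Fixpoint hcoefs_agree (e e' : hexp) (k len : nat) : Prop :=
  match len with
  | O => True
  | S l => hcoef k e = hcoef k e' /\ hcoefs_agree e e' (S k) l
  end.

Section Norm.
Context {V : CompleteNormedModule R_AbsRing}.
Implicit Types x y : V.

Lemma vnorm_scal (r : R) x : norm (scal r x) <= Rabs r * norm x.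
Proof. exact (norm_scal r x). Qed.
Lemma vnorm_plus x y : norm (plus x y) <= norm x + norm y.
Proof. exact (norm_triangle x y). Qed.
Lemma vnorm_opp x : norm (opp x) = norm x.
Proof. exact (norm_opp x). Qed.
Lemma vnorm_minus x y : norm (minus x y) <= norm x + norm y.
Proof. rewrite <- (vnorm_opp y). exact (norm_triangle x (opp y)). Qed.

End Norm.

Section LeftModule.
Context {V : CompleteNormedModule R_AbsRing}.
Variables (lm : quat -> V -> V) (rm : V -> quat -> V).
Hypothesis HV : two_sided lm rm.

Lemma lm_plus a u w : lm a (plus u w) = plus (lm a u) (lm a w).
Proof. apply HV. Qed.
Lemma lm_qadd a b u : lm (qadd a b) u = plus (lm a u) (lm b u).
Proof. apply HV. Qed.
Lemma lm_qmul a b u : lm (qmul a b) u = lm a (lm b u).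
Proof. apply HV. Qed.
Lemma lm_qreal r u : lm (qreal r) u = scal r u.
Proof. apply HV. Qed.
Lemma norm_lm a u : norm (lm a u) = qnorm a * norm u.
Proof. apply HV. Qed.
Lemma lm_qone u : lm qone u = u.
Proof. unfold qone. rewrite lm_qreal. exact (scal_one u). Qed.
Lemma lm_qscale r a u : lm (qscale r a) u = scal r (lm a u).
Proof.
  replace (qscale r a) with (qmul (qreal r) a) by quat_ring.
  rewrite lm_qmul. apply lm_qreal.
Qed.
Lemma lm_qzero u : lm (qreal 0) u = zero.
Proof. rewrite lm_qreal. exact (scal_zero_l u). Qed.
Lemma lm_qopp a u : lm (qopp a) u = opp (lm a u).
Proof.
  replace (qopp a) with (qscale (-1) a) by quat_ring.
  rewrite lm_qscale. exact (scal_opp_one (lm a u)).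
Qed.
Lemma opp_scal (u : V) : opp u = scal (-1) u.
Proof. symmetry. exact (scal_opp_one u). Qed.
Lemma lm_zero a : lm a zero = zero.
Proof.
  rewrite <- (lm_qzero zero), <- lm_qmul.
  replace (qmul a (qreal 0)) with (qreal 0) by quat_ring. reflexivity.
Qed.

Fixpoint hden (env : list V) (e : hexp) : V :=
  match e with
  | HAtom k => nth k env zero
  | HZero => zero
  | HAdd a b => plus (hden env a) (hden env b)
  | HOpp a => opp (hden env a)
  | HScal r a => scal r (hden env a)
  | HLm q a => lm q (hden env a)
  end.

Fixpoint hsum (c : nat -> quat) (env : list V) (k : nat) : V :=
  match env with
  | nil => zero
  | x :: l => plus (lm (c k) x) (hsum c l (S k))
  end.

Lemma hsum_zero env k : hsum (fun _ => qreal 0) env k = zero.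
Proof.
  revert k; induction env as [|x l IH]; intros k; simpl; auto.
  rewrite IH, lm_qzero. apply plus_zero_l.
Qed.

Lemma hsum_qadd c d env k :
  hsum (fun n => qadd (c n) (d n)) env k = plus (hsum c env k) (hsum d env k).
Proof.
  revert k; induction env as [|x l IH]; intros k; simpl.
  - now rewrite plus_zero_l.
  - rewrite IH, lm_qadd.
    rewrite <- !plus_assoc. f_equal. rewrite !plus_assoc. f_equal. apply plus_comm.
Qed.

Lemma hsum_qmul q c env k : hsum (fun n => qmul q (c n)) env k = lm q (hsum c env k).
Proof.
  revert k; induction env as [|x l IH]; intros k; simpl.
  - now rewrite lm_zero.
  - now rewrite IH, lm_qmul, lm_plus.
Qed.

Lemma hsum_ext c d env k : (forall n, c n = d n) -> hsum c env k = hsum d env k.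
Proof.
  intros E; revert k; induction env as [|x l IH]; intros k; simpl; auto.
  now rewrite IH, E.
Qed.

Lemma hsum_atom env k j :
  hsum (fun n => if Nat.eqb n (k + j) then qone else qreal 0) env k = nth j env zero.
Proof.
  revert k j; induction env as [|x l IH]; intros k j; simpl.
  - now destruct j.
  - destruct j as [|j].
    + rewrite Nat.add_0_r, Nat.eqb_refl, lm_qone.
      assert (forall m l', (k < m)%nat ->
        hsum (fun n => if Nat.eqb n k then qone else qreal 0) l' m = zero) as E.
      { intros m l'; revert m; induction l' as [|y l' IH']; intros m Hm; simpl; auto.
        rewrite IH' by lia. destruct (Nat.eqb_spec m k); [lia|].
        rewrite lm_qzero. apply plus_zero_l. }
      rewrite E by lia. apply plus_zero_r.
    + destruct (Nat.eqb_spec k (k + S j)); [lia|].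
      rewrite lm_qzero, plus_zero_l, <- (IH (S k) j).
      apply hsum_ext. intros n'. now replace (k + S j)%nat with (S k + j)%nat by lia.
Qed.

(** All quaternions act from the left, so every expression collapses to a sum of atoms with one left
    coefficient each; an identity of expressions then follows from finitely many quaternion
    identities. *)
Lemma hden_hsum env e : hden env e = hsum (fun n => hcoef n e) env 0.
Proof.
  induction e as [j| |a IHa b IHb|a IH|r a IH|q a IH]; simpl.
  - symmetry. apply (hsum_atom env 0 j).
  - symmetry; apply hsum_zero.
  - now rewrite hsum_qadd, IHa, IHb.
  - rewrite (hsum_ext _ (fun n => qmul (qreal (-1)) (hcoef n a)))
      by (intros; quat_ring).
    rewrite hsum_qmul, <- IH, lm_qreal. symmetry. exact (scal_opp_one _).
  - rewrite (hsum_ext _ (fun n => qmul (qreal r) (hcoef n a)))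
      by (intros; quat_ring).
    now rewrite hsum_qmul, <- IH, lm_qreal.
  - now rewrite hsum_qmul, <- IH.
Qed.

Lemma hsum_agree e e' env k :
  hcoefs_agree e e' k (length env) ->
  hsum (fun n => hcoef n e) env k = hsum (fun n => hcoef n e') env k.
Proof.
  revert k; induction env as [|x l IH]; intros k; simpl; auto.
  intros [E1 E2]. now rewrite E1, IH.
Qed.

Lemma hden_agree env e e' :
  hcoefs_agree e e' 0 (length env) -> hden env e = hden env e'.
Proof. intros; rewrite !hden_hsum; now apply hsum_agree. Qed.

End LeftModule.

Ltac hmem x l :=
  match l with
  | nil => constr:(false)
  | x :: _ => constr:(true)
  | _ :: ?l' => hmem x l'
  end.
Ltac hindex x l :=
  match l with
  | x :: _ => constr:(O)
  | _ :: ?l' => let n := hindex x l' in constr:(S n)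
  end.
Ltac hatoms lm t l :=
  lazymatch t with
  | @plus _ ?a ?b => let l1 := hatoms lm a l in hatoms lm b l1
  | @minus _ ?a ?b => let l1 := hatoms lm a l in hatoms lm b l1
  | @opp _ ?a => hatoms lm a l
  | @scal _ _ _ ?a => hatoms lm a l
  | lm _ ?a => hatoms lm a l
  | @zero _ => l
  | _ => match hmem t l with
         | true => l
         | false => constr:(t :: l)
         end
  end.
Ltac hreify lm t l :=
  lazymatch t with
  | @plus _ ?a ?b =>
      let x := hreify lm a l in let y := hreify lm b l in constr:(HAdd x y)
  | @minus _ ?a ?b =>
      let x := hreify lm a l in let y := hreify lm b l in constr:(HAdd x (HOpp y))
  | @opp _ ?a => let x := hreify lm a l in constr:(HOpp x)
  | @scal _ _ ?r ?a => let x := hreify lm a l in constr:(HScal r x)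
  | lm ?q ?a => let x := hreify lm a l in constr:(HLm q x)
  | @zero _ => constr:(HZero)
  | _ => let n := hindex t l in constr:(HAtom n)
  end.

(* Decides equalities in the left quaternionic module [V] by comparing the
   quaternion coefficient of every atom on both sides; coefficient identities
   which are not ring identities are left to the user. *)
Ltac hmod HV :=
  match type of HV with
  | @two_sided ?V ?lm ?rm =>
    lazymatch goal with
    | |- ?a = ?b =>
      let l0 := constr:(@nil V) in
      let l1 := hatoms lm a l0 in
      let l := hatoms lm b l1 in
      let x := hreify lm a l in
      let y := hreify lm b l in
      change (hden lm l x = hden lm l y);
      apply (hden_agree lm rm HV);
      cbn [hcoefs_agree hcoef Nat.eqb length];
      repeat (apply conj); try exact I; try solve [quat_ring]
    end
  end.

(** * The resolvent commutes with the components *)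

Section Operators.
Context {V : CompleteNormedModule R_AbsRing}.
Variables (lm : quat -> V -> V) (rm : V -> quat -> V).
Hypothesis HV : two_sided lm rm.
Variables (dom : V -> Prop) (T0 T1 T2 T3 : V -> V).
Hypothesis HT : is_KC lm rm dom T0 T1 T2 T3.

Definition component (A : V -> V) : Prop := A = T0 \/ A = T1 \/ A = T2 \/ A = T3.

Local Notation Q := (Qcs lm T0 T1 T2 T3).
Local Notation D2 := (dom2 lm dom T0 T1 T2 T3).
Local Notation Res := (Qinv lm dom T0 T1 T2 T3).
Local Notation rho := (in_rhoS lm dom T0 T1 T2 T3).

Lemma component0 : component T0. Proof. red; auto. Qed.
Lemma component1 : component T1. Proof. red; auto. Qed.
Lemma component2 : component T2. Proof. red; auto. Qed.
Lemma component3 : component T3. Proof. red; auto. Qed.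

Lemma dom_plus u w : dom u -> dom w -> dom (plus u w).
Proof. apply HT. Qed.
Lemma dom_lm a u : dom u -> dom (lm a u).
Proof. apply HT. Qed.
Lemma dom_scal r u : dom u -> dom (scal r u).
Proof. intros. rewrite <- (lm_qreal lm rm HV). now apply dom_lm. Qed.
Lemma dom_opp u : dom u -> dom (opp u).
Proof. intros. rewrite opp_scal. now apply dom_scal. Qed.

Lemma T_plus A u w : component A -> dom u -> dom w -> A (plus u w) = plus (A u) (A w).
Proof. intros HA. destruct HT as (_ & H & _). apply (H A HA). Qed.
Lemma T_lm A a u : component A -> dom u -> A (lm a u) = lm a (A u).
Proof. intros HA. destruct HT as (_ & H & _). apply (H A HA). Qed.
Lemma T_scal A r u : component A -> dom u -> A (scal r u) = scal r (A u).
Proof. intros. rewrite <- !(lm_qreal lm rm HV). now apply T_lm. Qed.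
Lemma T_opp A u : component A -> dom u -> A (opp u) = opp (A u).
Proof. intros. rewrite !opp_scal. now apply T_scal. Qed.

Lemma dom2_dom v : D2 v -> dom v.
Proof. now intros []. Qed.
Lemma dom2_component A v : component A -> D2 v -> dom (A v).
Proof.
  intros HA Hv. destruct HT as (_ & _ & _ & H).
  now destruct (H A A HA HA v Hv).
Qed.
Lemma T_comm A B v : component A -> component B -> D2 v -> A (B v) = B (A v).
Proof.
  intros HA HB Hv. destruct HT as (_ & _ & _ & H).
  now destruct (H A B HA HB v Hv).
Qed.
Lemma dom2_intro v : dom v -> (forall A, component A -> dom (A v)) -> D2 v.
Proof.
  intros Hv H. split; auto. unfold Top.
  repeat apply dom_plus; try apply dom_lm; apply H; unfold component; auto.
Qed.

Hint Resolve component0 component1 component2 component3 dom_plus dom_lm dom_scal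
  dom_opp dom2_dom dom2_component : kc.

Hint Extern 4 (dom _) => apply dom2_component : kc.

Ltac tlin1 A := first
  [ rewrite (T_plus A) by auto 12 with kc | rewrite (T_lm A) by auto 12 with kc
  | rewrite (T_scal A) by auto 12 with kc | rewrite (T_opp A) by auto 12 with kc ].
Ltac tlin := repeat (first
  [ tlin1 T0 | tlin1 T1 | tlin1 T2 | tlin1 T3
  | match goal with H : component ?A |- _ => tlin1 A end ]).

Lemma dom2_plus u w : D2 u -> D2 w -> D2 (plus u w).
Proof. intros; apply dom2_intro; auto with kc; intros; tlin; auto with kc. Qed.
Lemma dom2_lm a u : D2 u -> D2 (lm a u).
Proof. intros; apply dom2_intro; auto with kc; intros; tlin; auto with kc. Qed.
Lemma dom2_scal r u : D2 u -> D2 (scal r u).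
Proof. intros; apply dom2_intro; auto with kc; intros; tlin; auto with kc. Qed.
Lemma dom2_opp u : D2 u -> D2 (opp u).
Proof. intros; apply dom2_intro; auto with kc; intros; tlin; auto with kc. Qed.

Hint Resolve dom2_plus dom2_lm dom2_scal dom2_opp : kc.

Lemma Qcs_plus s u w : D2 u -> D2 w -> Q s (plus u w) = plus (Q s u) (Q s w).
Proof. intros; unfold Qcs; tlin; hmod HV. Qed.

(** The intertwiner [c] moves the spectral point: [p = s] covers every [c] commuting with [s], a
    real [p = s] covers all [c], and conjugation covers the change of imaginary unit. *)
Lemma Qcs_lm s p c u : D2 u -> qmul p c = qmul c s -> Q p (lm c u) = lm c (Q s u).
Proof.
  intros Hu E. unfold Qcs; tlin.
  assert (qmul (qmul p p) c = qmul c (qmul s s)) as E2.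
  { transitivity (qmul p (qmul p c)); [quat_ring|]. rewrite E.
    transitivity (qmul (qmul p c) s); [quat_ring|]. rewrite E. quat_ring. }
  rewrite <- !(lm_qmul lm rm HV), E2, E, !(lm_qmul lm rm HV). hmod HV.
Qed.

Lemma Qinv_spec s : rho s -> is_Qinv lm dom T0 T1 T2 T3 s (Res s).
Proof. intros H. unfold Qinv. apply epsilon_spec, H. Qed.

Lemma Qinv_dom2 s v : rho s -> D2 (Res s v).
Proof. intros H. now destruct (proj1 (Qinv_spec s H) v). Qed.
Lemma Qcs_Qinv s v : rho s -> Q s (Res s v) = v.
Proof. intros H. now destruct (proj1 (Qinv_spec s H) v). Qed.
Lemma Qinv_unique s x v : rho s -> D2 x -> Q s x = v -> Res s v = x.
Proof. intros H Hx <-. now apply (proj2 (Qinv_spec s H)). Qed.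

Hint Resolve Qinv_dom2 : kc.

Lemma Qinv_plus s u w : rho s -> Res s (plus u w) = plus (Res s u) (Res s w).
Proof.
  intros H. apply Qinv_unique; auto with kc.
  now rewrite Qcs_plus, !Qcs_Qinv by auto with kc.
Qed.
Lemma Qinv_lm s p c u : rho s -> rho p -> qmul p c = qmul c s ->
  Res p (lm c u) = lm c (Res s u).
Proof.
  intros H H' E. apply Qinv_unique; auto with kc.
  rewrite (Qcs_lm s) by auto with kc. now rewrite Qcs_Qinv.
Qed.
Lemma Qinv_scal s r u : rho s -> Res s (scal r u) = scal r (Res s u).
Proof.
  intros H. rewrite <- !(lm_qreal lm rm HV). apply Qinv_lm; auto. quat_ring.
Qed.
Lemma Qinv_opp s u : rho s -> Res s (opp u) = opp (Res s u).
Proof. intros. rewrite !opp_scal. now apply Qinv_scal. Qed.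

(** The parts [|T|^2] cancel in [Q_{c,p}(T) - Q_{c,s}(T)], leaving [(p^2 - s^2) - 2 (p - s) T_0]. It
    is applied to [R_s w] from the left, so [p] and [s] need not commute. *)
Lemma resolvent_identity p s w : rho p -> rho s ->
  minus (Res p w) (Res s w) =
  opp (Res p (minus (lm (qsub (qmul p p) (qmul s s)) (Res s w))
                    (scal 2 (lm (qsub p s) (T0 (Res s w)))))).
Proof.
  intros Hp Hs. set (x := Res s w).
  assert (w = plus (Q p x) (opp (minus (lm (qsub (qmul p p) (qmul s s)) x)
                    (scal 2 (lm (qsub p s) (T0 x)))))) as E.
  { transitivity (Q s x); [symmetry; now apply Qcs_Qinv|]. unfold Qcs. hmod HV. }
  rewrite E at 1. rewrite Qinv_plus, Qinv_opp by auto.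
  rewrite (Qinv_unique p x (Q p x)) by (unfold x; auto with kc).
  set (z := Res p _). hmod HV.
Qed.

(** * Commutation through a real point of both resolvent sets *)

Section RealPoint.
Variable a : R.
Hypothesis Ha : rho (qreal a).
Hypothesis Ha' : in_rhoS lm dom T0 (fun v => opp (T1 v)) (fun v => opp (T2 v))
                   (fun v => opp (T3 v)) (qreal a).

Local Notation Tp := (Top lm T0 T1 T2 T3).
Local Notation Tb := (Tbar lm T0 T1 T2 T3).
Local Notation Qb := (Qcs lm T0 (fun v => opp (T1 v)) (fun v => opp (T2 v)) (fun v => opp (T3 v))).
Local Notation D2b := (dom2 lm dom T0 (fun v => opp (T1 v)) (fun v => opp (T2 v))
                        (fun v => opp (T3 v))).

Lemma dom2_dom2_conj v : D2 v -> D2b v.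
Proof.
  intros Hv. split; auto with kc. unfold Top.
  repeat apply dom_plus; auto 12 with kc.
Qed.

Lemma Qcs_conj s v : dom (T1 v) -> dom (T2 v) -> dom (T3 v) -> Qb s v = Q s v.
Proof. intros; unfold Qcs; tlin. hmod HV. Qed.

(** The element [x] of [dom(T^2)] has the same image as [v] under [Q_{c,a}(Tbar)]. It also lies in
    [dom(Tbar^2)], where this operator is injective; hence [v = x]. *)
Lemma dom2_conj v : D2b v -> D2 v.
Proof.
  intros Hv. destruct Ha' as [B [HB1 HB2]].
  set (x := Res (qreal a) (Qb (qreal a) v)).
  assert (D2 x) as Hx by (unfold x; auto with kc).
  assert (Qb (qreal a) x = Qb (qreal a) v) as E.
  { rewrite Qcs_conj by auto with kc. now apply Qcs_Qinv. }
  rewrite <- (HB2 v Hv), <- E, HB2; auto. now apply dom2_dom2_conj.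
Qed.

Lemma Top_conj v : Top lm T0 (fun v => opp (T1 v)) (fun v => opp (T2 v))
  (fun v => opp (T3 v)) v = Tb v.
Proof. unfold Top, Tbar. hmod HV. Qed.

Definition shift (S : V -> V) (v : V) : V := minus (scal a v) (S v).

Lemma dom_Top v : D2 v -> dom (Tp v).
Proof. now intros []. Qed.
Lemma dom_Tbar v : D2 v -> dom (Tb v).
Proof. intros; unfold Tbar; auto 12 with kc. Qed.
Lemma dom_shift_Tbar v : D2 v -> dom (shift Tb v).
Proof. intros; unfold shift, minus; apply dom_plus; auto using dom_Tbar with kc. Qed.

(** The mixed terms [e_i e_j T_i T_j] cancel because the components commute and the units
    anticommute; a real [a] passes through both factors. *)
Lemma Top_Tbar_expand v : D2 v -> shift Tp (shift Tb v) = Q (qreal a) v.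
Proof.
  intros Hv. unfold shift, Top, Tbar, Qcs, minus. tlin.
  rewrite (T_comm T1 T0), (T_comm T2 T0), (T_comm T3 T0),
    (T_comm T2 T1), (T_comm T3 T1), (T_comm T3 T2) by auto with kc.
  hmod HV.
Qed.
Lemma Tbar_Top_expand v : D2 v -> shift Tb (shift Tp v) = Q (qreal a) v.
Proof.
  intros Hv. unfold shift, Top, Tbar, Qcs, minus. tlin.
  rewrite (T_comm T1 T0), (T_comm T2 T0), (T_comm T3 T0),
    (T_comm T2 T1), (T_comm T3 T1), (T_comm T3 T2) by auto with kc.
  hmod HV.
Qed.

(** A kernel element satisfies [T v = a v], so [T v] is again in the domain and [v] in [dom(T^2)],
    where the factorisation gives [Q_{c,a}(T) v = 0]. *)
Lemma shift_Top_inj u w : dom u -> dom w -> shift Tp u = shift Tp w -> u = w.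
Proof.
  intros Hu Hw E.
  set (v := minus u w).
  assert (dom v) as Hv by (unfold v, minus; auto with kc).
  assert (Tp v = scal a v) as E1.
  { unfold v at 2. transitivity (minus (scal a v) (minus (shift Tp u) (shift Tp w))).
    - unfold shift, v, Top, minus; tlin; hmod HV.
    - rewrite E. unfold v. hmod HV. }
  assert (D2 v) as Hv2 by (split; auto; rewrite E1; auto with kc).
  (* Zero is kept in the form [lm (qreal 0) v], to which [Qcs_lm] applies. *)
  assert (Q (qreal a) v = lm (qreal 0) v) as E2.
  { rewrite <- Tbar_Top_expand by auto. unfold shift at 2. rewrite E1.
    replace (minus (scal a v) (scal a v)) with (lm (qreal 0) v) by hmod HV.
    unfold shift, Tbar; tlin. hmod HV. }
  assert (v = lm (qreal 0) v) as E3.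
  { rewrite <- (Qinv_unique (qreal a) v (lm (qreal 0) v)) at 1 by auto.
    apply Qinv_unique; auto with kc.
    rewrite (Qcs_lm (qreal a)), E2 by (auto; quat_ring). hmod HV. }
  transitivity (plus v w); [unfold v; hmod HV|]. rewrite E3. hmod HV.
Qed.

(** Here [Tbar v = a v] only places [v] in [dom(Tbar^2)]; [dom2_conj] brings it back to
    [dom(T^2)]. *)
Lemma shift_Tbar_inj u w : dom u -> dom w -> shift Tb u = shift Tb w -> u = w.
Proof.
  intros Hu Hw E.
  set (v := minus u w).
  assert (dom v) as Hv by (unfold v, minus; auto with kc).
  assert (Tb v = scal a v) as E1.
  { unfold v at 2. transitivity (minus (scal a v) (minus (shift Tb u) (shift Tb w))).
    - unfold shift, v, Tbar, minus; tlin; hmod HV.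
    - rewrite E. unfold v. hmod HV. }
  assert (D2 v) as Hv2.
  { apply dom2_conj. split; auto. rewrite Top_conj, E1; auto with kc. }
  assert (Q (qreal a) v = lm (qreal 0) v) as E2.
  { rewrite <- Top_Tbar_expand by auto. unfold shift at 2. rewrite E1.
    replace (minus (scal a v) (scal a v)) with (lm (qreal 0) v) by hmod HV.
    unfold shift, Top; tlin. hmod HV. }
  assert (v = lm (qreal 0) v) as E3.
  { rewrite <- (Qinv_unique (qreal a) v (lm (qreal 0) v)) at 1 by auto.
    apply Qinv_unique; auto with kc.
    rewrite (Qcs_lm (qreal a)), E2 by (auto; quat_ring). hmod HV. }
  transitivity (plus v w); [unfold v; hmod HV|]. rewrite E3. hmod HV.
Qed.

Lemma T_Top A v : component A -> D2 v -> A (Tp v) = Tp (A v).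
Proof.
  intros HA Hv. unfold Top. tlin.
  now rewrite (T_comm A T0), (T_comm A T1), (T_comm A T2), (T_comm A T3) by auto with kc.
Qed.
Lemma T_Tbar A v : component A -> D2 v -> A (Tb v) = Tb (A v).
Proof.
  intros HA Hv. unfold Tbar. tlin.
  now rewrite (T_comm A T0), (T_comm A T1), (T_comm A T2), (T_comm A T3) by auto with kc.
Qed.
Lemma T_shift_Top A v : component A -> D2 v -> A (shift Tp v) = shift Tp (A v).
Proof.
  intros HA Hv. unfold shift, minus. pose proof (dom_Top v Hv). tlin. now rewrite T_Top.
Qed.
Lemma T_shift_Tbar A v : component A -> D2 v -> A (shift Tb v) = shift Tb (A v).
Proof.
  intros HA Hv. unfold shift, minus. pose proof (dom_Tbar v Hv). tlin. now rewrite T_Tbar.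
Qed.

(* [a - T] and [a - Tbar] factor [Q_a] and are injective, so a component commutes
   with the inverse of each factor, hence with [Q_a^{-1}]. *)
Lemma T_Qinv_real A w : component A -> dom w ->
  A (Res (qreal a) w) = Res (qreal a) (A w).
Proof.
  intros HA Hw. set (x := Res (qreal a) w). set (y := Res (qreal a) (A w)).
  assert (D2 x) as Hx by (unfold x; auto with kc).
  assert (D2 y) as Hy by (unfold y; auto with kc).
  assert (shift Tp (shift Tb x) = w) as Ex.
  { rewrite Top_Tbar_expand by auto. now apply Qcs_Qinv. }
  assert (shift Tp (shift Tb y) = A w) as Ey.
  { rewrite Top_Tbar_expand by auto. now apply Qcs_Qinv. }
  pose proof (dom_shift_Tbar x Hx) as Hx'. pose proof (dom_shift_Tbar y Hy) as Hy'.
  (* One degree of regularity is gained from [w] in [dom]: for [y = (a - Tbar) x] one has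
     [T y = a y - w], which is again in [dom]. *)
  assert (D2 (shift Tb x)) as Hx2.
  { split; auto. replace (Tp (shift Tb x)) with (minus (scal a (shift Tb x)) w).
    - unfold minus; auto with kc.
    - rewrite <- Ex. set (z := shift Tb x). unfold shift. hmod HV. }
  apply shift_Tbar_inj; auto with kc.
  rewrite <- T_shift_Tbar by auto.
  apply shift_Top_inj; auto with kc.
  now rewrite <- T_shift_Top, Ex, Ey by auto.
Qed.

Lemma dom2_T_Qinv_real A w : component A -> dom w -> D2 (A (Res (qreal a) w)).
Proof. intros. rewrite T_Qinv_real; auto with kc. Qed.

Lemma Qinv_real_comm s v : rho s ->
  Res s (Res (qreal a) v) = Res (qreal a) (Res s v).
Proof.
  intros Hs. apply Qinv_unique; auto with kc.
  set (u := Res s v).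
  assert (D2 u) as Hu by (unfold u; auto with kc).
  assert (forall A, component A -> A (A (Res (qreal a) u)) = Res (qreal a) (A (A u))) as E.
  { intros A HA. rewrite (T_Qinv_real A) by auto with kc. now rewrite (T_Qinv_real A) by auto with kc. }
  unfold Qcs. rewrite !E by auto with kc. rewrite (T_Qinv_real T0) by auto with kc.
  assert (forall c x, lm c (Res (qreal a) x) = Res (qreal a) (lm c x)) as L.
  { intros. symmetry. apply Qinv_lm; auto. quat_ring. }
  rewrite !L, <- Qinv_scal, <- !Qinv_plus by auto. f_equal.
  now apply (Qcs_Qinv s v).
Qed.

(** [T_i R_a] is a regularised [T_i]: it is everywhere defined, maps [dom T] into [dom(T^2)] and
    commutes with [Q_{c,s}(T)] on [dom(T^2)], so uniqueness applies to it. *)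
Lemma Qinv_T_Qinv_real s A v : rho s -> component A ->
  Res s (A (Res (qreal a) v)) = A (Res (qreal a) (Res s v)).
Proof.
  intros Hs HA. set (u := Res s v).
  assert (D2 u) as Hu by (unfold u; auto with kc).
  apply Qinv_unique; auto using dom2_T_Qinv_real with kc.
  assert (forall B, component B ->
    B (B (A (Res (qreal a) u))) = A (Res (qreal a) (B (B u)))) as E.
  { intros B HB.
    rewrite (T_Qinv_real A), (T_Qinv_real B) by auto with kc.
    rewrite (T_comm B A), <- (T_Qinv_real A) by auto with kc.
    rewrite (T_comm B A), (T_Qinv_real B) by auto with kc. reflexivity. }
  unfold Qcs. rewrite !E by auto with kc.
  replace (T0 (A (Res (qreal a) u))) with (A (Res (qreal a) (T0 u)))
    by (rewrite <- T_Qinv_real by auto with kc; apply T_comm; auto with kc).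
  assert (forall c x, lm c (A (Res (qreal a) x)) = A (Res (qreal a) (lm c x))) as L.
  { intros. rewrite (Qinv_lm (qreal a)) by (auto; quat_ring).
    now rewrite T_lm by auto with kc. }
  rewrite !L, <- T_scal, <- Qinv_scal by auto with kc.
  rewrite <- !T_plus by auto 12 with kc. rewrite <- !Qinv_plus by auto.
  do 2 f_equal. now apply (Qcs_Qinv s v).
Qed.

(** After [R_a] is applied, both sides agree by the regularised commutation; [R_a] is injective,
    [Q_{c,a}(T)] being its left inverse. *)
Lemma T_Qinv s A w : rho s -> component A -> dom w -> A (Res s w) = Res s (A w).
Proof.
  intros Hs HA Hw.
  assert (Res (qreal a) (A (Res s w)) = Res (qreal a) (Res s (A w))) as E.
  { rewrite <- T_Qinv_real by auto with kc.
    rewrite <- Qinv_T_Qinv_real by auto.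
    rewrite T_Qinv_real by auto. now apply Qinv_real_comm. }
  rewrite <- (Qcs_Qinv (qreal a) (A (Res s w))), E by auto.
  now apply Qcs_Qinv.
Qed.

End RealPoint.
End Operators.

(** * Sectors and resolvent estimates *)

Definition qnorm2 (a : quat) : R := q0 a ^ 2 + q1 a ^ 2 + q2 a ^ 2 + q3 a ^ 2.

Lemma qnorm2_ge0 a : 0 <= qnorm2 a.
Proof. unfold qnorm2. nra. Qed.
Lemma qnorm_ge0 a : 0 <= qnorm a.
Proof. apply sqrt_pos. Qed.
Lemma qnorm_sqr a : qnorm a ^ 2 = qnorm2 a.
Proof. unfold qnorm. rewrite pow2_sqrt; [reflexivity|apply qnorm2_ge0]. Qed.
Lemma qnorm_unique a r : 0 <= r -> r ^ 2 = qnorm2 a -> qnorm a = r.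
Proof.
  intros Hr E. change (sqrt (qnorm2 a) = r). rewrite <- E.
  replace (r ^ 2) with (r * r) by ring. now apply sqrt_square.
Qed.
Lemma qnorm_mul a b : qnorm (qmul a b) = qnorm a * qnorm b.
Proof.
  apply qnorm_unique.
  - apply Rmult_le_pos; apply qnorm_ge0.
  - rewrite Rpow_mult_distr, !qnorm_sqr. unfold qnorm2, qmul; simpl. ring.
Qed.
Lemma qnorm_scale r a : qnorm (qscale r a) = Rabs r * qnorm a.
Proof.
  apply qnorm_unique.
  - apply Rmult_le_pos; [apply Rabs_pos|apply qnorm_ge0].
  - rewrite Rpow_mult_distr, !qnorm_sqr, pow2_abs. unfold qnorm2; simpl. ring.
Qed.
Lemma qnorm_opp a : qnorm (qopp a) = qnorm a.
Proof.
  replace (qopp a) with (qscale (-1) a) by quat_ring.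
  rewrite qnorm_scale, Rabs_left by lra. ring.
Qed.
Lemma qnorm_conj a : qnorm (qconj a) = qnorm a.
Proof. unfold qnorm, qconj; simpl. f_equal. ring. Qed.
Lemma qnorm_qreal r : qnorm (qreal r) = Rabs r.
Proof.
  apply qnorm_unique; [apply Rabs_pos|]. rewrite pow2_abs. unfold qnorm2; simpl; ring.
Qed.
Lemma qnorm_e1 : qnorm e1 = 1.
Proof. apply qnorm_unique; [lra|]. unfold qnorm2; simpl; ring. Qed.
Lemma qnorm_e2 : qnorm e2 = 1.
Proof. apply qnorm_unique; [lra|]. unfold qnorm2; simpl; ring. Qed.
Lemma qnorm_e3 : qnorm e3 = 1.
Proof. apply qnorm_unique; [lra|]. unfold qnorm2; simpl; ring. Qed.
Lemma q0_le_qnorm a : q0 a <= qnorm a.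
Proof. pose proof (qnorm_ge0 a). pose proof (qnorm_sqr a). unfold qnorm2 in *. nra. Qed.
Lemma Rabs_q0_le a : Rabs (q0 a) <= qnorm a.
Proof.
  apply Rabs_le. split; [|apply q0_le_qnorm].
  rewrite <- qnorm_opp. pose proof (q0_le_qnorm (qopp a)). simpl in *. lra.
Qed.
(** Cauchy-Schwarz is the inequality [q0 x <= |x|] for [x = conj(a) b], since this [q0 x] is the
    Euclidean inner product. *)
Lemma qnorm_add a b : qnorm (qadd a b) <= qnorm a + qnorm b.
Proof.
  apply Rsqr_incr_0_var.
  2: { pose proof (qnorm_ge0 a); pose proof (qnorm_ge0 b); lra. }
  rewrite !Rsqr_pow2, qnorm_sqr.
  pose proof (q0_le_qnorm (qmul (qconj a) b)) as H.
  rewrite qnorm_mul, qnorm_conj in H.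
  pose proof (qnorm_sqr a); pose proof (qnorm_sqr b).
  unfold qnorm2, qmul, qconj, qadd in *; simpl in *. nra.
Qed.
Lemma qnorm_sub_sym a b : qnorm (qsub a b) = qnorm (qsub b a).
Proof. rewrite <- qnorm_opp. f_equal. quat_ring. Qed.
Lemma qnorm_eq0 a : qnorm a = 0 -> a = qreal 0.
Proof.
  intros H. pose proof (qnorm_sqr a) as E. rewrite H in E. unfold qnorm2 in E.
  apply quat_ext; simpl; nra.
Qed.
Lemma qnorm_pos a : a <> qreal 0 -> 0 < qnorm a.
Proof.
  intros H. destruct (qnorm_ge0 a) as [|E]; auto.
  now destruct H; apply qnorm_eq0.
Qed.
Lemma qnorm_sub_le a b : qnorm a <= qnorm b + qnorm (qsub a b).
Proof.
  replace a with (qadd b (qsub a b)) at 1 by quat_ring. apply qnorm_add.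
Qed.

Lemma in_S_sqr J : in_S J -> q1 J ^ 2 + q2 J ^ 2 + q3 J ^ 2 = 1.
Proof.
  intros [H0 H1]. pose proof (qnorm_sqr J) as E. rewrite H1 in E. unfold qnorm2 in E. nra.
Qed.
Lemma qmul_JJ J : in_S J -> qmul J J = qreal (-1).
Proof.
  intros HJ. pose proof (in_S_sqr J HJ). destruct HJ as [H0 _].
  apply quat_ext; simpl; rewrite ?H0; nra.
Qed.
Lemma in_S_opp J : in_S J -> in_S (qopp J).
Proof. intros [H0 H1]; split; [simpl; lra|now rewrite qnorm_opp]. Qed.
Lemma in_S_e1 : in_S e1.
Proof. split; [reflexivity|apply qnorm_e1]. Qed.
Lemma qinv_J J : in_S J -> qinv J = qopp J.
Proof.
  intros [H0 H1]. unfold qinv. rewrite H1. apply quat_ext; simpl; rewrite ?H0; field.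
Qed.
Lemma qnorm_slice u v J : in_S J -> qnorm (slice_pt u v J) = sqrt (u ^ 2 + v ^ 2).
Proof.
  intros HJ. pose proof (in_S_sqr J HJ). destruct HJ as [H0 _].
  unfold qnorm, slice_pt; simpl. f_equal. rewrite H0. nra.
Qed.
Lemma q0_slice u v J : in_S J -> q0 (slice_pt u v J) = u.
Proof. intros [H0 _]. simpl. rewrite H0. ring. Qed.
Lemma slice_polar r phi J :
  qscale r (qexpJ J phi) = slice_pt (r * cos phi) (r * sin phi) J.
Proof. quat_ring. Qed.
Lemma slice_pt_opp u v J : slice_pt u v (qopp J) = slice_pt u (- v) J.
Proof. quat_ring. Qed.
Lemma sqrt_polar r phi : 0 <= r -> sqrt ((r * cos phi) ^ 2 + (r * sin phi) ^ 2) = r.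
Proof.
  intros Hr. replace (_ + _) with (r * r).
  - now apply sqrt_square.
  - pose proof (sin2_cos2 phi) as E. unfold Rsqr in E. nra.
Qed.
Lemma qnorm_polar r phi J : in_S J -> 0 <= r -> qnorm (qscale r (qexpJ J phi)) = r.
Proof. intros. rewrite slice_polar, qnorm_slice by auto. now apply sqrt_polar. Qed.
Lemma qnorm_qexpJ J phi : in_S J -> qnorm (qexpJ J phi) = 1.
Proof.
  intros HJ. rewrite <- (qnorm_polar 1 phi J HJ) by lra. f_equal. quat_ring.
Qed.

Lemma cos_lt_abs th phi : Rabs phi < th -> th <= PI -> cos th < cos phi.
Proof.
  intros H1 H2. replace (cos phi) with (cos (Rabs phi)).
  - pose proof (Rabs_pos phi). apply cos_decreasing_1; lra.
  - unfold Rabs; destruct (Rcase_abs phi); auto using cos_neg.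
Qed.

(** An inequality between continuous functions of [s] replaces the polar form; it survives, as a
    weak inequality, the passage to the closure. *)
Lemma in_sector_cos th s : th <= PI -> in_sector th s -> cos th * qnorm s < q0 s.
Proof.
  intros Hth (r & J & phi & Hr & HJ & Hphi & ->).
  rewrite qnorm_polar, slice_polar, q0_slice by (auto; lra).
  pose proof (cos_lt_abs th phi Hphi Hth). nra.
Qed.

Lemma in_sector_closure_cos th s : th <= PI ->
  in_sector_closure th s -> cos th * qnorm s <= q0 s.
Proof.
  intros Hth H. apply Rnot_lt_le. intros Hs.
  (* Half of the gap suffices: [q0] and [cos th * qnorm] each change by at most [|s - p|]. *)
  destruct (H ((cos th * qnorm s - q0 s) / 2)) as (p & Hp & Hd); [lra|].
  pose proof (in_sector_cos th p Hth Hp).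
  pose proof (Rabs_q0_le (qsub s p)) as Hq.
  pose proof (qnorm_sub_le s p) as H1. pose proof (qnorm_sub_le p s) as H2.
  rewrite qnorm_sub_sym in H2.
  apply Rabs_le_between in Hq. simpl in Hq. pose proof (COS_bound th). nra.
Qed.

Lemma sector_dom_cos th u v : 0 < th < PI ->
  sector_dom th u v <-> cos th * sqrt (u ^ 2 + v ^ 2) < u.
Proof.
  intros Hth. split.
  - intros H. specialize (H e1 in_S_e1). apply in_sector_cos in H; [|lra].
    now rewrite qnorm_slice, q0_slice in H by apply in_S_e1.
  - intros H J HJ. set (r := sqrt (u ^ 2 + v ^ 2)) in *.
    assert (r ^ 2 = u ^ 2 + v ^ 2) as Er by (unfold r; rewrite pow2_sqrt; nra).
    assert (0 <= r) as Hr by apply sqrt_pos.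
    assert (0 < r) as Hr'.
    { destruct Hr as [|E]; auto. rewrite <- E in *. nra. }
    assert (-1 <= u / r <= 1) as Hb.
    { split; apply (Rmult_le_reg_r r); auto; unfold Rdiv; rewrite ?Rmult_assoc, Rinv_l by lra; nra. }
    set (phi := acos (u / r)).
    assert (cos phi = u / r) as Ec by (apply cos_acos; auto).
    pose proof (acos_bound (u / r)) as Hphi. fold phi in Hphi.
    assert (sin phi = Rabs v / r) as Es.
    { unfold phi. rewrite sin_acos by auto.
      replace (1 - (u / r)²) with ((Rabs v / r)²).
      - apply sqrt_Rsqr. apply Rdiv_le_0_compat; auto. apply Rabs_pos.
      - rewrite !Rsqr_div', <- Rsqr_abs. unfold Rsqr.
        field_simplify_eq; [nra|lra]. }
    assert (phi < th) as Hlt.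
    { apply Rnot_le_lt. intros Hc.
      assert (cos phi <= cos th) as Hcc.
      { destruct Hc as [Hc|<-]; [|lra]. left; apply cos_decreasing_1; lra. }
      rewrite Ec in Hcc. apply (Rmult_le_compat_r r) in Hcc; [|lra].
      unfold Rdiv in Hcc. rewrite Rmult_assoc, Rinv_l in Hcc; lra. }
    destruct (Rle_dec 0 v) as [Hv|Hv].
    + exists r, J, phi. split; [auto|split; [auto|split]].
      * rewrite Rabs_right; lra.
      * rewrite slice_polar, Ec, Es, Rabs_right by lra.
        f_equal; field; lra.
    (* The angle [acos (u / r)] is nonnegative, so a negative [v] is absorbed into the unit. *)
    + exists r, (qopp J), phi. pose proof (in_S_opp J HJ) as HJ'.
      split; [auto|split; [auto|split]].
      * rewrite Rabs_right; lra.
      * rewrite slice_polar, Ec, Es, slice_pt_opp, Rabs_left by lra.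
        f_equal; field; lra.
Qed.

Lemma sector_dom_polar th r phi : 0 < r -> Rabs phi < th ->
  sector_dom th (r * cos phi) (r * sin phi).
Proof.
  intros Hr Hphi J HJ. exists r, J, phi. repeat split; auto; try apply HJ.
  now rewrite slice_polar.
Qed.

Section Estimates.
Context {V : CompleteNormedModule R_AbsRing}.
Variables (lm : quat -> V -> V) (rm : V -> quat -> V).
Hypothesis HV : two_sided lm rm.
Variables (dom : V -> Prop) (T0 T1 T2 T3 : V -> V).
Hypothesis HT : is_KC lm rm dom T0 T1 T2 T3.
Variable omega : R.
Hypothesis Htype : of_type lm dom T0 T1 T2 T3 omega.
Hypothesis Htype' : of_type lm dom T0 (fun v => opp (T1 v)) (fun v => opp (T2 v))
                      (fun v => opp (T3 v)) omega.

Local Notation Q := (Qcs lm T0 T1 T2 T3).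
Local Notation D2 := (dom2 lm dom T0 T1 T2 T3).
Local Notation Res := (Qinv lm dom T0 T1 T2 T3).
Local Notation rho := (in_rhoS lm dom T0 T1 T2 T3).
Local Notation rho' := (in_rhoS lm dom T0 (fun v => opp (T1 v)) (fun v => opp (T2 v))
                      (fun v => opp (T3 v))).
Local Notation Res' := (Qinv lm dom T0 (fun v => opp (T1 v)) (fun v => opp (T2 v))
                      (fun v => opp (T3 v))).

Lemma rho_cos s : q0 s < cos omega * qnorm s -> rho s /\ rho' s.
Proof.
  destruct Htype as (Hom & H & _). destruct Htype' as (_ & H' & _).
  intros Hs. split; apply NNPP; intros Hn; [apply H in Hn|apply H' in Hn];
  apply in_sector_closure_cos in Hn; lra.
Qed.

Lemma rho_minus_one : rho (qreal (-1)) /\ rho' (qreal (-1)).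
Proof.
  destruct Htype as (Hom & _). apply rho_cos.
  rewrite qnorm_qreal, Rabs_left by lra. simpl.
  pose proof (cos_lt_abs PI omega). rewrite cos_PI, Rabs_right in H by lra. lra.
Qed.

Lemma T_Qinv_comm s A w : rho s -> component T0 T1 T2 T3 A -> dom w ->
  A (Res s w) = Res s (A w).
Proof.
  destruct rho_minus_one as [H1 H2].
  exact (T_Qinv lm rm HV dom T0 T1 T2 T3 HT (-1) H1 H2 s A w).
Qed.

(** The sign changes disappear in the squares, so [Q_{c,s}(Tbar)] and [Q_{c,s}(T)] agree on
    [dom(T^2)]; the estimates assumed for [Tbar] thus speak about the same [R_s]. *)
Lemma Qinv_conj s v : rho s -> rho' s -> Res' s v = Res s v.
Proof.
  intros Hs [B HB].
  assert (is_Qinv lm dom T0 (fun v => opp (T1 v)) (fun v => opp (T2 v))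
                      (fun v => opp (T3 v)) s (Res' s)) as [H1 H2].
  { unfold Qinv. apply epsilon_spec. now exists B. }
  assert (D2 (Res s v)) as Hd by now apply (Qinv_dom2 lm dom).
  rewrite <- (H2 (Res s v)) by now apply (dom2_dom2_conj lm rm HV dom T0 T1 T2 T3 HT).
  f_equal. rewrite (Qcs_conj lm rm HV dom T0 T1 T2 T3 HT).
  - symmetry. now apply (Qcs_Qinv lm dom).
  - eapply (dom2_component lm rm dom); eauto. red; auto.
  - eapply (dom2_component lm rm dom); eauto. red; auto.
  - eapply (dom2_component lm rm dom); eauto. red; auto.
Qed.

(** The bound on [(s - T_0) R_s] is kept as a second conclusion because it later controls [T_0 R_s],
    on which the local Lipschitz estimates rest. *)
Lemma Qinv_bound th : omega < th < PI -> exists M, 0 <= M /\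
  forall s, q0 s <= cos th * qnorm s -> s <> qreal 0 ->
    rho s /\ forall v, norm (Res s v) <= M / qnorm s ^ 2 * norm v /\
      norm (minus (lm s (Res s v)) (T0 (Res s v))) <= M / qnorm s * norm v.
Proof.
  intros Hth.
  pose proof Htype as (Hom & _ & Hb). pose proof Htype' as (_ & _ & Hb').
  destruct (Hb th Hth) as (C & HC & HC1). destruct (Hb' th Hth) as (C' & HC' & HC1').
  set (K := C + C').
  (* [K / |s|] bounds each half sum and half difference; [2 K^2] serves the two products in the
     identity for [R_s], and [K] the factor [A]. *)
  exists (K + 2 * K ^ 2). split; [unfold K; nra|].
  intros s Hs Hs0.
  pose proof (qnorm_pos s Hs0) as Hn.
  assert (~ in_sector th s) as Hsec.
  { intros H. apply in_sector_cos in H; lra. }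
  assert (cos th < cos omega) as Hcos.
  { apply cos_lt_abs; [rewrite Rabs_right|]; lra. }
  destruct (rho_cos s) as [Hr Hr']; [nra|].
  split; auto.
  assert (forall x, D2 (Res s x)) as HD by (intros; now apply (Qinv_dom2 lm dom)).
  pose proof (dom_plus lm rm dom T0 T1 T2 T3 HT) as dplus.
  pose proof (dom_lm lm rm dom T0 T1 T2 T3 HT) as dlm.
  pose proof (dom_opp lm rm HV dom T0 T1 T2 T3 HT) as dopp.
  assert (forall A x, component T0 T1 T2 T3 A -> D2 x -> dom (A x)) as dT
    by apply (dom2_component lm rm dom T0 T1 T2 T3 HT).
  pose proof (component0 T0 T1 T2 T3) as c0. pose proof (component1 T0 T1 T2 T3) as c1.
  pose proof (component2 T0 T1 T2 T3) as c2. pose proof (component3 T0 T1 T2 T3) as c3.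
  set (A := fun v => minus (lm s (Res s v)) (T0 (Res s v))).
  set (N := fun x => plus (lm e1 (T1 x)) (plus (lm e2 (T2 x)) (lm e3 (T3 x)))).
  (* The units stand inside [Res s] and cannot be moved past it, as they need not commute with [s];
     this is why the right S-resolvents are needed as well. *)
  set (N' := fun v => plus (T1 (Res s (lm e1 v)))
                     (plus (T2 (Res s (lm e2 v))) (T3 (Res s (lm e3 v))))).
  assert (0 <= C / qnorm s /\ 0 <= C' / qnorm s) as [HCs HCs'].
  { split; apply Rdiv_le_0_compat; lra. }
  assert (K / qnorm s = C / qnorm s + C' / qnorm s) as EK by (unfold K; field; lra).
  assert (forall x y v : V, norm x <= C / qnorm s * norm v -> norm y <= C' / qnorm s * norm v ->
    forall z, z = scal (/2) (plus x y) \/ z = scal (/2) (minus x y) ->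
    norm z <= K / qnorm s * norm v) as Hhalf.
  { intros x y v Hx Hy z Hz. pose proof (norm_ge_0 v). pose proof (norm_ge_0 z).
    assert (norm z <= /2 * (norm x + norm y)) as Hxy.
    { destruct Hz as [-> | ->]; 
      (eapply Rle_trans; [apply vnorm_scal|]);
      rewrite Rabs_right by lra; apply Rmult_le_compat_l; try lra.
      - apply vnorm_plus.
      - apply vnorm_minus. }
    rewrite EK. nra. }
  assert (forall v, norm (A v) <= K / qnorm s * norm v) as HA.
  { intros v. destruct (HC1 s Hsec Hs0 v) as [H1 _]. destruct (HC1' s Hsec Hs0 v) as [H2 _].
    apply (Hhalf _ _ v H1 H2). left. unfold SLinv, A. cbv zeta. rewrite Qinv_conj by auto.
    unfold Tbar. hmod HV. }
  assert (forall v, norm (N (Res s v)) <= K / qnorm s * norm v) as HN.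
  { intros v. destruct (HC1 s Hsec Hs0 v) as [H1 _]. destruct (HC1' s Hsec Hs0 v) as [H2 _].
    apply (Hhalf _ _ v H1 H2). right. unfold SLinv, N. cbv zeta. rewrite Qinv_conj by auto.
    unfold Tbar. hmod HV. }
  assert (forall v, norm (N' v) <= K / qnorm s * norm v) as HN'.
  { intros v. destruct (HC1 s Hsec Hs0 v) as [_ H1]. destruct (HC1' s Hsec Hs0 v) as [_ H2].
    apply (Hhalf _ _ v H1 H2). right. unfold SRinv, N'. cbv zeta.
    rewrite !Qinv_conj by auto.
    assert (forall B e, component T0 T1 T2 T3 B -> qconj e = qopp e ->
      B (Res s (lm (qconj e) v)) = opp (B (Res s (lm e v)))) as E.
    { intros B e HB ->. rewrite (lm_qopp lm rm HV).
      rewrite (Qinv_opp lm rm HV dom T0 T1 T2 T3 HT) by auto.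
      apply (T_opp lm rm HV dom T0 T1 T2 T3 HT); auto. apply HD. }
    rewrite (E T1 e1), (E T2 e2), (E T3 e3) by (auto; quat_ring).
    hmod HV. }
  intros v. split.
  2: { eapply Rle_trans; [apply HA|]. apply Rmult_le_compat_r; [apply norm_ge_0|].
       apply Rmult_le_compat_r; [left; now apply Rinv_0_lt_compat|]. nra. }
  (* Pulling the components through [R_s] turns the right-hand side into
     [R_s ((s - T_0)^2 - N^2) R_s v]; since [N^2 = -(T_1^2 + T_2^2 + T_3^2)], the middle factor is
     [Q_{c,s}(T)]. *)
  assert (Res s v = minus (A (A v)) (N' (N (Res s v)))) as E.
  { set (x := Res s v). pose proof (HD v) as Hx. fold x in Hx.
    assert (forall B w, component T0 T1 T2 T3 B -> dom w -> B (Res s w) = Res s (B w)) as HC2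
      by (intros; now apply T_Qinv_comm).
    assert (dom x) as Hdx by apply Hx.
    assert (forall c y, qmul s c = qmul c s -> lm c (Res s y) = Res s (lm c y)) as HL.
    { intros. symmetry. now apply (Qinv_lm lm rm HV dom T0 T1 T2 T3 HT). }
    assert (dom (N x)) as HdN by (unfold N; auto 10).
    unfold A. fold x. unfold N'.
    rewrite (HC2 T0), (HC2 T1), (HC2 T2), (HC2 T3) by (unfold minus; auto 10). rewrite HL by reflexivity.
    unfold minus. rewrite <- !(Qinv_opp lm rm HV dom T0 T1 T2 T3 HT) by auto.
    rewrite <- !(Qinv_plus lm rm HV dom T0 T1 T2 T3 HT) by auto.
    rewrite <- (Qinv_opp lm rm HV dom T0 T1 T2 T3 HT) by auto.
    rewrite <- (Qinv_plus lm rm HV dom T0 T1 T2 T3 HT) by auto.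
    unfold x at 1. f_equal. rewrite <- (Qcs_Qinv lm dom T0 T1 T2 T3 s v Hr). fold x.
    pose proof (T_plus lm rm dom T0 T1 T2 T3 HT) as tp.
    pose proof (T_lm lm rm dom T0 T1 T2 T3 HT) as tl.
    pose proof (T_opp lm rm HV dom T0 T1 T2 T3 HT) as topp.
    pose proof (T_comm lm rm dom T0 T1 T2 T3 HT) as tc.
    unfold N. rewrite !(tl T1), !(tl T2), !(tl T3) by auto 10.
    rewrite !(tp T0), !(tp T1), !(tp T2), !(tp T3) by auto 10.
    rewrite !(topp T0) by auto.
    rewrite !(tl T0), !(tl T1), !(tl T2), !(tl T3) by auto 10.
    rewrite (tc T2 T1), (tc T3 T1), (tc T3 T2) by auto.
    unfold Qcs. hmod HV. }
  rewrite E. eapply Rle_trans; [apply vnorm_minus|].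
  pose proof (HA v). pose proof (HN v). pose proof (HA (A v)). pose proof (HN' (N (Res s v))).
  assert (0 <= K / qnorm s) by lra. pose proof (norm_ge_0 v).
  assert ((K + 2 * K ^ 2) / qnorm s ^ 2 = K / qnorm s ^ 2 + 2 * (K / qnorm s) ^ 2) as ->
    by (field; lra).
  assert (0 <= K / qnorm s ^ 2) by (apply Rdiv_le_0_compat; [unfold K; lra|nra]).
  assert (norm (A (A v)) <= K / qnorm s * (K / qnorm s * norm v)) by
    (eapply Rle_trans; [eassumption|]; apply Rmult_le_compat_l; lra).
  assert (norm (N' (N (Res s v))) <= K / qnorm s * (K / qnorm s * norm v)) by
    (eapply Rle_trans; [eassumption|]; apply Rmult_le_compat_l; lra).
  nra.
Qed.

End Estimates.

(** * Improper and parametric integrals *)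

Section Improper.
Context {V : CompleteNormedModule R_AbsRing}.

Lemma ball_of_norm (x y : V) eps : norm (minus y x) < eps -> ball x eps y.
Proof. exact (norm_compat1 x y eps). Qed.

Lemma norm_plus_minus_mid (x y z : V) :
  norm (minus (plus x (plus y z)) y) <= norm x + norm z.
Proof.
  replace (minus (plus x (plus y z)) y) with (plus x z).
  - apply vnorm_plus.
  - unfold minus. rewrite <- plus_assoc. f_equal.
    rewrite (plus_comm y z), <- plus_assoc.
    symmetry. transitivity (plus z (zero : V)); [f_equal; exact (plus_opp_r y)|].
    exact (plus_zero_r z).
Qed.

Lemma norm_le_of_approx (x : V) : (forall eps, 0 < eps -> norm x <= eps) -> norm x = 0.
Proof.
  intros H. pose proof (norm_ge_0 x). apply Rle_antisym; auto.
  apply Rnot_lt_le. intros Hc. specialize (H (norm x / 2)). lra.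
Qed.

Lemma continuous_norm_eps {U : UniformSpace} (f : U -> V) x :
  (forall eps, 0 < eps -> locally x (fun y => norm (minus (f y) (f x)) < eps)) ->
  continuous f x.
Proof.
  intros H. apply filterlim_locally. intros eps.
  generalize (H eps (cond_pos eps)). apply filter_imp. intros y Hy.
  now apply ball_of_norm.
Qed.

Lemma continuous_eps_norm {U : UniformSpace} (f : U -> V) x eps : continuous f x ->
  0 < eps -> locally x (fun y => norm (minus (f y) (f x)) < eps).
Proof.
  intros H Heps.
  exact (proj1 (filterlim_locally_ball_norm f (f x)) H (mkposreal eps Heps)).
Qed.

Lemma norm_RInt_le_increment (g : R -> V) (W W' : R -> R) a b I :
  (forall r, 0 < r -> is_derive W r (W' r)) ->
  (forall r, 0 < r -> continuous W' r) ->
  (forall r, 0 < r -> norm (g r) <= W' r) ->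
  0 < a -> 0 < b -> is_RInt g a b I -> norm I <= Rabs (W b - W a).
Proof.
  intros HW HW' Hg.
  assert (forall a b I, 0 < a -> a <= b -> is_RInt g a b I -> norm I <= W b - W a) as H.
  { clear a b I. intros a b I Ha Hb HI.
    apply (norm_RInt_le g W' a b I (W b - W a)); auto.
    - intros; apply Hg; lra.
    - apply (is_RInt_derive W W'); rewrite Rmin_left, Rmax_right by lra; intros;
      [apply HW|apply HW']; lra. }
  intros Ha Hb HI. destruct (Rle_dec a b) as [Hab|Hab].
  - rewrite Rabs_right; [auto|]. pose proof (H a b I Ha Hab HI).
    pose proof (norm_ge_0 I). lra.
  - apply is_RInt_swap in HI. apply H in HI; [|lra|lra].
    rewrite norm_opp in HI. pose proof (norm_ge_0 I).
    rewrite Rabs_left1; lra.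
Qed.

(** Comparison through a primitive [W] of the majorant: by the Cauchy criterion it is enough that
    two truncated integrals differ by at most the increments of [W] near the two ends. *)
Lemma ex_RInt_gen_dominated (g : R -> V) (W W' : R -> R) (l0 l1 : R) :
  (forall r, 0 < r -> continuous g r) ->
  (forall r, 0 < r -> is_derive W r (W' r)) ->
  (forall r, 0 < r -> continuous W' r) ->
  (forall r, 0 < r -> norm (g r) <= W' r) ->
  filterlim W (at_right 0) (locally l0) ->
  filterlim W (Rbar_locally p_infty) (locally l1) ->
  ex_RInt_gen g (at_right 0) (Rbar_locally p_infty).
Proof.
  intros Hg HW HW' Hb H0 H1.
  assert (at_right 0 (fun r => 0 < r)) as P0.
  { exists (mkposreal 1 Rlt_0_1). auto. }
  assert (Rbar_locally p_infty (fun r => 0 < r)) as P1 by (now exists 0).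
  assert (forall a b, 0 < a -> 0 < b -> ex_RInt g a b) as Hex.
  { intros a b Ha Hb'. apply (ex_RInt_continuous g). intros z Hz. apply Hg.
    eapply Rlt_le_trans; [|apply Hz]. now apply Rmin_glb_lt. }
  apply (filterlimi_locally_cauchy (F := filter_prod (at_right 0) (Rbar_locally p_infty))
    (fun ab : R * R => is_RInt g (fst ab) (snd ab))).
  - apply (Filter_prod _ _ _ _ _ P0 P1). intros a b Ha Hb'. split.
    + destruct (Hex a b Ha Hb') as [I HI]. now exists I.
    + intros y1 y2 E1 E2. simpl in *.
      rewrite <- (is_RInt_unique _ _ _ _ E1). now apply is_RInt_unique.
  (* Each end contributes an increment of [W] between two points where [W] is within [eps / 4] of
     its limit, thus less than [eps / 2]. *)
  - intros eps. assert (0 < eps / 4) as He by (pose proof (cond_pos eps); lra).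
    exists (fun ab : R * R => (0 < fst ab /\ Rabs (W (fst ab) - l0) < eps / 4) /\
                          (0 < snd ab /\ Rabs (W (snd ab) - l1) < eps / 4)). split.
    + apply (Filter_prod _ _ _ (fun a => 0 < a /\ Rabs (W a - l0) < eps / 4)
        (fun b => 0 < b /\ Rabs (W b - l1) < eps / 4)); auto.
      * apply filter_and; auto.
        exact (proj1 (filterlim_locally W l0) H0 (mkposreal _ He)).
      * apply filter_and; auto.
        exact (proj1 (filterlim_locally W l1) H1 (mkposreal _ He)).
    + intros [a b] [a' b'] [[Ha Wa] [Hb1 Wb]] [[Ha' Wa'] [Hb1' Wb']] I I' HI HI'.
      simpl in *. apply ball_of_norm.
      destruct (Hex a' a Ha' Ha) as [K HK]. destruct (Hex b b' Hb1 Hb1') as [L HL].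
      assert (is_RInt g a' b' (plus K (plus I L))) as HI2.
      { apply (is_RInt_Chasles g a' a b' K); auto.
        now apply (is_RInt_Chasles g a b b'). }
      assert (I' = plus K (plus I L)) as ->.
      { rewrite <- (is_RInt_unique _ _ _ _ HI'). now apply is_RInt_unique. }
      eapply Rle_lt_trans; [exact (norm_plus_minus_mid K I L)|].
      pose proof (norm_RInt_le_increment g W W' _ _ _ HW HW' Hb Ha' Ha HK) as B1.
      pose proof (norm_RInt_le_increment g W W' _ _ _ HW HW' Hb Hb1 Hb1' HL) as B2.
      assert (Rabs (W a - W a') < eps / 2).
      { replace (W a - W a') with ((W a - l0) + - (W a' - l0)) by ring.
        eapply Rle_lt_trans; [apply Rabs_triang|]. rewrite Rabs_Ropp. lra. }
      assert (Rabs (W b' - W b) < eps / 2).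
      { replace (W b' - W b) with ((W b' - l1) + - (W b - l1)) by ring.
        eapply Rle_lt_trans; [apply Rabs_triang|]. rewrite Rabs_Ropp. lra. }
      lra.
Qed.

Lemma is_RInt_gen_reflect (g : R -> V) l :
  is_RInt_gen g (at_right 0) (Rbar_locally p_infty) l ->
  is_RInt_gen (fun t => g (- t)) (Rbar_locally m_infty) (at_left 0) l.
Proof.
  intros H P HP. destruct (H P HP) as [A B HA HB HAB].
  apply (Filter_prod _ _ _ (fun a => B (- a)) (fun b => A (- b))).
  - destruct HB as [M HM]. exists (- M). intros x Hx. apply HM. lra.
  - destruct HA as [d Hd]. exists d. intros x Hx Hx0. apply Hd; [|lra].
    unfold ball in *; simpl in *; unfold AbsRing_ball, abs, minus, plus, opp in *; simpl in *.
    rewrite <- Rabs_Ropp. now replace (- (- x + - 0)) with (x + - 0) by ring.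
  - intros a b Ha Hb. destruct (HAB (- b) (- a) Hb Ha) as (y & Hy & HPy).
    exists y. split; auto. simpl in *.
    apply is_RInt_swap, is_RInt_comp_opp, is_RInt_opp in Hy.
    rewrite opp_opp in Hy. revert Hy. apply is_RInt_ext. intros; apply opp_opp.
Qed.

End Improper.

(** * Differentiation under the integral sign *)

Section ParametricIntegral.
Context {V : CompleteNormedModule R_AbsRing}.
Variables (lm : quat -> V -> V) (rm : V -> quat -> V).
Hypothesis HV : two_sided lm rm.

Lemma continuous_slice_l (F : R -> R -> V) x y :
  continuous (fun z : R * R => F (fst z) (snd z)) (x, y) -> continuous (fun t => F t y) x.
Proof.
  intros H. apply (continuous_comp_2 (fun t => t) (fun _ => y) F); auto.
  - apply continuous_id.
  - apply continuous_const.
Qed.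
Lemma continuous_slice_r (F : R -> R -> V) x y :
  continuous (fun z : R * R => F (fst z) (snd z)) (x, y) -> continuous (fun t => F x t) y.
Proof.
  intros H. apply (continuous_comp_2 (fun _ => x) (fun t => t) F); auto.
  - apply continuous_const.
  - apply continuous_id.
Qed.

(** Tube lemma along the segment at height [y0]: the pointwise radii are replaced by a single one by
    compactness of [[a, b]], and both values are compared with the one at a centre. *)
Lemma uniform_slice (G : R -> R -> V) a b y0 :
  (forall x, a <= x <= b -> continuous (fun z : R * R => G (fst z) (snd z)) (x, y0)) ->
  forall eps, 0 < eps -> exists d : posreal, forall x y, a <= x <= b -> Rabs (y - y0) < d ->
    norm (minus (G x y) (G x y0)) <= eps.
Proof.
  intros HG eps Heps.
  assert (forall x, exists d : posreal, a <= x <= b -> forall x' y',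
    Rabs (x' - x) < d -> Rabs (y' - y0) < d ->
    norm (minus (G x' y') (G x y0)) < eps / 2) as Hd.
  { intros x. destruct (classic (a <= x <= b)) as [Hx|Hx].
    - assert (0 < eps / 2) as He by lra.
      destruct (continuous_eps_norm _ _ _ (HG x Hx) He) as [d Hd].
      exists d. intros _ x' y' H1 H2. apply (Hd (x', y')). split; assumption.
    (* A default radius: the compactness lemma takes a radius function on the whole line. *)
    - exists (mkposreal 1 Rlt_0_1). intros; contradiction. }
  set (delta := fun x => proj1_sig (constructive_indefinite_description _ (Hd x))).
  assert (forall x, a <= x <= b -> forall x' y',
    Rabs (x' - x) < delta x -> Rabs (y' - y0) < delta x ->
    norm (minus (G x' y') (G x y0)) < eps / 2) as Hdelta.
  { intros x. unfold delta. now destruct (constructive_indefinite_description _ (Hd x)). }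
  destruct (compactness_value_1d a b delta) as [d Hc].
  exists d. intros x y Hx Hy.
  destruct (NNPP _ (Hc x Hx)) as (t & Ht & Hxt & Hdt).
  pose proof (Hdelta t Ht x y Hxt ltac:(lra)) as B1.
  assert (Rabs (y0 - y0) < delta t) as H0.
  { unfold Rminus. rewrite Rplus_opp_r, Rabs_R0. apply cond_pos. }
  pose proof (Hdelta t Ht x y0 Hxt H0) as B2.
  replace (minus (G x y) (G x y0)) with
    (minus (minus (G x y) (G t y0)) (minus (G x y0) (G t y0))) by hmod HV.
  eapply Rle_trans; [apply vnorm_minus|]. lra.
Qed.

(** The remainder [F x y - F x y0 - (y - y0) dF x y0] is the integral of [dF x t - dF x y0] over [t]
    from [y0] to [y], and this integrand is small uniformly in [x]. *)
Lemma is_derive_RInt_parametric (F dF : R -> R -> V) a b y0 (d : posreal) : a <= b ->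
  (forall x y, a <= x <= b -> Rabs (y - y0) < d -> is_derive (fun t => F x t) y (dF x y)) ->
  (forall x y, a <= x <= b -> Rabs (y - y0) < d -> continuous (fun t => F t y) x) ->
  (forall x y, a <= x <= b -> Rabs (y - y0) < d ->
    continuous (fun z : R * R => dF (fst z) (snd z)) (x, y)) ->
  is_derive (fun y => RInt (fun x => F x y) a b) y0 (RInt (fun x => dF x y0) a b).
Proof.
  intros Hab HF HFc HdF.
  assert (Rabs (y0 - y0) < d) as H0.
  { unfold Rminus. rewrite Rplus_opp_r, Rabs_R0. apply cond_pos. }
  assert (forall y, Rabs (y - y0) < d -> is_RInt (fun x => F x y) a b (RInt (fun x => F x y) a b)) as IF.
  { intros y Hy. apply (RInt_correct (fun x => F x y)), (ex_RInt_continuous (fun x => F x y)).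
    rewrite Rmin_left, Rmax_right by auto. intros; auto. }
  assert (is_RInt (fun x => dF x y0) a b (RInt (fun x => dF x y0) a b)) as IdF.
  { apply (RInt_correct (fun x => dF x y0)), (ex_RInt_continuous (fun x => dF x y0)).
    rewrite Rmin_left, Rmax_right by auto. intros. apply continuous_slice_l; auto. }
  split; [apply is_linear_scal_l|].
  intros y Hy. replace y with y0 in * by (exact (is_filter_lim_locally_unique _ _ Hy)).
  clear y Hy. intros eps.
  (* The [+ 1] keeps the denominator positive when [a = b]; in all cases [(b - a) * eta <= eps]. *)
  set (eta := eps / (b - a + 1)).
  assert (0 < eta) as Heta by (apply Rdiv_lt_0_compat; [apply cond_pos|lra]).
  destruct (uniform_slice dF a b y0 (fun x Hx => HdF x y0 Hx H0) eta Heta) as [d' Hd'].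
  assert (0 < Rmin d d') as Hmin by (apply Rmin_pos; apply cond_pos).
  exists (mkposreal _ Hmin). intros y Hy.
  assert (Rabs (y - y0) < Rmin d d') as Hy' by exact Hy.
  assert (Rabs (y - y0) < d) as Hyd by (eapply Rlt_le_trans; [exact Hy'|apply Rmin_l]).
  assert (Rabs (y - y0) < d') as Hyd' by (eapply Rlt_le_trans; [exact Hy'|apply Rmin_r]).
  change (norm (minus y y0)) with (Rabs (y - y0)).
  change (minus y y0) with (y - y0).
  assert (forall x, a <= x <= b ->
    norm (minus (minus (F x y) (F x y0)) (scal (y - y0) (dF x y0))) <= Rabs (y - y0) * eta) as Hpt.
  { intros x Hx.
    assert (forall t, Rmin y0 y <= t <= Rmax y0 y ->
      Rabs (t - y0) < d /\ Rabs (t - y0) < d') as Ht.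
    { intros t Ht. assert (Rabs (t - y0) <= Rabs (y - y0)); [|lra].
      revert Ht. unfold Rmin, Rmax, Rabs.
      destruct (Rle_dec y0 y), (Rcase_abs (t - y0)), (Rcase_abs (y - y0)); lra. }
    assert (is_RInt (fun t => minus (dF x t) (dF x y0)) y0 y
      (minus (minus (F x y) (F x y0)) (scal (y - y0) (dF x y0)))) as HI.
    { apply (is_RInt_minus (fun t => dF x t) (fun _ => dF x y0)).
      - apply (is_RInt_derive (fun t => F x t)).
        + intros t Ht'. apply HF; auto. now apply Ht.
        + intros t Ht'. apply (continuous_slice_r dF). apply HdF; auto. now apply Ht.
      - apply (is_RInt_const y0 y (dF x y0)). }
    destruct (Rle_dec y0 y) as [Hle|Hle].
    - rewrite (Rabs_right (y - y0)) by lra.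
      apply (norm_RInt_le_const _ y0 y _ eta Hle) in HI; auto.
      intros t Ht'. apply Hd'; auto. apply Ht. now rewrite Rmin_left, Rmax_right.
    - apply is_RInt_swap in HI. rewrite (Rabs_left (y - y0)) by lra.
      apply (norm_RInt_le_const _ y y0 _ eta) in HI; [|lra|].
      + rewrite norm_opp in HI. lra.
      + intros t Ht'. apply Hd'; auto. apply Ht. rewrite Rmin_right, Rmax_left; lra. }
  assert (is_RInt (fun x => minus (minus (F x y) (F x y0)) (scal (y - y0) (dF x y0))) a b
    (minus (minus (RInt (fun x => F x y) a b) (RInt (fun x => F x y0) a b))
           (scal (y - y0) (RInt (fun x => dF x y0) a b)))) as HI.
  { apply (is_RInt_minus (fun x => minus (F x y) (F x y0)) (fun x => scal (y - y0) (dF x y0))).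
    - apply (is_RInt_minus (fun x => F x y) (fun x => F x y0)); auto.
    - apply (is_RInt_scal (fun x => dF x y0)); auto. }
  apply (norm_RInt_le_const _ a b _ _ Hab Hpt) in HI.
  eapply Rle_trans; [exact HI|].
  assert ((b - a) * eta <= eps).
  { unfold eta. replace ((b - a) * (eps / (b - a + 1))) with (eps * ((b - a) / (b - a + 1)))
      by (field; lra).
    rewrite <- (Rmult_1_r eps) at 2. apply Rmult_le_compat_l; [left; apply cond_pos|].
    apply (Rmult_le_reg_r (b - a + 1)); [lra|]. unfold Rdiv.
    rewrite Rmult_assoc, Rinv_l by lra. lra. }
  pose proof (Rabs_pos (y - y0)). nra.
Qed.

End ParametricIntegral.

(** * Rotation of the integration ray *)

Definition diff2 {W : NormedModule R_AbsRing} (P : R -> R -> W) (u v : R) (Pu Pv : W) : Prop :=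
  filterdiff (fun z : R * R => P (fst z) (snd z)) (locally (u, v))
    (fun z : R * R => plus (scal (fst z) Pu) (scal (snd z) Pv)).

Definition cont2 {W : UniformSpace} (P : R -> R -> W) (u v : R) : Prop :=
  continuous (fun z : R * R => P (fst z) (snd z)) (u, v).

(* [P + i N] is holomorphic on [D], with derivative [Pu + i Nu]. *)
Definition CR_pair {W : NormedModule R_AbsRing} (D : R -> R -> Prop)
  (P N Pu Nu : R -> R -> W) : Prop :=
  forall u v, D u v ->
    diff2 P u v (Pu u v) (opp (Nu u v)) /\ diff2 N u v (Nu u v) (Pu u v) /\
    cont2 Pu u v /\ cont2 Nu u v.

Lemma diff2_cont2 {W : NormedModule R_AbsRing} (P : R -> R -> W) u v Pu Pv :
  diff2 P u v Pu Pv -> cont2 P u v.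
Proof.
  intros H. apply (filterdiff_continuous (fun z : R * R => P (fst z) (snd z)) (u, v)).
  eexists; exact H.
Qed.

Lemma diff2_comp {W : NormedModule R_AbsRing} (P : R -> R -> W) (f g : R -> R) t f' g' Pu Pv :
  diff2 P (f t) (g t) Pu Pv -> is_derive f t f' -> is_derive g t g' ->
  is_derive (fun t => P (f t) (g t)) t (plus (scal f' Pu) (scal g' Pv)).
Proof.
  intros HP Hf Hg. unfold is_derive in *.
  apply (filterdiff_ext_lin _
    (fun y : R => plus (scal (scal y f') Pu) (scal (scal y g') Pv))).
  - apply (filterdiff_comp'_2 f g P t (fun y => scal y f') (fun y => scal y g')
      (fun a b => plus (scal a Pu) (scal b Pv))); auto.
  - intros y. rewrite scal_distr_l, !scal_assoc. reflexivity.
Qed.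

Lemma is_derive_scal_fct {W : NormedModule R_AbsRing} (k : R -> R) (G : R -> W) t k' G' :
  is_derive k t k' -> is_derive G t G' ->
  is_derive (fun t => scal (k t) (G t)) t (plus (scal k' (G t)) (scal (k t) G')).
Proof.
  intros Hk HG. unfold is_derive in *.
  apply (filterdiff_ext_lin _
    (fun y : R => plus (scal (scal y k') (G t)) (scal (k t) (scal y G')))).
  - apply (filterdiff_scal_fct t k G (fun y => scal y k') (fun y => scal y G')); auto.
    exact Rmult_comm.
  - intros y. rewrite scal_distr_l, !scal_assoc. f_equal. f_equal. apply Rmult_comm.
Qed.

Lemma cont2_comp {W : UniformSpace} (P : R -> R -> W) (f g : R -> R -> R) x y :
  cont2 f x y -> cont2 g x y -> cont2 P (f x y) (g x y) ->
  cont2 (fun x y => P (f x y) (g x y)) x y.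
Proof.
  intros Hf Hg HP. unfold cont2.
  exact (continuous_comp_2 (fun z : R * R => f (fst z) (snd z)) (fun z : R * R => g (fst z) (snd z)) P (x, y) Hf Hg HP).
Qed.
Lemma cont2_plus {W : NormedModule R_AbsRing} (P N : R -> R -> W) x y :
  cont2 P x y -> cont2 N x y -> cont2 (fun x y => plus (P x y) (N x y)) x y.
Proof.
  intros. exact (continuous_plus (fun z : R * R => P (fst z) (snd z))
    (fun z : R * R => N (fst z) (snd z)) (x, y) H H0).
Qed.
Lemma cont2_opp {W : NormedModule R_AbsRing} (P : R -> R -> W) x y :
  cont2 P x y -> cont2 (fun x y => opp (P x y)) x y.
Proof. intros. exact (continuous_opp (fun z : R * R => P (fst z) (snd z)) (x, y) H). Qed.
Lemma cont2_minus {W : NormedModule R_AbsRing} (P N : R -> R -> W) x y :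
  cont2 P x y -> cont2 N x y -> cont2 (fun x y => minus (P x y) (N x y)) x y.
Proof. intros; unfold minus; apply cont2_plus; auto; now apply cont2_opp. Qed.
Lemma cont2_scal {W : NormedModule R_AbsRing} (k : R -> R -> R) (P : R -> R -> W) x y :
  cont2 k x y -> cont2 P x y -> cont2 (fun x y => scal (k x y) (P x y)) x y.
Proof.
  intros. exact (continuous_scal (fun z : R * R => k (fst z) (snd z))
    (fun z : R * R => P (fst z) (snd z)) (x, y) H H0).
Qed.
Lemma cont2_mult (k l : R -> R -> R) x y :
  cont2 k x y -> cont2 l x y -> cont2 (fun x y => k x y * l x y) x y.
Proof. exact (cont2_scal (W := R_NormedModule) k l x y). Qed.
Lemma cont2_fst x y : cont2 (fun x _ : R => x) x y.
Proof. exact (continuous_fst x y). Qed.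
Lemma cont2_cos x y : cont2 (fun _ y : R => cos y) x y.
Proof.
  apply (continuous_comp (fun z : R * R => snd z) cos); [apply continuous_snd|].
  apply continuous_cos.
Qed.
Lemma cont2_sin x y : cont2 (fun _ y : R => sin y) x y.
Proof.
  apply (continuous_comp (fun z : R * R => snd z) sin); [apply continuous_snd|].
  apply continuous_sin.
Qed.

Section Contour.
Context {V : CompleteNormedModule R_AbsRing}.
Variables (lm : quat -> V -> V) (rm : V -> quat -> V).
Hypothesis HV : two_sided lm rm.

Section Rotation.
Variables (D : R -> R -> Prop) (P N Pu Nu : R -> R -> V).
Hypothesis HCR : CR_pair D P N Pu Nu.

(* The imaginary and real parts of [e^{i phi} (P + i N)] at [r e^{i phi}]. *)
Definition im_ray (r phi : R) : V :=
  plus (scal (sin phi) (P (r * cos phi) (r * sin phi)))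
       (scal (cos phi) (N (r * cos phi) (r * sin phi))).
Definition re_ray (r phi : R) : V :=
  minus (scal (cos phi) (P (r * cos phi) (r * sin phi)))
        (scal (sin phi) (N (r * cos phi) (r * sin phi))).

(** With [h = P + i N], this is [Re (e^{i phi} h + r e^{2 i phi} h')]: at once the [phi]-derivative
    of [Im (e^{i phi} h)] and the [r]-derivative of [Re (r e^{i phi} h)]. *)
Definition dim_ray (r phi : R) : V :=
  plus (re_ray r phi)
    (scal r (minus (scal (cos phi ^ 2 - sin phi ^ 2) (Pu (r * cos phi) (r * sin phi)))
                   (scal (2 * (sin phi * cos phi)) (Nu (r * cos phi) (r * sin phi))))).

Lemma is_derive_im_ray r phi : D (r * cos phi) (r * sin phi) ->
  is_derive (fun t => im_ray r t) phi (dim_ray r phi).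
Proof.
  intros HD. destruct (HCR _ _ HD) as (HP & HN & _ & _).
  assert (is_derive (fun t => r * cos t) phi (- r * sin phi)) as Hc
    by (auto_derive; auto; ring).
  assert (is_derive (fun t => r * sin t) phi (r * cos phi)) as Hs
    by (auto_derive; auto; ring).
  pose proof (diff2_comp P _ _ _ _ _ _ _ HP Hc Hs) as DP.
  pose proof (diff2_comp N _ _ _ _ _ _ _ HN Hc Hs) as DN.
  pose proof (is_derive_plus _ _ _ _ _
    (is_derive_scal_fct sin _ _ _ _ (is_derive_sin phi) DP)
    (is_derive_scal_fct cos _ _ _ _ (is_derive_cos phi) DN)) as H.
  replace (dim_ray r phi) with
   (plus
       (plus (scal (cos phi) (P (r * cos phi) (r * sin phi)))
          (scal (sin phi)
             (plus (scal (- r * sin phi) (Pu (r * cos phi) (r * sin phi)))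
                (scal (r * cos phi) (opp (Nu (r * cos phi) (r * sin phi)))))))
       (plus (scal (- sin phi) (N (r * cos phi) (r * sin phi)))
          (scal (cos phi)
             (plus (scal (- r * sin phi) (Nu (r * cos phi) (r * sin phi)))
                (scal (r * cos phi) (Pu (r * cos phi) (r * sin phi))))))).
  - exact H.
  - unfold dim_ray, re_ray. hmod HV.
Qed.

Lemma is_derive_re_ray r phi : D (r * cos phi) (r * sin phi) ->
  is_derive (fun t => scal t (re_ray t phi)) r (dim_ray r phi).
Proof.
  intros HD. destruct (HCR _ _ HD) as (HP & HN & _ & _).
  assert (is_derive (fun t => t * cos phi) r (cos phi)) as Hc
    by (auto_derive; auto; ring).
  assert (is_derive (fun t => t * sin phi) r (sin phi)) as Hs
    by (auto_derive; auto; ring).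
  pose proof (diff2_comp P _ _ _ _ _ _ _ HP Hc Hs) as DP.
  pose proof (diff2_comp N _ _ _ _ _ _ _ HN Hc Hs) as DN.
  assert (is_derive (fun t : R => t) r 1) as Hid by (auto_derive; auto).
  pose proof (is_derive_scal_fct _ _ _ _ _ Hid
   (is_derive_minus _ _ _ _ _
    (is_derive_scal_fct _ _ _ _ _ (is_derive_const (cos phi) r) DP)
    (is_derive_scal_fct _ _ _ _ _ (is_derive_const (sin phi) r) DN))) as H.
  replace (dim_ray r phi) with
    (plus (scal 1 (re_ray r phi)) (scal r
      (minus
        (plus (scal 0 (P (r * cos phi) (r * sin phi)))
          (scal (cos phi)
             (plus (scal (cos phi) (Pu (r * cos phi) (r * sin phi)))
                (scal (sin phi) (opp (Nu (r * cos phi) (r * sin phi)))))))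
        (plus (scal 0 (N (r * cos phi) (r * sin phi)))
          (scal (sin phi)
             (plus (scal (cos phi) (Nu (r * cos phi) (r * sin phi)))
                (scal (sin phi) (Pu (r * cos phi) (r * sin phi))))))))).
  - exact H.
  - unfold dim_ray, re_ray. hmod HV.
Qed.

Lemma cont2_polar_x r phi : cont2 (fun r phi => r * cos phi) r phi.
Proof. apply cont2_mult; [apply cont2_fst|apply cont2_cos]. Qed.
Lemma cont2_polar_y r phi : cont2 (fun r phi => r * sin phi) r phi.
Proof. apply cont2_mult; [apply cont2_fst|apply cont2_sin]. Qed.

Lemma cont2_polar {W : UniformSpace} (G : R -> R -> W) r phi :
  cont2 G (r * cos phi) (r * sin phi) ->
  cont2 (fun r phi => G (r * cos phi) (r * sin phi)) r phi.
Proof.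
  apply (cont2_comp G (fun r phi => r * cos phi) (fun r phi => r * sin phi)).
  - apply cont2_polar_x.
  - apply cont2_polar_y.
Qed.

Lemma cont2_im_ray r phi : D (r * cos phi) (r * sin phi) -> cont2 im_ray r phi.
Proof.
  intros HD. destruct (HCR _ _ HD) as (HP & HN & _ & _).
  pose proof (diff2_cont2 _ _ _ _ _ HP) as CP. pose proof (diff2_cont2 _ _ _ _ _ HN) as CN.
  apply (cont2_plus (W := V)); apply (cont2_scal (W := V)).
  - apply cont2_sin.
  - now apply cont2_polar.
  - apply cont2_cos.
  - now apply cont2_polar.
Qed.
Lemma cont2_re_ray r phi : D (r * cos phi) (r * sin phi) -> cont2 re_ray r phi.
Proof.
  intros HD. destruct (HCR _ _ HD) as (HP & HN & _ & _).
  pose proof (diff2_cont2 _ _ _ _ _ HP) as CP. pose proof (diff2_cont2 _ _ _ _ _ HN) as CN.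
  apply (cont2_minus (W := V)); apply (cont2_scal (W := V)).
  - apply cont2_cos.
  - now apply cont2_polar.
  - apply cont2_sin.
  - now apply cont2_polar.
Qed.
Lemma cont2_dim_ray r phi : D (r * cos phi) (r * sin phi) -> cont2 dim_ray r phi.
Proof.
  intros HD. destruct (HCR _ _ HD) as (HP & HN & HPu & HNu).
  unfold dim_ray. apply (cont2_plus (W := V)); [now apply cont2_re_ray|].
  assert (forall k : R -> R -> R, cont2 k r phi -> cont2 (fun r phi => k r phi ^ 2) r phi) as Sq.
  { intros k Hk. apply (cont2_mult k (fun r phi => k r phi * 1)); auto.
    apply (cont2_mult k (fun _ _ => 1)); auto. apply continuous_const. }
  apply (cont2_scal (W := V)); [apply cont2_fst|].
  apply (cont2_minus (W := V)); apply (cont2_scal (W := V)).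
  - apply (cont2_minus (W := R_NormedModule) (fun r phi => cos phi ^ 2) (fun r phi => sin phi ^ 2)).
    + exact (Sq (fun _ phi => cos phi) (cont2_cos r phi)).
    + exact (Sq (fun _ phi => sin phi) (cont2_sin r phi)).
  - now apply cont2_polar.
  - apply (cont2_mult (fun _ _ => 2)); [apply continuous_const|].
    apply (cont2_mult (fun _ phi => sin phi)); [apply cont2_sin|apply cont2_cos].
  - now apply cont2_polar.
Qed.

(** Both derivatives being [dim_ray], the angular derivative of the truncated integral is the
    difference of the boundary terms [r * re_ray] at [b] and [a]; integrating it over [[p1, p2]]
    gives the estimate. The open margin around [[p1, p2]] allows differentiation at the end
    angles. *)
Lemma norm_rotation a b p1 p2 m : 0 < a <= b -> p1 <= p2 ->
  (exists c d, c < p1 /\ p2 < d /\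
    forall r phi, 0 < r -> c < phi < d -> D (r * cos phi) (r * sin phi)) ->
  (forall phi, p1 <= phi <= p2 -> norm (scal a (re_ray a phi)) <= m /\
                                  norm (scal b (re_ray b phi)) <= m) ->
  norm (minus (RInt (fun r => im_ray r p2) a b) (RInt (fun r => im_ray r p1) a b))
    <= (p2 - p1) * (2 * m).
Proof.
  intros Hab Hp (c & d & Hc & Hd & HD) Hm.
  set (dI := fun phi => minus (scal b (re_ray b phi)) (scal a (re_ray a phi))).
  assert (forall phi, p1 <= phi <= p2 ->
    is_derive (fun t => RInt (fun r => im_ray r t) a b) phi (dI phi)) as Hder.
  { intros phi Hphi. assert (0 < Rmin (phi - c) (d - phi)) as Hmin by (apply Rmin_pos; lra).
    assert (forall y, Rabs (y - phi) < Rmin (phi - c) (d - phi) -> c < y < d) as Hy.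
    { intros y Hy. pose proof (Rmin_l (phi - c) (d - phi)).
      pose proof (Rmin_r (phi - c) (d - phi)). apply Rabs_lt_between in Hy. lra. }
    assert (is_RInt (fun r => dim_ray r phi) a b (dI phi)) as HI.
    { apply (is_RInt_derive (fun t => scal t (re_ray t phi)));
      rewrite Rmin_left, Rmax_right by lra; intros x Hx.
      - apply is_derive_re_ray, HD; lra.
      - apply (continuous_slice_l dim_ray), cont2_dim_ray, HD; lra. }
    rewrite <- (is_RInt_unique _ _ _ _ HI).
    apply (is_derive_RInt_parametric lm rm HV im_ray dim_ray a b phi (mkposreal _ Hmin)); [lra| | |];
    intros x y Hx Hyd; simpl in Hyd; apply Hy in Hyd.
    - apply is_derive_im_ray, HD; lra.
    - apply (continuous_slice_l im_ray), cont2_im_ray, HD; lra.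
    - apply cont2_dim_ray, HD; lra. }
  assert (is_RInt dI p1 p2
    (minus (RInt (fun r => im_ray r p2) a b) (RInt (fun r => im_ray r p1) a b))) as HI.
  { apply (is_RInt_derive (fun t => RInt (fun r => im_ray r t) a b));
    rewrite Rmin_left, Rmax_right by lra; intros x Hx; auto.
    apply (continuous_minus (V := V) (fun x => scal b (re_ray b x)) (fun x => scal a (re_ray a x)));
    [ apply (continuous_scal_r (V := V) b (fun x => re_ray b x))
    | apply (continuous_scal_r (V := V) a (fun x => re_ray a x)) ];
    apply (continuous_slice_r re_ray), cont2_re_ray, HD; lra. }
  refine (norm_RInt_le_const dI p1 p2 _ _ Hp _ HI).
  intros x Hx. destruct (Hm x Hx). unfold dI.
  eapply Rle_trans; [apply vnorm_minus|]. lra.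
Qed.

(** The boundary terms play the part of the two circular arcs of a closed contour; they vanish with
    [m] at both ends. *)
Lemma rotation_invariance p1 p2 (m : R -> R) l1 l2 : p1 <= p2 ->
  (exists c d, c < p1 /\ p2 < d /\
    forall r phi, 0 < r -> c < phi < d -> D (r * cos phi) (r * sin phi)) ->
  (forall r phi, 0 < r -> p1 <= phi <= p2 -> norm (scal r (re_ray r phi)) <= m r) ->
  filterlim m (at_right 0) (locally 0) ->
  filterlim m (Rbar_locally p_infty) (locally 0) ->
  is_RInt_gen (fun r => im_ray r p1) (at_right 0) (Rbar_locally p_infty) l1 ->
  is_RInt_gen (fun r => im_ray r p2) (at_right 0) (Rbar_locally p_infty) l2 ->
  l1 = l2.
Proof.
  intros Hp HD Hm Hm0 Hm1 I1 I2.
  pose proof (is_RInt_gen_minus _ _ _ _ I2 I1) as I.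
  assert (norm (minus l2 l1) = 0) as E.
  { apply norm_le_of_approx. intros eps Heps.
    (* Chosen so that [(p2 - p1) * (2 * eta) <= eps / 2], also when [p1 = p2]. *)
    set (eta := eps / (2 * (2 * (p2 - p1) + 1))).
    assert (0 < eta) as Heta by (apply Rdiv_lt_0_compat; lra).
    assert (0 < eps / (2 * (@norm_factor R_AbsRing V + 1))) as Heps2.
    { apply Rdiv_lt_0_compat; auto. pose proof (@norm_factor_gt_0 R_AbsRing V). lra. }
    assert (0 < eps / 2) as Heps3 by lra.
    assert (locally (minus l2 l1) (fun y => norm (minus y (minus l2 l1)) < eps / 2)) as HL
      by exact (locally_ball_norm (minus l2 l1 : V) (mkposreal _ Heps3)).
    destruct (I _ HL) as [A B HA HB HAB].
    assert (at_right 0 (fun r => A r /\ 0 < r < 1 /\ Rabs (m r - 0) < eta)) as HA'.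
    { apply filter_and; auto. apply filter_and.
      - exists (mkposreal 1 Rlt_0_1). intros y Hy Hy0. split; auto.
        unfold ball in Hy; simpl in Hy; unfold AbsRing_ball, abs, minus, plus, opp in Hy; simpl in Hy.
        rewrite Ropp_0, Rplus_0_r in Hy. apply Rabs_lt_between in Hy. lra.
      - exact (proj1 (filterlim_locally m 0) Hm0 (mkposreal _ Heta)). }
    assert (Rbar_locally p_infty (fun r => B r /\ 1 < r /\ Rabs (m r - 0) < eta)) as HB'.
    { apply filter_and; auto. apply filter_and.
      - now exists 1.
      - exact (proj1 (filterlim_locally m 0) Hm1 (mkposreal _ Heta)). }
    destruct (filter_ex _ HA') as (a & Aa & Ha & Ma).
    destruct (filter_ex _ HB') as (b & Bb & Hb & Mb).
    destruct (HAB a b Aa Bb) as (y & Hy & Hyn). simpl in Hy.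
    rewrite Rminus_0_r in Ma, Mb. apply Rabs_lt_between in Ma. apply Rabs_lt_between in Mb.
    assert (forall p, p1 <= p <= p2 -> ex_RInt (fun r => im_ray r p) a b) as Hex.
    { intros p Hpp. apply (ex_RInt_continuous (fun r => im_ray r p)).
      rewrite Rmin_left, Rmax_right by lra. intros z Hz.
      destruct HD as (c & d & Hc & Hd & HD).
      apply (continuous_slice_l im_ray), cont2_im_ray, HD; lra. }
    assert (y = minus (RInt (fun r => im_ray r p2) a b) (RInt (fun r => im_ray r p1) a b)) as Ey.
    { rewrite <- (is_RInt_unique _ _ _ _ Hy). apply is_RInt_unique.
      apply (is_RInt_minus (fun r => im_ray r p2) (fun r => im_ray r p1));
      apply (RInt_correct (V := V)), Hex; lra. }
    assert (norm y <= (p2 - p1) * (2 * eta)) as By.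
    { rewrite Ey. apply norm_rotation; auto; [lra|].
      intros phi Hphi. pose proof (Hm a phi). pose proof (Hm b phi). split; lra. }
    assert ((p2 - p1) * (2 * eta) <= eps / 2) as Be.
    { unfold eta. apply (Rmult_le_reg_r (2 * (2 * (p2 - p1) + 1))); [lra|].
      field_simplify; [|lra]. nra. }
    replace (minus l2 l1) with (minus y (minus y (minus l2 l1))) by hmod HV.
    eapply Rle_trans; [apply vnorm_minus|]. lra. }
  apply norm_eq_zero in E.
  transitivity (minus l2 (minus l2 l1)); [hmod HV|]. rewrite E.
  exact (minus_zero_r l2).
Qed.

End Rotation.
End Contour.

(** * Holomorphy of the resolvent *)

Lemma qinv_r a : a <> qreal 0 -> qmul a (qinv a) = qone.
Proof.
  intros Ha. pose proof (qnorm_pos a Ha) as Hn. pose proof (qnorm_sqr a) as E.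
  unfold qinv. rewrite E. assert (qnorm2 a <> 0) as H0 by nra. unfold qnorm2 in *.
  apply quat_ext; simpl; field; simpl in H0; intros H; apply H0; rewrite <- H; ring.
Qed.

Lemma in_S_conjugate a J : a <> qreal 0 -> in_S J -> in_S (qmul (qinv a) (qmul J a)).
Proof.
  intros Ha [H0 H1]. split.
  - unfold qinv. set (n := / _). simpl. rewrite H0. ring.
  - rewrite !qnorm_mul, H1, Rmult_1_l, Rmult_comm, <- qnorm_mul, (qinv_r a Ha).
    unfold qone. rewrite qnorm_qreal. apply Rabs_R1.
Qed.

Lemma qnorm_slice_sub u v u' v' J : in_S J ->
  qnorm (qsub (slice_pt u' v' J) (slice_pt u v J)) = sqrt ((u' - u) ^ 2 + (v' - v) ^ 2).
Proof.
  intros HJ. rewrite <- (qnorm_slice _ _ J HJ). f_equal. quat_ring.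
Qed.

Lemma sqrt_le_Rabs x y : sqrt (x ^ 2 + y ^ 2) <= Rabs x + Rabs y.
Proof.
  apply Rsqr_incr_0_var; [|pose proof (Rabs_pos x); pose proof (Rabs_pos y); lra].
  rewrite !Rsqr_pow2, pow2_sqrt by nra.
  rewrite <- (pow2_abs x), <- (pow2_abs y).
  pose proof (Rabs_pos x); pose proof (Rabs_pos y). nra.
Qed.

Lemma locally_slice u v J (d : R) : in_S J -> 0 < d ->
  locally (u, v) (fun z : R * R =>
    qnorm (qsub (slice_pt (fst z) (snd z) J) (slice_pt u v J)) < d).
Proof.
  intros HJ Hd. assert (0 < d / 2) as Hd2 by lra.
  exists (mkposreal _ Hd2). intros [u' v'] [H1 H2]. simpl in *.
  rewrite qnorm_slice_sub by auto. eapply Rle_lt_trans; [apply sqrt_le_Rabs|].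
  assert (Rabs (u' - u) < d / 2) by exact H1.
  assert (Rabs (v' - v) < d / 2) by exact H2. lra.
Qed.

(** * Calculus of Cauchy-Riemann pairs *)

Section Pairs.
Context {V : CompleteNormedModule R_AbsRing}.
Variables (lm : quat -> V -> V) (rm : V -> quat -> V).
Hypothesis HV : two_sided lm rm.

Lemma is_linear_pair (a b : V) :
  is_linear (fun z : R * R => plus (scal (fst z) a) (scal (snd z) b)).
Proof.
  apply (is_linear_comp (fun z : R * R => (scal (fst z) a, scal (snd z) b))
    (fun z : V * V => plus (fst z) (snd z))); [|exact (is_linear_plus (V := V))].
  apply is_linear_prod.
  - apply (is_linear_comp (fun z : R * R => fst z) (fun k : R => scal k a));
    [apply is_linear_fst|exact (is_linear_scal_l (V := V) a)].
  - apply (is_linear_comp (fun z : R * R => snd z) (fun k : R => scal k b));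
    [apply is_linear_snd|exact (is_linear_scal_l (V := V) b)].
Qed.

Lemma is_linear_lm a : is_linear (lm a).
Proof.
  split.
  - apply (lm_plus lm rm HV).
  - intros k x. change (lm a (scal k x) = scal k (lm a x)). hmod HV.
  - exists (qnorm a + 1). pose proof (qnorm_ge0 a). split; [lra|].
    intros x. rewrite (norm_lm lm rm HV). pose proof (norm_ge_0 x). nra.
Qed.

Lemma diff2_plus (P N : R -> R -> V) u v Pu Pv Nu Nv :
  diff2 P u v Pu Pv -> diff2 N u v Nu Nv ->
  diff2 (fun u v => plus (P u v) (N u v)) u v (plus Pu Nu) (plus Pv Nv).
Proof.
  intros HP HN. unfold diff2 in *.
  eapply filterdiff_ext_lin; [exact (filterdiff_plus_fct _ _ _ _ HP HN)|].
  intros z. cbv beta.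
  change (plus (plus (scal (fst z) Pu) (scal (snd z) Pv))
               (plus (scal (fst z) Nu) (scal (snd z) Nv)) =
          plus (scal (fst z) (plus Pu Nu)) (scal (snd z) (plus Pv Nv))).
  hmod HV.
Qed.

Lemma diff2_linear (l : V -> V) (P : R -> R -> V) u v Pu Pv : is_linear l ->
  diff2 P u v Pu Pv -> diff2 (fun u v => l (P u v)) u v (l Pu) (l Pv).
Proof.
  intros Hl HP. unfold diff2 in *.
  eapply filterdiff_ext_lin;
  [exact (filterdiff_comp' _ l (u, v) _ l HP (filterdiff_linear l Hl))|].
  intros z. cbv beta. now rewrite (linear_plus l Hl), !(linear_scal l Hl).
Qed.

Lemma diff2_scal (k : R -> R -> R) (P : R -> R -> V) u v ku kv Pu Pv :
  diff2 (W := R_NormedModule) k u v ku kv -> diff2 P u v Pu Pv ->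
  diff2 (fun u v => scal (k u v) (P u v)) u v
    (plus (scal ku (P u v)) (scal (k u v) Pu)) (plus (scal kv (P u v)) (scal (k u v) Pv)).
Proof.
  intros Hk HP. unfold diff2 in *.
  eapply filterdiff_ext_lin;
  [exact (filterdiff_scal_fct (u, v) _ _ _ _ Rmult_comm Hk HP)|].
  intros z. cbv beta.
  change (plus (scal (fst z * ku + snd z * kv) (P u v))
               (scal (k u v) (plus (scal (fst z) Pu) (scal (snd z) Pv))) =
    plus (scal (fst z) (plus (scal ku (P u v)) (scal (k u v) Pu)))
         (scal (snd z) (plus (scal kv (P u v)) (scal (k u v) Pv)))).
  hmod HV.
Qed.

Lemma cont2_linear (l : V -> V) (P : R -> R -> V) u v : is_linear l ->
  cont2 P u v -> cont2 (fun u v => l (P u v)) u v.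
Proof.
  intros Hl HP. apply (continuous_comp (fun z : R * R => P (fst z) (snd z)) l); auto.
  exact (linear_cont l _ Hl).
Qed.

Lemma diff2_eq (P N : R -> R -> V) u v Pu Pv Nu Nv :
  diff2 P u v Pu Pv -> (forall u v, N u v = P u v) -> Nu = Pu -> Nv = Pv ->
  diff2 N u v Nu Nv.
Proof.
  intros H E -> ->. unfold diff2 in *. revert H. apply filterdiff_ext. intros; now rewrite E.
Qed.

Lemma CR_pair_plus D (P N Pu Nu P' N' Pu' Nu' : R -> R -> V) :
  CR_pair D P N Pu Nu -> CR_pair D P' N' Pu' Nu' ->
  CR_pair D (fun u v => plus (P u v) (P' u v)) (fun u v => plus (N u v) (N' u v))
    (fun u v => plus (Pu u v) (Pu' u v)) (fun u v => plus (Nu u v) (Nu' u v)).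
Proof.
  intros H H' u v HD. destruct (H u v HD) as (H1 & H2 & H3 & H4).
  destruct (H' u v HD) as (H1' & H2' & H3' & H4'). split; [|split; [|split]].
  - apply (diff2_eq _ _ _ _ _ _ _ _ (diff2_plus _ _ _ _ _ _ _ _ H1 H1')); auto.
    hmod HV.
  - exact (diff2_plus _ _ _ _ _ _ _ _ H2 H2').
  - now apply (cont2_plus (W := V)).
  - now apply (cont2_plus (W := V)).
Qed.

(** Leibniz rule for the product [(a + i b)(P + i N)], written out in real and imaginary parts. *)
Lemma CR_pair_mul D (a b au bu : R -> R -> R) (P N Pu Nu : R -> R -> V) :
  CR_pair (W := R_NormedModule) D a b au bu -> CR_pair D P N Pu Nu ->
  CR_pair D
    (fun u v => minus (scal (a u v) (P u v)) (scal (b u v) (N u v)))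
    (fun u v => plus (scal (a u v) (N u v)) (scal (b u v) (P u v)))
    (fun u v => plus (minus (scal (au u v) (P u v)) (scal (bu u v) (N u v)))
                     (minus (scal (a u v) (Pu u v)) (scal (b u v) (Nu u v))))
    (fun u v => plus (plus (scal (au u v) (N u v)) (scal (bu u v) (P u v)))
                     (plus (scal (a u v) (Nu u v)) (scal (b u v) (Pu u v)))).
Proof.
  intros H H' u v HD. destruct (H u v HD) as (H1 & H2 & H3 & H4).
  destruct (H' u v HD) as (H1' & H2' & H3' & H4').
  pose proof (diff2_cont2 _ _ _ _ _ H1) as C1. pose proof (diff2_cont2 _ _ _ _ _ H2) as C2.
  pose proof (diff2_cont2 _ _ _ _ _ H1') as C3. pose proof (diff2_cont2 _ _ _ _ _ H2') as C4.
  split; [|split; [|split]].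
  - pose proof (diff2_linear opp _ _ _ _ _ is_linear_opp (diff2_scal _ _ _ _ _ _ _ _ H2 H2')) as G2.
    pose proof (diff2_scal _ _ _ _ _ _ _ _ H1 H1') as G1.
    apply (diff2_eq _ _ _ _ _ _ _ _ (diff2_plus _ _ _ _ _ _ _ _ G1 G2)).
    + reflexivity.
    + hmod HV.
    + change (opp (bu u v)) with (- bu u v). hmod HV.
  - pose proof (diff2_scal _ _ _ _ _ _ _ _ H1 H2') as G1.
    pose proof (diff2_scal _ _ _ _ _ _ _ _ H2 H1') as G2.
    apply (diff2_eq _ _ _ _ _ _ _ _ (diff2_plus _ _ _ _ _ _ _ _ G1 G2)).
    + reflexivity.
    + hmod HV.
    + change (opp (bu u v)) with (- bu u v). hmod HV.
  - repeat first [apply (cont2_minus (W := V)) | apply (cont2_plus (W := V))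
                 | apply (cont2_scal (W := V))];
    match goal with E : _ |- _ => exact E end.
  - repeat first [apply (cont2_minus (W := V)) | apply (cont2_plus (W := V))
                 | apply (cont2_scal (W := V))];
    match goal with E : _ |- _ => exact E end.
Qed.

End Pairs.

(** * Even and odd parts of the resolvent on the slices *)

Section ResolventPair.
Context {V : CompleteNormedModule R_AbsRing}.
Variables (lm : quat -> V -> V) (rm : V -> quat -> V).
Hypothesis HV : two_sided lm rm.
Variables (dom : V -> Prop) (T0 T1 T2 T3 : V -> V).
Hypothesis HT : is_KC lm rm dom T0 T1 T2 T3.
Variable omega : R.
Hypothesis Htype : of_type lm dom T0 T1 T2 T3 omega.
Hypothesis Htype' : of_type lm dom T0 (fun v => opp (T1 v)) (fun v => opp (T2 v))
                      (fun v => opp (T3 v)) omega.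

Local Notation Q := (Qcs lm T0 T1 T2 T3).
Local Notation D2 := (dom2 lm dom T0 T1 T2 T3).
Local Notation Res := (Qinv lm dom T0 T1 T2 T3).
Local Notation rho := (in_rhoS lm dom T0 T1 T2 T3).

Definition outside (u v : R) : Prop := u < cos omega * sqrt (u ^ 2 + v ^ 2).

Lemma rho_outside u v J : outside u v -> in_S J -> rho (slice_pt u v J).
Proof.
  intros H HJ. apply (rho_cos lm dom T0 T1 T2 T3 omega Htype Htype').
  now rewrite qnorm_slice, q0_slice.
Qed.

Definition Res_even (u v : R) (w : V) : V :=
  scal (/ 2) (plus (Res (slice_pt u v e1) w) (Res (slice_pt u v (qopp e1)) w)).
(** [- e1 / 2] inverts [2 e1]: the difference of the two resolvents is to be [2 e1] times the odd
    part. *)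
Definition Res_odd (u v : R) (w : V) : V :=
  scal (- / 2) (lm e1 (minus (Res (slice_pt u v e1) w) (Res (slice_pt u v (qopp e1)) w))).

(* [c1 = (1 - J e1)/2] and [c2 = (1 + J e1)/2] intertwine [u + J v] with [u + e1 v] and
   [u - e1 v], so that [Q_{u + J v}] maps the right-hand side to [(c1 + c2) w = w]. *)
Lemma Qinv_slice u v J w : outside u v -> in_S J ->
  Res (slice_pt u v J) w = plus (Res_even u v w) (lm J (Res_odd u v w)).
Proof.
  intros H HJ. pose proof in_S_e1 as H1. pose proof (in_S_opp _ H1) as H1'.
  pose proof (rho_outside u v J H HJ) as R0.
  pose proof (rho_outside u v e1 H H1) as R1.
  pose proof (rho_outside u v (qopp e1) H H1') as R2.
  set (c1 := qscale (/2) (qsub qone (qmul J e1))).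
  set (c2 := qscale (/2) (qadd qone (qmul J e1))).
  assert (qmul (slice_pt u v J) c1 = qmul c1 (slice_pt u v e1)) as E1.
  { transitivity (qadd (qmul c1 (slice_pt u v e1))
      (qmul (qscale (- / 2 * v) (qadd (qmul J J) qone)) e1)); [unfold c1; quat_ring|].
    rewrite qmul_JJ by auto. quat_ring. }
  assert (qmul (slice_pt u v J) c2 = qmul c2 (slice_pt u v (qopp e1))) as E2.
  { transitivity (qadd (qmul c2 (slice_pt u v (qopp e1)))
      (qmul (qscale (/ 2 * v) (qadd (qmul J J) qone)) e1)); [unfold c2; quat_ring|].
    rewrite qmul_JJ by auto. quat_ring. }
  pose proof (Qinv_dom2 lm dom T0 T1 T2 T3 _ w R1) as D1.
  pose proof (Qinv_dom2 lm dom T0 T1 T2 T3 _ w R2) as D2'.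
  assert (plus (Res_even u v w) (lm J (Res_odd u v w)) =
    plus (lm c1 (Res (slice_pt u v e1) w)) (lm c2 (Res (slice_pt u v (qopp e1)) w))) as ->.
  { unfold Res_even, Res_odd, c1, c2. hmod HV. }
  pose proof (dom2_lm lm rm dom T0 T1 T2 T3 HT) as dl.
  apply (Qinv_unique lm dom); auto.
  - apply (dom2_plus lm rm dom T0 T1 T2 T3 HT); auto.
  - rewrite (Qcs_plus lm rm HV dom T0 T1 T2 T3 HT) by auto.
    rewrite (Qcs_lm lm rm HV dom T0 T1 T2 T3 HT _ _ _ _ D1 E1).
    rewrite (Qcs_lm lm rm HV dom T0 T1 T2 T3 HT _ _ _ _ D2' E2).
    rewrite !(Qcs_Qinv lm dom) by auto. unfold c1, c2. hmod HV.
Qed.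

(** For invertible [a] and the conjugate unit [K] with [a K = e1 a], intertwining gives [R_{u + e1
    v} a = a R_{u + K v} = a E + e1 a O], and likewise for [- e1]; half sum and half difference
    yield the claim. *)
Lemma Res_even_odd_lm u v a w : outside u v ->
  Res_even u v (lm a w) = lm a (Res_even u v w) /\
  Res_odd u v (lm a w) = lm a (Res_odd u v w).
Proof.
  intros H. pose proof in_S_e1 as H1. pose proof (in_S_opp _ H1) as H1'.
  destruct (classic (a = qreal 0)) as [->|Ha].
  - rewrite !(lm_qreal lm rm HV). unfold Res_even, Res_odd.
    rewrite !(Qinv_scal lm rm HV dom T0 T1 T2 T3 HT) by (now apply rho_outside).
    split; hmod HV.
  - set (K := qmul (qinv a) (qmul e1 a)).
    assert (in_S K) as HK by (now apply in_S_conjugate).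
    assert (qmul a K = qmul e1 a) as EK.
    { transitivity (qmul (qmul a (qinv a)) (qmul e1 a)); [unfold K; quat_ring|].
      rewrite qinv_r by auto. quat_ring. }
    assert (forall J J', qmul a J = qmul J' a ->
      qmul (slice_pt u v J') a = qmul a (slice_pt u v J)) as Esl.
    { intros J J' E. unfold slice_pt.
      transitivity (qadd (qscale u a) (qscale v (qmul J' a))); [quat_ring|].
      rewrite <- E. quat_ring. }
    assert (qmul a (qopp K) = qmul (qopp e1) a) as EK'.
    { transitivity (qopp (qmul a K)); [quat_ring|]. rewrite EK. quat_ring. }
    assert (Res (slice_pt u v e1) (lm a w) =
      lm a (plus (Res_even u v w) (lm K (Res_odd u v w)))) as E1.
    { rewrite <- Qinv_slice by auto.
      apply (Qinv_lm lm rm HV dom T0 T1 T2 T3 HT); auto using rho_outside. }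
    assert (Res (slice_pt u v (qopp e1)) (lm a w) =
      lm a (plus (Res_even u v w) (lm (qopp K) (Res_odd u v w)))) as E2.
    { rewrite <- Qinv_slice by (auto using in_S_opp).
      apply (Qinv_lm lm rm HV dom T0 T1 T2 T3 HT); auto using rho_outside, in_S_opp. }
    unfold Res_even at 1. unfold Res_odd at 1. rewrite E1, E2. split; [hmod HV|].
    transitivity (scal (-1) (lm e1 (lm (qmul a K) (Res_odd u v w)))); [hmod HV|].
    rewrite EK. hmod HV.
Qed.

Lemma Qinv_local_bound s : q0 s < cos omega * qnorm s ->
  exists d M, 0 < d /\ 0 <= M /\ forall p, qnorm (qsub p s) < d ->
    q0 p < cos omega * qnorm p /\
    forall w, norm (Res p w) <= M * norm w /\ norm (T0 (Res p w)) <= M * norm w.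
Proof.
  intros Hs. pose proof Htype as (Hom & _).
  assert (0 < qnorm s) as Hn.
  { destruct (qnorm_ge0 s) as [|E]; auto. pose proof (q0_le_qnorm (qopp s)) as H.
    rewrite qnorm_opp in H. simpl in H. rewrite <- E in *. lra. }
  (* Midway between the cosine of the argument of [s] and [cos omega]: the angle [acos c] exceeds
     [omega], and [s] is still strictly outside the closed sector of that angle. *)
  set (c := (q0 s / qnorm s + cos omega) / 2).
  assert (-1 <= q0 s / qnorm s < cos omega) as Hc.
  { pose proof (Rabs_q0_le s) as H. apply Rabs_le_between in H.
    split; [apply (Rmult_le_reg_r (qnorm s))|apply (Rmult_lt_reg_r (qnorm s))]; auto;
    unfold Rdiv; rewrite Rmult_assoc, Rinv_l; lra. }
  assert (cos omega < 1) as Hc1.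
  { rewrite <- cos_0. apply cos_decreasing_1; lra. }
  set (th := acos c).
  assert (cos th = c) as Eth by (apply cos_acos; unfold c; lra).
  assert (0 <= th <= PI) as Bth by apply acos_bound.
  assert (omega < th < PI) as Hth.
  { split; apply cos_decreasing_0; try lra; rewrite Eth, ?cos_PI; unfold c; lra. }
  destruct (Qinv_bound lm rm HV dom T0 T1 T2 T3 HT omega Htype Htype' th Hth) as (M & HM & HB).
  rewrite Eth in HB.
  assert (q0 s < c * qnorm s) as Hcs.
  { replace (q0 s) with (q0 s / qnorm s * qnorm s) by (field; lra).
    apply Rmult_lt_compat_r; unfold c; lra. }
  set (n := qnorm s / 2).
  (* The first radius keeps [|p|] above [n]. The second keeps [p] outside the sector of angle [th],
     half of the margin going to [q0] and half to [c * qnorm]. The bound adds [M / n^2] for [R_p]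
     and [2 M / n] for [T_0 R_p = p R_p - (p - T_0) R_p]. *)
  exists (Rmin n ((c * qnorm s - q0 s) / 2)), (M / n ^ 2 + 2 * M / n).
  assert (0 < n) as Hn2 by (unfold n; lra).
  assert (0 <= M / n ^ 2) by (apply Rdiv_le_0_compat; nra).
  assert (0 <= M / n) by (apply Rdiv_le_0_compat; lra).
  split; [apply Rmin_pos; lra|]. split; [lra|].
  intros p Hp.
  assert (qnorm (qsub p s) < n) as Hp1 by (eapply Rlt_le_trans; [exact Hp|apply Rmin_l]).
  assert (qnorm (qsub p s) < (c * qnorm s - q0 s) / 2) as Hp2
    by (eapply Rlt_le_trans; [exact Hp|apply Rmin_r]).
  pose proof (qnorm_sub_le s p) as B1. rewrite qnorm_sub_sym in B1.
  pose proof (qnorm_sub_le p s) as B2.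
  pose proof (Rabs_q0_le (qsub p s)) as B3. apply Rabs_le_between in B3. simpl in B3.
  assert (-1 <= c < 1) as Hc2 by (unfold c; lra).
  assert (n < qnorm p) as Hpn by (unfold n in *; lra).
  assert (q0 p < c * qnorm p) as Hpc by nra.
  assert (p <> qreal 0) as Hp0.
  { intros ->. rewrite qnorm_qreal, Rabs_R0 in Hpn. lra. }
  split.
  { eapply Rlt_trans; [exact Hpc|]. apply Rmult_lt_compat_r; unfold c; lra. }
  intros w. destruct (HB p ltac:(lra) Hp0) as [Hr Hb]. destruct (Hb w) as [Hb1 Hb2].
  pose proof (norm_ge_0 w) as Hw.
  assert (M / qnorm p ^ 2 <= M / n ^ 2) as I1.
  { apply Rmult_le_compat_l; auto. apply Rinv_le_contravar; nra. }
  assert (M / qnorm p <= M / n) as I2.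
  { apply Rmult_le_compat_l; auto. apply Rinv_le_contravar; lra. }
  split; [nra|].
  replace (T0 (Res p w)) with
    (minus (lm p (Res p w)) (minus (lm p (Res p w)) (T0 (Res p w)))) by hmod HV.
  eapply Rle_trans; [apply vnorm_minus|]. rewrite (norm_lm lm rm HV).
  assert (qnorm p * norm (Res p w) <= M / qnorm p * norm w).
  { replace (M / qnorm p * norm w) with (qnorm p * (M / qnorm p ^ 2 * norm w))
      by (field; lra). apply Rmult_le_compat_l; [lra|auto]. }
  assert (M / qnorm p * norm w <= M / n * norm w) by (apply Rmult_le_compat_r; auto).
  replace ((M / n ^ 2 + 2 * M / n) * norm w) with
    (M / n ^ 2 * norm w + 2 * (M / n * norm w)) by (field; lra).
  assert (0 <= M / n ^ 2 * norm w) by (apply Rmult_le_pos; auto). lra.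
Qed.

(** The resolvent identity puts a factor [p - s] into the argument of [R_p]; since [T_0 R_p] is
    locally bounded too, the same argument applies to it. *)
Lemma Qinv_local_lipschitz s : q0 s < cos omega * qnorm s ->
  exists d K, 0 < d /\ 0 <= K /\ forall p, qnorm (qsub p s) < d ->
    q0 p < cos omega * qnorm p /\
    forall w, norm (Res p w) <= K * norm w /\ norm (T0 (Res p w)) <= K * norm w /\
      norm (minus (Res p w) (Res s w)) <= K * qnorm (qsub p s) * norm w /\
      norm (minus (T0 (Res p w)) (T0 (Res s w))) <= K * qnorm (qsub p s) * norm w.
Proof.
  intros Hs. destruct (Qinv_local_bound s Hs) as (d & M & Hd & HM & HB).
  set (L := (2 * qnorm s + d) * M + 2 * M).
  pose proof (qnorm_ge0 s) as Hn.
  assert (0 <= L) as HL by (unfold L; nra).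
  exists d, (M + M * L). split; auto. split; [nra|].
  intros p Hp. destruct (HB p Hp) as [Hpc Hb]. split; auto.
  assert (rho p /\ rho s) as [Rp Rs].
  { split; now apply (rho_cos lm dom T0 T1 T2 T3 omega Htype Htype'). }
  assert (qnorm (qsub s s) < d) as Hss.
  { replace (qsub s s) with (qreal 0) by quat_ring. rewrite qnorm_qreal, Rabs_R0; auto. }
  destruct (HB s Hss) as [_ Hbs].
  intros w. destruct (Hb w) as [B1 B2]. destruct (Hbs w) as [B3 B4].
  pose proof (norm_ge_0 w) as Hw. pose proof (qnorm_ge0 (qsub p s)) as Hd0.
  assert (0 <= M * L * norm w) by (apply Rmult_le_pos; nra).
  split; [nra|]. split; [nra|].
  set (y := minus (lm (qsub (qmul p p) (qmul s s)) (Res s w))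
                  (scal 2 (lm (qsub p s) (T0 (Res s w))))).
  assert (minus (Res p w) (Res s w) = opp (Res p y)) as E
    by (exact (resolvent_identity lm rm HV dom T0 T1 T2 T3 HT p s w Rp Rs)).
  assert (norm y <= L * qnorm (qsub p s) * norm w) as By.
  { unfold y. eapply Rle_trans; [apply vnorm_minus|].
    rewrite (norm_lm lm rm HV).
    assert (norm (scal 2 (lm (qsub p s) (T0 (Res s w)))) <=
            2 * (qnorm (qsub p s) * (M * norm w))) as N2.
    { eapply Rle_trans; [apply vnorm_scal|]. rewrite Rabs_right by lra.
      rewrite (norm_lm lm rm HV). apply Rmult_le_compat_l; [lra|].
      apply Rmult_le_compat_l; auto. }
    assert (qnorm (qsub (qmul p p) (qmul s s)) <= qnorm (qsub p s) * (2 * qnorm s + d)) as N1.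
    (* [p^2 - s^2 = p (p - s) + (p - s) s] holds without commutativity. *)
    { replace (qsub (qmul p p) (qmul s s)) with
        (qadd (qmul p (qsub p s)) (qmul (qsub p s) s)) by quat_ring.
      eapply Rle_trans; [apply qnorm_add|]. rewrite !qnorm_mul.
      pose proof (qnorm_sub_le p s). nra. }
    assert (qnorm (qsub (qmul p p) (qmul s s)) * norm (Res s w) <=
      qnorm (qsub p s) * (2 * qnorm s + d) * (M * norm w)).
    { apply Rmult_le_compat; auto; [apply qnorm_ge0|apply norm_ge_0]. }
    replace (L * qnorm (qsub p s) * norm w) with
      (qnorm (qsub p s) * (2 * qnorm s + d) * (M * norm w) +
       2 * (qnorm (qsub p s) * (M * norm w))) by (unfold L; ring).
    lra. }
  assert (M * norm y <= (M + M * L) * qnorm (qsub p s) * norm w) as Bf.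
  { eapply Rle_trans; [apply Rmult_le_compat_l; [exact HM|exact By]|].
    assert (0 <= M * (qnorm (qsub p s) * norm w)) by (repeat apply Rmult_le_pos; auto).
    replace ((M + M * L) * qnorm (qsub p s) * norm w) with
      (M * (L * qnorm (qsub p s) * norm w) + M * (qnorm (qsub p s) * norm w)) by ring.
    lra. }
  destruct (Hb y) as [B5 B6].
  pose proof (dom2_dom lm dom T0 T1 T2 T3 _ (Qinv_dom2 lm dom T0 T1 T2 T3 p w Rp)) as Dp.
  pose proof (dom2_dom lm dom T0 T1 T2 T3 _ (Qinv_dom2 lm dom T0 T1 T2 T3 s w Rs)) as Ds.
  pose proof (dom2_dom lm dom T0 T1 T2 T3 _ (Qinv_dom2 lm dom T0 T1 T2 T3 p y Rp)) as Dy.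
  pose proof (component0 T0 T1 T2 T3) as c0.
  split.
  - rewrite E, vnorm_opp. lra.
  - replace (minus (T0 (Res p w)) (T0 (Res s w))) with (T0 (minus (Res p w) (Res s w))).
    + rewrite E, (T_opp lm rm HV dom T0 T1 T2 T3 HT), vnorm_opp by auto. lra.
    + unfold minus. rewrite (T_plus lm rm dom T0 T1 T2 T3 HT), (T_opp lm rm HV dom T0 T1 T2 T3 HT);
      auto. apply (dom_opp lm rm HV dom T0 T1 T2 T3 HT); auto.
Qed.

(** The derivative [- R_s (2 s - 2 T_0) R_s] of the inverse of [Q_{c,s}(T)] when [s] moves inside
    its own plane [C_J]. *)
Definition Res_d (s : quat) (w : V) : V :=
  scal (-2) (Res s (minus (lm s (Res s w)) (T0 (Res s w)))).

Lemma cont2_of_lipschitz (G : quat -> V) u v J : in_S J ->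
  (exists d K, 0 < d /\ 0 <= K /\ forall p, qnorm (qsub p (slice_pt u v J)) < d ->
    norm (minus (G p) (G (slice_pt u v J))) <= K * qnorm (qsub p (slice_pt u v J))) ->
  cont2 (fun u v => G (slice_pt u v J)) u v.
Proof.
  intros HJ (d & K & Hd & HK & HG). apply continuous_norm_eps. intros eps Heps.
  assert (0 < Rmin d (eps / (K + 1))) as Hm.
  { apply Rmin_pos; auto. apply Rdiv_lt_0_compat; lra. }
  generalize (locally_slice u v J _ HJ Hm). apply filter_imp. intros z Hz. simpl.
  assert (qnorm (qsub (slice_pt (fst z) (snd z) J) (slice_pt u v J)) < d) as H1
    by (eapply Rlt_le_trans; [exact Hz|apply Rmin_l]).
  assert (qnorm (qsub (slice_pt (fst z) (snd z) J) (slice_pt u v J)) < eps / (K + 1)) as H2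
    by (eapply Rlt_le_trans; [exact Hz|apply Rmin_r]).
  eapply Rle_lt_trans; [apply HG, H1|].
  apply (Rmult_lt_compat_r (K + 1)) in H2; [|lra].
  unfold Rdiv in H2. rewrite Rmult_assoc, Rinv_l in H2 by lra.
  pose proof (qnorm_ge0 (qsub (slice_pt (fst z) (snd z) J) (slice_pt u v J))) as H3.
  set (q := qnorm _) in H2, H3. change (K * q < eps). nra.
Qed.

(** The resolvent enters twice; with [L_s = (s - T_0) R_s w] the difference splits as
    [R_p (L_p - L_s) + (R_p - R_s) L_s], and both terms are Lipschitz at [s]. *)
Lemma cont2_Res_d u v J w : outside u v -> in_S J ->
  cont2 (fun u v => Res_d (slice_pt u v J) w) u v.
Proof.
  intros H HJ. apply (cont2_of_lipschitz (fun s => Res_d s w)); auto.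
  set (s := slice_pt u v J).
  assert (q0 s < cos omega * qnorm s) as Hs by (unfold s; now rewrite q0_slice, qnorm_slice).
  destruct (Qinv_local_lipschitz s Hs) as (d & K & Hd & HK & HB).
  set (Lf := fun s => minus (lm s (Res s w)) (T0 (Res s w))).
  set (B := ((qnorm s + d) * K + 2 * K) * norm w).
  exists d, (2 * (K * B + K * norm (Lf s))). split; auto.
  pose proof (norm_ge_0 w) as Hw. pose proof (qnorm_ge0 s) as Hn.
  pose proof (norm_ge_0 (Lf s)) as HLf.
  assert (0 <= B) as HB0 by (unfold B; apply Rmult_le_pos; nra).
  split; [nra|]. intros p Hp.
  destruct (HB p Hp) as [Hpc Hb].
  assert (rho p /\ rho s) as [Rp Rs].
  { split; now apply (rho_cos lm dom T0 T1 T2 T3 omega Htype Htype'). }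
  assert (qnorm (qsub s s) < d) as Hss.
  { replace (qsub s s) with (qreal 0) by quat_ring. rewrite qnorm_qreal, Rabs_R0; auto. }
  destruct (HB s Hss) as [_ Hbs].
  pose proof (qnorm_ge0 (qsub p s)) as Hq.
  assert (norm (minus (Lf p) (Lf s)) <= B * qnorm (qsub p s)) as BL.
  { destruct (Hb w) as (_ & _ & B3 & B4). destruct (Hbs w) as (B1 & _ & _ & _).
    replace (minus (Lf p) (Lf s)) with
      (plus (lm (qsub p s) (Res s w)) (minus (lm p (minus (Res p w) (Res s w)))
        (minus (T0 (Res p w)) (T0 (Res s w))))) by (unfold Lf; hmod HV).
    eapply Rle_trans; [apply vnorm_plus|].
    eapply Rle_trans; [apply Rplus_le_compat_l, vnorm_minus|].
    rewrite !(norm_lm lm rm HV).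
    assert (qnorm (qsub p s) * norm (Res s w) <= qnorm (qsub p s) * (K * norm w))
      by (apply Rmult_le_compat_l; auto).
    assert (qnorm p * norm (minus (Res p w) (Res s w)) <=
      (qnorm s + d) * (K * qnorm (qsub p s) * norm w)).
    { apply Rmult_le_compat; auto; [apply qnorm_ge0|apply norm_ge_0|].
      pose proof (qnorm_sub_le p s). lra. }
    unfold B.
    replace (((qnorm s + d) * K + 2 * K) * norm w * qnorm (qsub p s)) with
      (qnorm (qsub p s) * (K * norm w) + ((qnorm s + d) * (K * qnorm (qsub p s) * norm w)
        + K * qnorm (qsub p s) * norm w)) by ring.
    lra. }
  replace (minus (Res_d p w) (Res_d s w)) with
    (scal (-2) (plus (Res p (minus (Lf p) (Lf s))) (minus (Res p (Lf s)) (Res s (Lf s))))).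
  - eapply Rle_trans; [apply vnorm_scal|]. rewrite Rabs_left by lra.
    destruct (Hb (minus (Lf p) (Lf s))) as (B1 & _). destruct (Hb (Lf s)) as (_ & _ & B3 & _).
    assert (K * norm (minus (Lf p) (Lf s)) <= K * (B * qnorm (qsub p s)))
      by (apply Rmult_le_compat_l; auto).
    pose proof (vnorm_plus (Res p (minus (Lf p) (Lf s))) (minus (Res p (Lf s)) (Res s (Lf s)))).
    replace (2 * (K * B + K * norm (Lf s)) * qnorm (qsub p s)) with
      (2 * (K * (B * qnorm (qsub p s)) + K * qnorm (qsub p s) * norm (Lf s))) by ring.
    lra.
  - unfold Res_d. fold (Lf p) (Lf s). unfold minus at 1.
    rewrite (Qinv_plus lm rm HV dom T0 T1 T2 T3 HT), (Qinv_opp lm rm HV dom T0 T1 T2 T3 HT) by auto.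
    hmod HV.
Qed.

(** The increment [p - s] stays in [C_J], so it commutes with [p] and passes through [R_p], and
    [p^2 - s^2] factors. After subtraction of the linear term there remains [p - s] times a quantity
    that is itself of order [|p - s|]. *)
Lemma diff2_Res u v J w : outside u v -> in_S J ->
  diff2 (fun u v => Res (slice_pt u v J) w) u v
    (Res_d (slice_pt u v J) w) (lm J (Res_d (slice_pt u v J) w)).
Proof.
  intros H HJ. split; [exact (is_linear_pair _ _)|].
  intros z Hz. replace z with (u, v) by (exact (is_filter_lim_locally_unique _ _ Hz)).
  clear z Hz. intros eps. set (s := slice_pt u v J).
  assert (q0 s < cos omega * qnorm s) as Hs by (unfold s; now rewrite q0_slice, qnorm_slice).
  destruct (Qinv_local_lipschitz s Hs) as (d & K & Hd & HK & HB).
  set (x := Res s w). set (L := minus (lm s x) (T0 x)).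
  set (C := 2 * (K * norm L) + K * norm x).
  assert (0 <= C) as HC.
  { unfold C. pose proof (norm_ge_0 L). pose proof (norm_ge_0 x).
    assert (0 <= K * norm L) by (now apply Rmult_le_pos).
    assert (0 <= K * norm x) by (now apply Rmult_le_pos). lra. }
  pose proof (cond_pos eps) as Heps.
  assert (0 < Rmin d (eps / (C + 1))) as Hm.
  { apply Rmin_pos; auto. apply Rdiv_lt_0_compat; lra. }
  generalize (locally_slice u v J _ HJ Hm). apply filter_imp. intros [u' v'] Hz. simpl fst in *. simpl snd in *.
  set (p := slice_pt u' v' J) in *. fold s in Hz.
  assert (qnorm (qsub p s) < d) as H1
    by (eapply Rlt_le_trans; [exact Hz|apply Rmin_l]).
  assert (qnorm (qsub p s) < eps / (C + 1)) as H2
    by (eapply Rlt_le_trans; [exact Hz|apply Rmin_r]).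
  assert (norm (minus (u', v') (u, v)) = qnorm (qsub p s)) as En.
  { unfold p, s. rewrite qnorm_slice_sub by auto.
    change (sqrt (Rabs (u' - u) ^ 2 + Rabs (v' - v) ^ 2) = sqrt ((u' - u) ^ 2 + (v' - v) ^ 2)).
    now rewrite !pow2_abs. }
  match goal with |- _ <= _ * ?n => replace n with (qnorm (qsub p s)) by (symmetry; exact En) end.
  clear En.
  destruct (HB p H1) as [Hpc Hb].
  assert (rho p /\ rho s) as [Rp Rs].
  { split; now apply (rho_cos lm dom T0 T1 T2 T3 omega Htype Htype'). }
  change (norm (minus (minus (Res p w) x)
    (plus (scal (u' - u) (Res_d s w)) (scal (v' - v) (lm J (Res_d s w)))))
    <= eps * qnorm (qsub p s)).
  assert (forall a b y, Res p (lm (slice_pt a b J) y) = lm (slice_pt a b J) (Res p y)) as Ecomm.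
  { intros. apply (Qinv_lm lm rm HV dom T0 T1 T2 T3 HT); auto.
    unfold p. quat_ring. }
  assert (minus (minus (Res p w) x)
    (plus (scal (u' - u) (Res_d s w)) (scal (v' - v) (lm J (Res_d s w)))) =
    opp (lm (qsub p s) (plus (scal 2 (minus (Res p L) (Res s L)))
                             (lm (qsub p s) (Res p x))))) as E.
  { assert (minus (Res p w) x = opp (lm (qsub p s)
      (plus (scal 2 (Res p L)) (lm (qsub p s) (Res p x))))) as E1.
    { unfold x at 1. rewrite (resolvent_identity lm rm HV dom T0 T1 T2 T3 HT) by auto.
      fold x. f_equal.
      assert (qsub p s = slice_pt (u' - u) (v' - v) J) as Eps by (unfold p, s; quat_ring).
      rewrite Eps. rewrite <- Ecomm. rewrite <- (Qinv_scal lm rm HV dom T0 T1 T2 T3 HT) by auto.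
      rewrite <- (Qinv_plus lm rm HV dom T0 T1 T2 T3 HT) by auto. rewrite <- Ecomm.
      f_equal. rewrite <- Eps. unfold L.
      assert (qsub (qmul p p) (qmul s s) = qmul (qsub p s) (qadd p s)) as ->
        by (unfold p, s; quat_ring).
      hmod HV. }
    rewrite E1. unfold Res_d. fold x. fold L.
    assert (qsub p s = slice_pt (u' - u) (v' - v) J) as -> by (unfold p, s; quat_ring).
    hmod HV. }
  rewrite E, vnorm_opp, (norm_lm lm rm HV).
  pose proof (qnorm_ge0 (qsub p s)) as Hq.
  destruct (Hb L) as (_ & _ & B3 & _). destruct (Hb x) as (B1 & _).
  assert (norm (plus (scal 2 (minus (Res p L) (Res s L))) (lm (qsub p s) (Res p x)))
    <= C * qnorm (qsub p s)) as Bn.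
  { eapply Rle_trans; [apply vnorm_plus|]. rewrite (norm_lm lm rm HV).
    assert (norm (scal 2 (minus (Res p L) (Res s L))) <= 2 * (K * qnorm (qsub p s) * norm L)).
    { eapply Rle_trans; [apply vnorm_scal|]. rewrite Rabs_right by lra. lra. }
    assert (qnorm (qsub p s) * norm (Res p x) <= qnorm (qsub p s) * (K * norm x))
      by (apply Rmult_le_compat_l; auto).
    unfold C. replace ((2 * (K * norm L) + K * norm x) * qnorm (qsub p s)) with
      (2 * (K * qnorm (qsub p s) * norm L) + qnorm (qsub p s) * (K * norm x)) by ring.
    lra. }
  rewrite (Rmult_comm eps). apply Rmult_le_compat_l; auto.
  eapply Rle_trans; [exact Bn|].
  apply (Rmult_lt_compat_r (C + 1)) in H2; [|lra].
  unfold Rdiv in H2. rewrite Rmult_assoc, Rinv_l in H2 by lra. nra.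
Qed.

(** On the plane of [J] the [v]-derivative is [J] times the [u]-derivative; taken at [e1] and
    [- e1], this becomes the Cauchy-Riemann system of the even and odd parts. *)
Lemma CR_pair_Res w : CR_pair outside (fun u v => Res_even u v w) (fun u v => Res_odd u v w)
  (fun u v => scal (/ 2) (plus (Res_d (slice_pt u v e1) w) (Res_d (slice_pt u v (qopp e1)) w)))
  (fun u v => scal (- / 2)
    (lm e1 (minus (Res_d (slice_pt u v e1) w) (Res_d (slice_pt u v (qopp e1)) w)))).
Proof.
  intros u v H. pose proof in_S_e1 as H1. pose proof (in_S_opp _ H1) as H1'.
  pose proof (diff2_Res u v e1 w H H1) as G1.
  pose proof (diff2_Res u v (qopp e1) w H H1') as G2.
  pose proof (cont2_Res_d u v e1 w H H1) as C1.
  pose proof (cont2_Res_d u v (qopp e1) w H H1') as C2.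
  assert (forall c : R, is_linear (fun x : V => scal c x)) as Lc
    by (intros c; exact (is_linear_scal_r (V := V) c Rmult_comm)).
  split; [|split; [|split]].
  - apply (diff2_eq _ _ _ _ _ _ _ _
      (diff2_linear _ _ _ _ _ _ (Lc (/ 2)) (diff2_plus lm rm HV _ _ _ _ _ _ _ _ G1 G2))).
    + reflexivity.
    + reflexivity.
    + hmod HV.
  - apply (diff2_eq _ _ _ _ _ _ _ _
      (diff2_linear _ _ _ _ _ _ (Lc (- / 2))
        (diff2_linear _ _ _ _ _ _ (is_linear_lm lm rm HV e1)
          (diff2_plus lm rm HV _ _ _ _ _ _ _ _ G1
            (diff2_linear _ _ _ _ _ _ is_linear_opp G2))))).
    + reflexivity.
    + reflexivity.
    + hmod HV.
  - apply (cont2_scal (W := V) (fun _ _ => / 2)); [apply continuous_const|].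
    now apply (cont2_plus (W := V)).
  - apply (cont2_scal (W := V) (fun _ _ => - / 2)); [apply continuous_const|].
    apply cont2_linear; [exact (is_linear_lm lm rm HV e1)|].
    now apply (cont2_minus (W := V)).
Qed.

End ResolventPair.

(** * Power majorants and operator norms *)

Section PowerMajorant.
Variable a : R.
Hypothesis Ha : 0 < a.

Lemma Rpower_pos r x : 0 < Rpower r x.
Proof. apply exp_pos. Qed.

Lemma Rpower_le_eps eps r : 0 < eps -> 0 < r <= Rpower eps (/ a) -> Rpower r a <= eps.
Proof.
  intros Heps Hr. apply (Rle_trans _ (Rpower (Rpower eps (/ a)) a)).
  - apply Rle_Rpower_l; lra.
  - rewrite Rpower_mult, Rinv_l, Rpower_1; lra.
Qed.

Lemma Rpower_lim_0 : filterlim (fun r => Rpower r a) (at_right 0) (locally 0).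
Proof.
  apply filterlim_locally. intros eps. pose proof (cond_pos eps) as He.
  assert (0 < eps / 2) as He2 by lra.
  exists (mkposreal _ (Rpower_pos (eps / 2) (/ a))). intros r Hr Hr0.
  change (Rabs (Rpower r a - 0) < eps). change (Rabs (r - 0) < Rpower (eps / 2) (/ a)) in Hr.
  rewrite Rminus_0_r in *. rewrite Rabs_right in * by (try apply Rle_ge; try lra; left; apply Rpower_pos).
  pose proof (Rpower_le_eps (eps / 2) r He2). lra.
Qed.

Lemma Rpower_ge_1 r : 1 <= r -> 1 <= Rpower r a.
Proof.
  intros Hr. replace 1 with (Rpower 1 a) at 1.
  - apply Rle_Rpower_l; lra.
  - unfold Rpower. rewrite ln_1, Rmult_0_r. apply exp_0.
Qed.
Lemma Rpower_le_1 r : 0 < r <= 1 -> Rpower r a <= 1.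
Proof.
  intros Hr. replace 1 with (Rpower 1 a).
  - apply Rle_Rpower_l; lra.
  - unfold Rpower. rewrite ln_1, Rmult_0_r. apply exp_0.
Qed.

Lemma Rpower_inv_lim_infty :
  filterlim (fun r => / (1 + Rpower r a)) (Rbar_locally p_infty) (locally 0).
Proof.
  apply filterlim_locally. intros eps. pose proof (cond_pos eps) as He.
  exists (Rpower (/ eps) (/ a)). intros r Hr.
  pose proof (Rpower_pos (/ eps) (/ a)). pose proof (Rpower_pos r a).
  change (Rabs (/ (1 + Rpower r a) - 0) < eps). rewrite Rminus_0_r, Rabs_right.
  - rewrite <- (Rinv_inv eps). apply Rinv_lt_contravar.
    + apply Rmult_lt_0_compat; [now apply Rinv_0_lt_compat|lra].
    + assert (/ eps <= Rpower r a); [|lra].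
      replace (/ eps) with (Rpower (Rpower (/ eps) (/ a)) a).
      * apply Rle_Rpower_l; lra.
      * rewrite Rpower_mult, Rinv_l, Rpower_1; try lra. now apply Rinv_0_lt_compat.
  - apply Rle_ge; left; apply Rinv_0_lt_compat; lra.
Qed.

(** For [c >= 0] an increasing primitive with limits [0] and [c]. Its derivative is of order
    [r^(a-1)] at zero and [r^(-a-1)] at infinity, enough to dominate [decay r / r^2] up to a
    constant. *)
Definition majorant (c r : R) : R := c * (1 - / (1 + Rpower r a)).
Definition dmajorant (c r : R) : R := c * (a * Rpower r (a - 1)) / (1 + Rpower r a) ^ 2.

Lemma is_derive_Rpower x r : 0 < r -> is_derive (fun r => Rpower r x) r (x * Rpower r (x - 1)).
Proof. intros. apply is_derive_Reals. now apply derivable_pt_lim_power. Qed.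

Lemma is_derive_majorant c r : 0 < r -> is_derive (majorant c) r (dmajorant c r).
Proof.
  intros Hr. pose proof (is_derive_Rpower a r Hr) as H. pose proof (Rpower_pos r a).
  unfold majorant, dmajorant.
  assert (ex_derive (fun r : R => Rpower r a) r) as Hex by (eexists; exact H).
  evar_last.
  - auto_derive; [|reflexivity]. split; [exact Hex|]. split; [lra|auto].
  - replace (Derive _ _) with (a * Rpower r (a - 1))
      by (symmetry; apply is_derive_unique; exact H).
    field. lra.
Qed.

Lemma continuous_dmajorant c r : 0 < r -> continuous (dmajorant c) r.
Proof.
  intros Hr. pose proof (is_derive_Rpower a r Hr) as H. pose proof (Rpower_pos r a).
  pose proof (is_derive_Rpower (a - 1) r Hr) as H'.
  apply (ex_derive_continuous (dmajorant c)). unfold dmajorant. auto_derive.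
  repeat split; try (eexists; eassumption). nra.
Qed.

Lemma majorant_lim_0 c : filterlim (majorant c) (at_right 0) (locally 0).
Proof.
  assert (forall x : R, 0 <= x -> 0 <= 1 - / (1 + x) <= x) as Hx.
  { intros x Hx. replace (1 - / (1 + x)) with (x / (1 + x)) by (field; lra).
    split; [apply Rdiv_le_0_compat; lra|].
    apply (Rmult_le_reg_r (1 + x)); [lra|]. unfold Rdiv. rewrite Rmult_assoc, Rinv_l by lra. nra. }
  apply (filterlim_ext (fun r => scal c (1 - / (1 + Rpower r a)))); [reflexivity|].
  replace 0 with (scal c 0) at 2 by apply Rmult_0_r.
  apply (filterlim_comp _ _ _ (fun r => 1 - / (1 + Rpower r a)) (fun x => scal c x) _ (locally 0));
    [|apply (filterlim_scal_r (K := R_AbsRing) (V := R_NormedModule))].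
  apply (filterlim_le_le (fun _ => 0) _ (fun r => Rpower r a) (Finite 0)).
  - apply filter_forall. intros r. apply Hx. left; apply Rpower_pos.
  - apply filterlim_const.
  - apply Rpower_lim_0.
Qed.

Lemma majorant_lim_infty c : filterlim (majorant c) (Rbar_locally p_infty) (locally c).
Proof.
  apply (filterlim_comp _ _ _ (fun r => / (1 + Rpower r a)) (fun x => c * (1 - x))
    (Rbar_locally p_infty) (locally 0)); [apply Rpower_inv_lim_infty|].
  assert (continuous (fun x : R => c * (1 - x)) 0) as Hc.
  { apply (ex_derive_continuous (fun x : R => c * (1 - x)) 0). auto_derive. auto. }
  refine (eq_rect (c * (1 - 0))
    (fun y => filterlim (fun x : R => c * (1 - x)) (locally 0) (locally y)) Hc c _).
  ring.
Qed.

Definition decay (r : R) : R := Rpower r (1 + a) / (1 + Rpower r (1 + 2 * a)).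

Lemma decay_split r : 0 < r -> Rpower r (1 + a) = r * Rpower r a /\
  Rpower r (1 + 2 * a) = r * Rpower r a ^ 2 /\ Rpower r a = r * Rpower r (a - 1).
Proof.
  intros Hr. split; [|split].
  - now rewrite Rpower_plus, Rpower_1.
  - replace (1 + 2 * a) with (1 + (a + a)) by ring.
    rewrite !Rpower_plus, Rpower_1 by auto. ring.
  - replace a with (1 + (a - 1)) at 1 by ring. now rewrite Rpower_plus, Rpower_1.
Qed.

Lemma decay_ge0 r : 0 <= decay r.
Proof.
  apply Rdiv_le_0_compat; [left; apply Rpower_pos|].
  pose proof (Rpower_pos r (1 + 2 * a)). lra.
Qed.

Lemma decay_le_dmajorant c r : 0 <= c -> 0 < r -> c / r ^ 2 * decay r <= dmajorant (4 * c / a) r.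
Proof.
  intros Hc Hr. destruct (decay_split r Hr) as (E1 & E2 & E3).
  unfold decay, dmajorant. rewrite E1, E2.
  pose proof (Rpower_pos r (a - 1)) as H1. pose proof (Rpower_pos r a) as H0.
  assert ((1 + Rpower r a) ^ 2 <= 4 * (1 + r * Rpower r a ^ 2)) as H.
  { destruct (Rle_dec r 1) as [Hr1|Hr1].
    - pose proof (Rpower_le_1 r ltac:(lra)).
      assert (0 <= r * Rpower r a ^ 2) by nra. nra.
    - assert (Rpower r a ^ 2 <= r * Rpower r a ^ 2) by nra.
      pose proof (pow2_ge_0 (Rpower r a - 1)). nra. }
  set (p := Rpower r a) in *. set (q := Rpower r (a - 1)) in *.
  assert (0 < 1 + r * p ^ 2) as Hd by nra.
  assert (p / r = q) as E4 by (rewrite E3; field; lra).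
  replace (c / r ^ 2 * (r * p / (1 + r * p ^ 2))) with (c * (p / r) * / (1 + r * p ^ 2))
    by (field; split; lra).
  rewrite E4.
  replace (4 * c / a * (a * q) / (1 + p) ^ 2) with (c * q * (4 / (1 + p) ^ 2))
    by (field; lra).
  apply Rmult_le_compat_l; [nra|].
  apply (Rmult_le_reg_r (1 + r * p ^ 2)); auto. rewrite Rinv_l by lra.
  apply (Rmult_le_reg_r ((1 + p) ^ 2)); [nra|].
  replace (4 / (1 + p) ^ 2 * (1 + r * p ^ 2) * (1 + p) ^ 2) with (4 * (1 + r * p ^ 2))
    by (field; lra). lra.
Qed.

(** [decay r / r] is the size of the boundary terms in the rotation: a factor [r] from the ray and
    [1 / r^2] from the resolvent. Near zero it is at most [r^a]. *)
Lemma decay_lim_0 c : filterlim (fun r => c / r * decay r) (at_right 0) (locally 0) .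
Proof.
  apply (filterlim_ext_loc (fun r => scal c (/ r * decay r))).
  { apply filter_forall. intros r. unfold scal; simpl; unfold mult; simpl.
    unfold Rdiv; ring. }
  replace 0 with (scal c 0) at 2 by apply Rmult_0_r.
  apply (filterlim_comp _ _ _ (fun r => / r * decay r) (fun x => scal c x) _ (locally 0));
    [|apply (filterlim_scal_r (K := R_AbsRing) (V := R_NormedModule))].
  apply (filterlim_le_le (fun _ => 0) _ (fun r => Rpower r a) (Finite 0)).
  - exists (mkposreal 1 Rlt_0_1). intros r _ Hr. split.
    + apply Rmult_le_pos; [left; now apply Rinv_0_lt_compat|apply decay_ge0].
    + destruct (decay_split r Hr) as (E1 & E2 & _). unfold decay. rewrite E1, E2.
      pose proof (Rpower_pos r a) as H0.
      assert (0 <= r * Rpower r a ^ 2) by nra.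
      replace (/ r * (r * Rpower r a / (1 + r * Rpower r a ^ 2))) with
        (Rpower r a * / (1 + r * Rpower r a ^ 2)) by (field; split; lra).
      rewrite <- (Rmult_1_r (Rpower r a)) at 3. apply Rmult_le_compat_l; [lra|].
      rewrite <- Rinv_1. apply Rinv_le_contravar; lra.
  - apply filterlim_const.
  - apply Rpower_lim_0.
Qed.

Lemma decay_le_inv r : 1 <= r -> decay r <= / Rpower r a.
Proof.
  intros Hr. destruct (decay_split r ltac:(lra)) as (E1 & E2 & _). unfold decay. rewrite E1, E2.
  pose proof (Rpower_pos r a) as H0. assert (0 <= r * Rpower r a ^ 2) by nra.
  apply (Rmult_le_reg_r (1 + r * Rpower r a ^ 2)); [lra|].
  unfold Rdiv. rewrite Rmult_assoc, Rinv_l, Rmult_1_r by lra.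
  replace (/ Rpower r a * (1 + r * Rpower r a ^ 2)) with (/ Rpower r a + r * Rpower r a)
    by (field; lra).
  pose proof (Rinv_0_lt_compat _ H0). lra.
Qed.

Lemma decay_lim_infty_aux : filterlim decay (Rbar_locally p_infty) (locally 0).
Proof.
  apply (filterlim_le_le (fun _ => 0) _ (fun r => 2 * / (1 + Rpower r a)) (Finite 0)).
  - exists 1. intros r Hr. split; [apply decay_ge0|].
    pose proof (decay_le_inv r ltac:(lra)). pose proof (Rpower_ge_1 r ltac:(lra)).
    eapply Rle_trans; [eassumption|].
    apply (Rmult_le_reg_r (Rpower r a * (1 + Rpower r a))); [nra|].
    field_simplify; lra.
  - apply filterlim_const.
  - simpl. replace 0 with (scal 2 0) by apply Rmult_0_r.
    apply (filterlim_comp _ _ _ (fun r => / (1 + Rpower r a)) (fun x => scal 2 x) _ (locally 0));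
    [apply Rpower_inv_lim_infty|apply (filterlim_scal_r (K := R_AbsRing) (V := R_NormedModule))].
Qed.

Lemma decay_lim_infty c : filterlim (fun r => c / r * decay r) (Rbar_locally p_infty) (locally 0).
Proof.
  apply (filterlim_ext (fun r => scal c (/ r * decay r))).
  { intros r. unfold scal; simpl; unfold mult; simpl. unfold Rdiv; ring. }
  replace 0 with (scal c 0) by apply Rmult_0_r.
  apply (filterlim_comp _ _ _ (fun r => / r * decay r) (fun x => scal c x) _ (locally 0));
    [|apply (filterlim_scal_r (K := R_AbsRing) (V := R_NormedModule))].
  apply (filterlim_le_le (fun _ => 0) _ decay (Finite 0)).
  - exists 1. intros r Hr. pose proof (decay_ge0 r). 
    assert (0 < / r <= 1).
    { split; [apply Rinv_0_lt_compat; lra|]. rewrite <- Rinv_1. apply Rinv_le_contravar; lra. }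
    split; nra.
  - apply filterlim_const.
  - apply decay_lim_infty_aux.
Qed.

End PowerMajorant.

(** * Operator norms and continuity in the operator norm *)

Section OperatorNorm.
Context {V : CompleteNormedModule R_AbsRing}.
Variables (lm : quat -> V -> V) (rm : V -> quat -> V).
Hypothesis HV : two_sided lm rm.

Lemma vnorm_zero_le_1 : norm (zero : V) <= 1.
Proof. rewrite (norm_zero : norm (zero : V) = 0). lra. Qed.

Lemma opnorm_spec (A : V -> V) B : (forall v, norm (A v) <= B * norm v) -> 0 <= B ->
  (forall v, norm v <= 1 -> norm (A v) <= opnorm A) /\
  (forall b, (forall v, norm v <= 1 -> norm (A v) <= b) -> opnorm A <= b).
Proof.
  intros HA HB.
  set (E := fun r => exists v : V, norm v <= 1 /\ r = norm (A v)).
  pose proof vnorm_zero_le_1 as N0.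
  destruct (Lub_Rbar_correct E) as [H1 H2].
  assert (forall b, (forall v, norm v <= 1 -> norm (A v) <= b) -> Rbar_le (Lub_Rbar E) b) as H3.
  { intros b Hb. apply H2. intros r (v & Hv & ->). now apply Hb. }
  assert (Rbar_le (Lub_Rbar E) B) as H4.
  { apply H3. intros v Hv. eapply Rle_trans; [apply HA|]. pose proof (norm_ge_0 v). nra. }
  assert (Rbar_le (norm (A zero)) (Lub_Rbar E)) as H5.
  { apply H1. now exists zero. }
  (* [opnorm] applies [real] to an extended least upper bound, which would give [0] at infinity; the
     bound [B] rules this out. *)
  assert (is_finite (Lub_Rbar E)) as Hf.
  { destruct (Lub_Rbar E); simpl in *; try contradiction. reflexivity. }
  unfold opnorm. fold E. rewrite <- Hf in H1, H3. split.
  - intros v Hv. apply (H1 (norm (A v))). now exists v.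
  - intros b Hb. now apply H3 in Hb.
Qed.

Lemma opnorm_bounds (A : V -> V) B : (forall v, norm (A v) <= B * norm v) -> 0 <= B ->
  0 <= opnorm A <= B.
Proof.
  intros HA HB. destruct (opnorm_spec A B HA HB) as [H1 H2]. split.
  - eapply Rle_trans; [exact (norm_ge_0 (A zero))|exact (H1 zero vnorm_zero_le_1)].
  - apply H2. intros v Hv. eapply Rle_trans; [apply HA|]. pose proof (norm_ge_0 v). nra.
Qed.

Lemma opnorm_diff (A A' : V -> V) B B' e :
  (forall v, norm (A v) <= B * norm v) -> 0 <= B ->
  (forall v, norm (A' v) <= B' * norm v) -> 0 <= B' -> 0 <= e ->
  (forall v, norm (minus (A v) (A' v)) <= e * norm v) ->
  Rabs (opnorm A - opnorm A') <= e.
Proof.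
  intros HA HB HA' HB' He Hd.
  destruct (opnorm_spec A B HA HB) as [H1 H2]. destruct (opnorm_spec A' B' HA' HB') as [H1' H2'].
  apply Rabs_le. split.
  - assert (opnorm A' <= opnorm A + e); [|lra]. apply H2'. intros v Hv.
    replace (A' v) with (minus (A v) (minus (A v) (A' v))) by hmod HV.
    eapply Rle_trans; [apply vnorm_minus|]. pose proof (H1 v Hv). pose proof (Hd v).
    pose proof (norm_ge_0 v). nra.
  - assert (opnorm A <= opnorm A' + e); [|lra]. apply H2. intros v Hv.
    replace (A v) with (plus (A' v) (minus (A v) (A' v))) by hmod HV.
    eapply Rle_trans; [apply vnorm_plus|]. pose proof (H1' v Hv). pose proof (Hd v).
    pose proof (norm_ge_0 v). nra.
Qed.

(** Uniformity in [v] is the point: continuity of each [K t v] alone would not in general make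
    [opnorm (K t)] continuous in [t], as used for absolute convergence. *)
Definition opcont (K : R -> V -> V) (r : R) : Prop :=
  forall eps, 0 < eps -> locally r (fun t => forall v, norm (minus (K t v) (K r v)) <= eps * norm v).

Lemma opcont_comp (K L : R -> V -> V) r BK BL : 0 <= BK -> 0 <= BL ->
  opcont K r -> opcont L r ->
  locally r (fun t => (forall v, norm (K t v) <= BK * norm v) /\
    forall v w, K t (minus v w) = minus (K t v) (K t w)) ->
  (forall v, norm (L r v) <= BL * norm v) ->
  opcont (fun t v => K t (L t v)) r.
Proof.
  intros HBK HBL HK HL Hloc HLr eps Heps.
  assert (0 < eps / (2 * (BK + 1))) as H1 by (apply Rdiv_lt_0_compat; lra).
  assert (0 < eps / (2 * (BL + 1))) as H2 by (apply Rdiv_lt_0_compat; lra).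
  generalize (filter_and _ _ Hloc (filter_and _ _ (HL _ H1) (HK _ H2))).
  apply filter_imp. intros t ((B1 & B2) & B3 & B4) v.
  replace (minus (K t (L t v)) (K r (L r v))) with
    (plus (K t (minus (L t v) (L r v))) (minus (K t (L r v)) (K r (L r v))))
    by (rewrite B2; hmod HV).
  eapply Rle_trans; [apply vnorm_plus|].
  pose proof (norm_ge_0 v) as Hv.
  assert (norm (K t (minus (L t v) (L r v))) <= BK * (eps / (2 * (BK + 1)) * norm v)) as C1.
  { eapply Rle_trans; [apply B1|]. apply Rmult_le_compat_l; auto. }
  assert (norm (minus (K t (L r v)) (K r (L r v))) <= eps / (2 * (BL + 1)) * (BL * norm v)) as C2.
  { eapply Rle_trans; [apply B4|]. apply Rmult_le_compat_l; [lra|auto]. }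
  assert (forall B, 0 <= B -> B * (eps / (2 * (B + 1))) <= eps / 2) as HB.
  { intros B HB. apply (Rmult_le_reg_r (2 * (B + 1))); [lra|]. field_simplify; [nra|lra]. }
  pose proof (HB BK HBK). pose proof (HB BL HBL). nra.
Qed.

Lemma opcont_continuous K r v : opcont K r -> continuous (fun t => K t v) r.
Proof.
  intros HK. apply continuous_norm_eps. intros eps Heps.
  pose proof (norm_ge_0 v) as Hv.
  assert (0 < eps / (norm v + 1)) as H1 by (apply Rdiv_lt_0_compat; lra).
  generalize (HK _ H1). apply filter_imp. intros t Ht.
  eapply Rle_lt_trans; [apply Ht|].
  apply (Rmult_lt_reg_r (norm v + 1)); [lra|]. field_simplify; [nra|lra].
Qed.

Lemma opcont_opnorm K r (m : R -> R) :
  (forall t, 0 < t -> 0 <= m t /\ forall v, norm (K t v) <= m t * norm v) -> 0 < r ->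
  opcont K r -> continuous (fun t => opnorm (K t)) r.
Proof.
  intros Hm Hr HK. apply (continuous_norm_eps (V := R_CompleteNormedModule)). intros eps Heps.
  assert (0 < eps / 2) as He2 by lra.
  assert (locally r (fun t => 0 < t)) as Hpos.
  { exists (mkposreal r Hr). intros t Ht. assert (Rabs (t - r) < r) as H by exact Ht.
    apply Rabs_lt_between in H. lra. }
  generalize (filter_and _ _ Hpos (HK _ He2)). apply filter_imp. intros t (Ht & Hd).
  change (Rabs (opnorm (K t) - opnorm (K r)) < eps).
  destruct (Hm t Ht). destruct (Hm r Hr).
  assert (Rabs (opnorm (K t) - opnorm (K r)) <= eps / 2); [|lra].
  now apply (opnorm_diff (K t) (K r) (m t) (m r)); auto; lra.
Qed.

Definition qcont (c : R -> quat) (r : R) : Prop :=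
  forall eps, 0 < eps -> locally r (fun t => qnorm (qsub (c t) (c r)) <= eps).

Lemma opcont_lm c r : qcont c r -> opcont (fun t => lm (c t)) r.
Proof.
  intros Hc eps Heps. generalize (Hc eps Heps). apply filter_imp. intros t Ht v.
  replace (minus (lm (c t) v) (lm (c r) v)) with (lm (qsub (c t) (c r)) v) by hmod HV.
  rewrite (norm_lm lm rm HV). apply Rmult_le_compat_r; auto. apply norm_ge_0.
Qed.

End OperatorNorm.

Lemma qcont_ext c c' r : (forall t, c t = c' t) -> qcont c r -> qcont c' r.
Proof.
  intros E Hc eps Heps. generalize (Hc eps Heps). apply filter_imp. intros t. now rewrite !E.
Qed.

Lemma qcont_mul q c q' r : qcont c r -> qcont (fun t => qmul (qmul q (c t)) q') r.
Proof.
  intros Hc eps Heps. set (n := qnorm q * qnorm q' + 1).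
  assert (0 < n) as Hn.
  { unfold n. pose proof (Rmult_le_pos _ _ (qnorm_ge0 q) (qnorm_ge0 q')). lra. }
  assert (0 < eps / n) as He by (apply Rdiv_lt_0_compat; lra).
  generalize (Hc _ He). apply filter_imp. intros t Ht.
  replace (qsub _ _) with (qmul (qmul q (qsub (c t) (c r))) q') by quat_ring.
  rewrite !qnorm_mul. replace (qnorm q * _ * qnorm q') with
    ((qnorm q * qnorm q') * qnorm (qsub (c t) (c r))) by ring.
  pose proof (qnorm_ge0 (qsub (c t) (c r))).
  apply (Rle_trans _ (n * (eps / n))).
  - apply Rmult_le_compat; auto; [apply Rmult_le_pos; apply qnorm_ge0|unfold n; lra].
  - right. field. lra.
Qed.
Lemma qcont_add c c' r : qcont c r -> qcont c' r -> qcont (fun t => qadd (c t) (c' t)) r.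
Proof.
  intros Hc Hc' eps Heps. assert (0 < eps / 2) as He by lra.
  generalize (filter_and _ _ (Hc _ He) (Hc' _ He)). apply filter_imp. intros t [H1 H2].
  replace (qsub _ _) with (qadd (qsub (c t) (c r)) (qsub (c' t) (c' r))) by quat_ring.
  eapply Rle_trans; [apply qnorm_add|]. lra.
Qed.
Lemma qcont_components c r : continuous (fun t => q0 (c t)) r -> continuous (fun t => q1 (c t)) r ->
  continuous (fun t => q2 (c t)) r -> continuous (fun t => q3 (c t)) r -> qcont c r.
Proof.
  intros H0 H1 H2 H3 eps Heps. assert (0 < eps / 4) as He by lra.
  generalize (filter_and _ _ (continuous_eps_norm (V := R_CompleteNormedModule) _ _ _ H0 He)
   (filter_and _ _ (continuous_eps_norm (V := R_CompleteNormedModule) _ _ _ H1 He)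
   (filter_and _ _ (continuous_eps_norm (V := R_CompleteNormedModule) _ _ _ H2 He)
                   (continuous_eps_norm (V := R_CompleteNormedModule) _ _ _ H3 He)))).
  apply filter_imp. intros t (A0 & A1 & A2 & A3).
  set (d := qsub (c t) (c r)).
  assert (Rabs (q0 d) < eps / 4) by exact A0. assert (Rabs (q1 d) < eps / 4) by exact A1.
  assert (Rabs (q2 d) < eps / 4) by exact A2. assert (Rabs (q3 d) < eps / 4) by exact A3.
  replace d with (qadd (qscale (q0 d) qone) (qadd (qscale (q1 d) e1)
    (qadd (qscale (q2 d) e2) (qscale (q3 d) e3)))) by (destruct d; quat_ring).
  eapply Rle_trans; [apply qnorm_add|].
  eapply Rle_trans; [apply Rplus_le_compat_l, qnorm_add|].
  eapply Rle_trans; [do 2 apply Rplus_le_compat_l; apply qnorm_add|].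
  rewrite !qnorm_scale, qnorm_e1, qnorm_e2, qnorm_e3. unfold qone. rewrite qnorm_qreal, Rabs_R1.
  lra.
Qed.

(** * The path integrals *)

Lemma locally_sector_dom th u v : 0 < th < PI -> sector_dom th u v ->
  locally (u, v) (fun z : R * R => sector_dom th (fst z) (snd z)).
Proof.
  intros Hth H. pose proof in_S_e1 as HS.
  apply (sector_dom_cos th u v Hth) in H.
  set (gap := u - cos th * sqrt (u ^ 2 + v ^ 2)).
  assert (0 < gap / 2) as Hg by (unfold gap; lra).
  generalize (locally_slice u v e1 _ HS Hg). apply filter_imp. intros [u' v'] Hd. cbn [fst snd] in *.
  apply sector_dom_cos; auto.
  set (p := slice_pt u' v' e1) in *. set (s := slice_pt u v e1) in *.
  assert (q0 p = u' /\ qnorm p = sqrt (u' ^ 2 + v' ^ 2)) as [E1 E2]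
    by (split; [now apply q0_slice|now apply qnorm_slice]).
  assert (q0 s = u /\ qnorm s = sqrt (u ^ 2 + v ^ 2)) as [E3 E4]
    by (split; [now apply q0_slice|now apply qnorm_slice]).
  unfold gap in *. rewrite <- E2, <- E1. rewrite <- E4, <- E3 in Hd, Hg, H.
  pose proof (qnorm_sub_le s p) as B1. rewrite qnorm_sub_sym in B1.
  pose proof (qnorm_sub_le p s) as B2.
  pose proof (Rabs_q0_le (qsub p s)) as B3. apply Rabs_le_between in B3.
  change (q0 (qsub p s)) with (q0 p - q0 s) in B3.
  pose proof (COS_bound th). nra.
Qed.

Lemma C1_diff2 D (h : R -> R -> R) u v :
  locally (u, v) (fun z : R * R => D (fst z) (snd z)) -> C1_on D h ->
  diff2 (W := R_NormedModule) h u v (Derive (fun x => h x v) u) (Derive (fun y => h u y) v).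
Proof.
  intros Hloc HC. assert (D u v) as HD by exact (locally_singleton _ _ Hloc).
  destruct (HC u v HD) as (E1 & E2 & C1 & C2).
  apply (is_derive_filterdiff h u v (fun x y => Derive (fun x' => h x' y) x)).
  - generalize Hloc. apply filter_imp. intros z Hz.
    destruct (HC _ _ Hz) as (E1' & _). now apply Derive_correct.
  - now apply Derive_correct.
  - now apply continuity_2d_pt_filterlim in C1.
Qed.

Definition slice_pair (th : R) (al be : R -> R -> quat) : Prop :=
  C1_on_quat (sector_dom th) al /\ C1_on_quat (sector_dom th) be /\
  (forall u v, sector_dom th u v ->
     dU al u v = dV be u v /\ dV al u v = qopp (dU be u v)).

Definition component_map (qk : quat -> R) : Prop := qk = q0 \/ qk = q1 \/ qk = q2 \/ qk = q3.
#[local] Hint Unfold component_map : core.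

Lemma CR_pair_components th al be : 0 < th < PI -> slice_pair th al be ->
  forall qk, component_map qk ->
  CR_pair (W := R_NormedModule) (sector_dom th) (fun u v => qk (al u v)) (fun u v => qk (be u v))
    (fun u v => Derive (fun x => qk (al x v)) u) (fun u v => Derive (fun x => qk (be x v)) u).
Proof.
  intros Hth (Ha & Hb & Hcr) qk Hqk u v HD.
  pose proof (locally_sector_dom th u v Hth HD) as Hloc.
  destruct (Hcr u v HD) as [F1 F2].
  assert (C1_on (sector_dom th) (fun u v => qk (al u v))) as Ca
    by (destruct Hqk as [-> | [-> | [-> | ->]]]; apply Ha).
  assert (C1_on (sector_dom th) (fun u v => qk (be u v))) as Cb
    by (destruct Hqk as [-> | [-> | [-> | ->]]]; apply Hb).
  pose proof (C1_diff2 _ _ _ _ Hloc Ca) as Da. pose proof (C1_diff2 _ _ _ _ Hloc Cb) as Db.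
  assert (Derive (fun y => qk (al u y)) v = opp (Derive (fun x => qk (be x v)) u)) as E1.
  { apply (f_equal qk) in F2. destruct Hqk as [-> | [-> | [-> | ->]]]; exact F2. }
  assert (Derive (fun y => qk (be u y)) v = Derive (fun x => qk (al x v)) u) as E2.
  { apply (f_equal qk) in F1. destruct Hqk as [-> | [-> | [-> | ->]]]; symmetry; exact F1. }
  cbv beta in Da, Db. rewrite E1 in Da. rewrite E2 in Db.
  destruct (Ca u v HD) as (_ & _ & Ka & _). destruct (Cb u v HD) as (_ & _ & Kb & _).
  split; [exact Da|split; [exact Db|split]].
  - now apply continuity_2d_pt_filterlim in Ka.
  - now apply continuity_2d_pt_filterlim in Kb.
Qed.

Lemma qcont_slice_pair th al be r phi : 0 < th < PI -> slice_pair th al be ->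
  0 < r -> Rabs phi < th ->
  qcont (fun t => al (t * cos phi) (t * sin phi)) r /\
  qcont (fun t => be (t * cos phi) (t * sin phi)) r.
Proof.
  intros Hth HP Hr Hphi. pose proof (sector_dom_polar th r phi Hr Hphi) as HD.
  assert (forall h : R -> R -> R, cont2 h (r * cos phi) (r * sin phi) ->
    continuous (fun t => h (t * cos phi) (t * sin phi)) r) as Hc.
  { intros h Hh. apply (continuous_comp_2 (fun t => t * cos phi) (fun t => t * sin phi) h); auto;
    apply (ex_derive_continuous (K := R_AbsRing) (V := R_NormedModule)); auto_derive; auto. }
  assert (forall qk, component_map qk ->
    continuous (fun t => qk (al (t * cos phi) (t * sin phi))) r /\
    continuous (fun t => qk (be (t * cos phi) (t * sin phi))) r) as H.
  { intros qk Hqk. destruct (CR_pair_components th al be Hth HP qk Hqk _ _ HD) as (D1 & D2 & _).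
    split; [apply (Hc (fun u v => qk (al u v)))|apply (Hc (fun u v => qk (be u v)))].
    - exact (diff2_cont2 _ _ _ _ _ D1).
    - exact (diff2_cont2 _ _ _ _ _ D2). }
  destruct (H q0) as [? ?]; auto. destruct (H q1) as [? ?]; auto.
  destruct (H q2) as [? ?]; auto. destruct (H q3) as [? ?]; auto.
  split; now apply qcont_components.
Qed.

Lemma at_right_infty_ext {W : NormedModule R_AbsRing} (g h : R -> W) l :
  (forall r, 0 < r -> g r = h r) ->
  is_RInt_gen g (at_right 0) (Rbar_locally p_infty) l ->
  is_RInt_gen h (at_right 0) (Rbar_locally p_infty) l.
Proof.
  intros E. apply is_RInt_gen_ext.
  apply (Filter_prod _ _ _ (fun x => 0 < x) (fun x => 0 < x)).
  - exists (mkposreal 1 Rlt_0_1). auto.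
  - now exists 0.
  - intros x y Hx Hy z [Hz _]. apply E. eapply Rle_lt_trans; [|exact Hz].
    simpl. left. now apply Rmin_glb_lt.
Qed.

Lemma infty_at_left_ext {W : NormedModule R_AbsRing} (g h : R -> W) l :
  (forall r, r < 0 -> g r = h r) ->
  is_RInt_gen g (Rbar_locally m_infty) (at_left 0) l ->
  is_RInt_gen h (Rbar_locally m_infty) (at_left 0) l.
Proof.
  intros E. apply is_RInt_gen_ext.
  apply (Filter_prod _ _ _ (fun x => x < 0) (fun x => x < 0)).
  - now exists 0.
  - exists (mkposreal 1 Rlt_0_1). auto.
  - intros x y Hx Hy z [_ Hz]. apply E. eapply Rlt_le_trans; [exact Hz|].
    simpl. left. now apply Rmax_lub_lt.
Qed.

Lemma opnorm_ext {V : CompleteNormedModule R_AbsRing} (A B : V -> V) : (forall v, A v = B v) -> opnorm A = opnorm B.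
Proof.
  intros E. unfold opnorm. f_equal. apply Lub_Rbar_eqset.
  intros x; split; intros (v & Hv & ->); exists v; split; auto; now rewrite E.
Qed.

Section PairClosure.
Context {V : CompleteNormedModule R_AbsRing}.

Lemma CR_pair_linear D (l : V -> V) (P N Pu Nu : R -> R -> V) : is_linear l ->
  CR_pair D P N Pu Nu ->
  CR_pair D (fun u v => l (P u v)) (fun u v => l (N u v))
    (fun u v => l (Pu u v)) (fun u v => l (Nu u v)).
Proof.
  intros Hl H u v HD. destruct (H u v HD) as (H1 & H2 & H3 & H4).
  split; [|split; [|split]].
  - exact (eq_rect _ (fun x => diff2 (fun u v => l (P u v)) u v (l (Pu u v)) x)
      (diff2_linear l _ _ _ _ _ Hl H1) _ (linear_opp l (Nu u v) Hl)).
  - now apply (diff2_linear l).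
  - now apply (cont2_linear l).
  - now apply (cont2_linear l).
Qed.

Lemma CR_pair_eq (D D' : R -> R -> Prop) (P N Pu Nu P' N' : R -> R -> V) :
  (forall u v, D' u v -> D u v) ->
  (forall u v, P' u v = P u v) -> (forall u v, N' u v = N u v) ->
  CR_pair D P N Pu Nu -> CR_pair D' P' N' Pu Nu.
Proof.
  intros HDD EP EN H u v HD. destruct (H u v (HDD u v HD)) as (H1 & H2 & H3 & H4).
  split; [|split; [|split]]; auto.
  - now apply (diff2_eq _ _ _ _ _ _ _ _ H1).
  - now apply (diff2_eq _ _ _ _ _ _ _ _ H2).
Qed.

End PairClosure.

Section Rays.
Context {V : CompleteNormedModule R_AbsRing}.
Variables (lm : quat -> V -> V) (rm : V -> quat -> V).
Hypothesis HV : two_sided lm rm.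
Variables (dom : V -> Prop) (T0 T1 T2 T3 : V -> V).
Hypothesis HT : is_KC lm rm dom T0 T1 T2 T3.
Variable omega : R.
Hypothesis Htype : of_type lm dom T0 T1 T2 T3 omega.
Hypothesis Htype' : of_type lm dom T0 (fun v => opp (T1 v)) (fun v => opp (T2 v))
                      (fun v => opp (T3 v)) omega.
Variable theta : R.
Hypothesis Htheta : omega < theta < PI.

Local Notation Res := (Qinv lm dom T0 T1 T2 T3).
Local Notation rho := (in_rhoS lm dom T0 T1 T2 T3).
Local Notation Even := (Res_even lm dom T0 T1 T2 T3).
Local Notation Odd := (Res_odd lm dom T0 T1 T2 T3).

Lemma theta_bounds : 0 < omega /\ 0 < theta < PI.
Proof. destruct Htype as (H & _). lra. Qed.

Section Data.
Variables (left : bool) (f : quat -> quat) (al be : R -> R -> quat).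
Hypothesis Hpair : slice_pair theta al be.
Hypothesis Hf : forall u v, sector_dom theta u v -> forall J, in_S J ->
  f (slice_pt u v J) = qadd (al u v) (if left then qmul J (be u v) else qmul (be u v) J).
Variables (a C : R).
Hypothesis Ha : 0 < a.
Hypothesis HC : 0 <= C.
Hypothesis Hdecay : forall s, in_sector theta s -> qnorm (f s) <= C * decay a (qnorm s).

(* Real and imaginary parts of the formal product [(Even + i Odd) (al + i be)]. *)
Definition prod_re (w : V) (u v : R) : V :=
  minus (lm (al u v) (Even u v w)) (lm (be u v) (Odd u v w)).
Definition prod_im (w : V) (u v : R) : V :=
  plus (lm (be u v) (Even u v w)) (lm (al u v) (Odd u v w)).

(** The quaternionic coefficients are split into real components, with the unit [e_k] moved onto the
    resolvent pair; only products of real with [V]-valued pairs are left. *)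
Lemma CR_pair_prod w : exists Pu Nu,
  CR_pair (fun u v => outside omega u v /\ sector_dom theta u v) (prod_re w) (prod_im w) Pu Nu.
Proof.
  set (D := fun u v => outside omega u v /\ sector_dom theta u v).
  pose proof (CR_pair_Res lm rm HV dom T0 T1 T2 T3 HT omega Htype Htype' w) as HR.
  assert (forall qk e, component_map qk -> exists Pu Nu, CR_pair D
    (fun u v => minus (scal (qk (al u v)) (lm e (Even u v w))) (scal (qk (be u v)) (lm e (Odd u v w))))
    (fun u v => plus (scal (qk (al u v)) (lm e (Odd u v w))) (scal (qk (be u v)) (lm e (Even u v w))))
    Pu Nu) as Hk.
  { intros qk e Hqk. do 2 eexists. apply (CR_pair_mul lm rm HV D).
    - intros u v [_ HD].
      exact (CR_pair_components theta al be (proj2 theta_bounds) Hpair qk Hqk u v HD).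
    - intros u v [HD _].
      exact (CR_pair_linear _ (lm e) _ _ _ _ (is_linear_lm lm rm HV e) HR u v HD). }
  destruct (Hk q0 qone) as (P0 & N0 & H0); auto. destruct (Hk q1 e1) as (P1 & N1 & H1); auto.
  destruct (Hk q2 e2) as (P2 & N2 & H2); auto. destruct (Hk q3 e3) as (P3 & N3 & H3); auto.
  pose proof (CR_pair_plus lm rm HV D _ _ _ _ _ _ _ _ H0
    (CR_pair_plus lm rm HV D _ _ _ _ _ _ _ _ H1
      (CR_pair_plus lm rm HV D _ _ _ _ _ _ _ _ H2 H3))) as H.
  do 2 eexists. refine (CR_pair_eq D D _ _ _ _ _ _ (fun _ _ HD => HD) _ _ H).
  - intros u v. unfold prod_re. hmod HV.
  - intros u v. unfold prod_im. hmod HV.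
Qed.

Lemma polar_region r phi : 0 < r -> omega < phi < theta ->
  outside omega (r * cos phi) (r * sin phi) /\ sector_dom theta (r * cos phi) (r * sin phi).
Proof.
  intros Hr Hphi. pose proof theta_bounds as [H1 H2]. split.
  - unfold outside. rewrite sqrt_polar by lra.
    assert (cos phi < cos omega) by (apply cos_decreasing_1; lra). nra.
  - apply sector_dom_polar; auto. rewrite Rabs_right; lra.
Qed.

(** Both halves of the path have this form, with the unit [K = J] for [t < 0] and [K = - J] for
    [t > 0], because [dgamma] times [J^{-1}] equals [e^{K phi} K] in either case. The flag [left]
    treats the two functionals at once. *)
Definition ray (phi : R) (J : quat) (r : R) (v : V) : V :=
  let s := slice_pt (r * cos phi) (r * sin phi) J in
  if left then Res s (lm (qmul (qmul (qexpJ J phi) J) (f s)) v)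
  else lm (qmul (f s) (qmul (qexpJ J phi) J)) (Res s v).

Lemma exp_J_mul_left phi J x y : in_S J ->
  qmul (qmul (qexpJ J phi) J) (qadd x (qmul J y)) =
    qsub (qmul J (qsub (qscale (cos phi) x) (qscale (sin phi) y)))
         (qadd (qscale (cos phi) y) (qscale (sin phi) x)).
Proof.
  intros HJ.
  transitivity (qadd (qadd (qmul J (qscale (cos phi) x)) (qmul (qmul J J) (qscale (cos phi) y)))
    (qadd (qmul (qmul J J) (qscale (sin phi) x)) (qmul J (qmul (qmul J J) (qscale (sin phi) y)))));
  [quat_ring|].
  rewrite qmul_JJ by auto. quat_ring.
Qed.

Lemma exp_J_mul_right phi J x y : in_S J ->
  qmul (qadd x (qmul y J)) (qmul (qexpJ J phi) J) =
    qsub (qmul (qsub (qscale (cos phi) x) (qscale (sin phi) y)) J)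
         (qadd (qscale (cos phi) y) (qscale (sin phi) x)).
Proof.
  intros HJ.
  transitivity (qadd (qadd (qmul (qscale (cos phi) x) J) (qmul (qscale (cos phi) y) (qmul J J)))
    (qadd (qmul (qscale (sin phi) x) (qmul J J)) (qmul (qmul (qscale (sin phi) y) (qmul J J)) J)));
  [quat_ring|].
  rewrite qmul_JJ by auto. quat_ring.
Qed.

(** The terms odd in the unit cancel between [J] and [- J]. In the left case the coefficient stands
    under the resolvent and comes out by [Res_even_odd_lm]. In the right case it is already outside
    and [J] multiplies it from the other side; [J J = -1] gives the same result. *)
Lemma ray_sum phi J r v : 0 < r -> omega < phi < theta -> in_S J ->
  plus (ray phi J r v) (ray phi (qopp J) r v) =
  scal (-2) (im_ray (prod_re v) (prod_im v) r phi).
Proof.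
  intros Hr Hphi HJ. destruct (polar_region r phi Hr Hphi) as [H1 H2].
  pose proof (in_S_opp J HJ) as HJ'. unfold ray. cbv zeta.
  rewrite (Hf _ _ H2 J HJ), (Hf _ _ H2 _ HJ').
  set (u := r * cos phi) in *. set (w := r * sin phi) in *.
  unfold im_ray, prod_re, prod_im. fold u w.
  destruct left.
  - rewrite !(exp_J_mul_left phi) by auto.
    rewrite !(Qinv_slice lm rm HV dom T0 T1 T2 T3 HT omega Htype Htype') by auto.
    set (c1 := qsub (qmul J _) _). set (c2 := qsub (qmul (qopp J) _) _).
    destruct (Res_even_odd_lm lm rm HV dom T0 T1 T2 T3 HT omega Htype Htype' u w c1 v H1) as [-> ->].
    destruct (Res_even_odd_lm lm rm HV dom T0 T1 T2 T3 HT omega Htype Htype' u w c2 v H1) as [-> ->].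
    (* The coefficient of the odd part; that of the even part is [qadd c1 c2]. *)
    assert (qadd (qmul J c1) (qmul (qopp J) c2) =
      qscale (-2) (qsub (qscale (cos phi) (al u w)) (qscale (sin phi) (be u w)))) as E.
    { transitivity (qscale 2 (qmul (qmul J J)
        (qsub (qscale (cos phi) (al u w)) (qscale (sin phi) (be u w)))));
      [unfold c1, c2; quat_ring|]. rewrite qmul_JJ by auto. quat_ring. }
    transitivity (plus (lm (qadd c1 c2) (Even u w v))
      (lm (qadd (qmul J c1) (qmul (qopp J) c2)) (Odd u w v))); [hmod HV|].
    rewrite E. unfold c1, c2. hmod HV.
  - rewrite !(exp_J_mul_right phi) by auto.
    rewrite !(Qinv_slice lm rm HV dom T0 T1 T2 T3 HT omega Htype Htype') by auto.
    set (c1 := qsub (qmul _ J) _). set (c2 := qsub (qmul _ (qopp J)) _).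
    assert (qadd (qmul c1 J) (qmul c2 (qopp J)) =
      qscale (-2) (qsub (qscale (cos phi) (al u w)) (qscale (sin phi) (be u w)))) as E.
    { transitivity (qscale 2 (qmul
        (qsub (qscale (cos phi) (al u w)) (qscale (sin phi) (be u w))) (qmul J J)));
      [unfold c1, c2; quat_ring|]. rewrite qmul_JJ by auto. quat_ring. }
    transitivity (plus (lm (qadd c1 c2) (Even u w v))
      (lm (qadd (qmul c1 J) (qmul c2 (qopp J))) (Odd u w v))); [hmod HV|].
    rewrite E. unfold c1, c2. hmod HV.
Qed.

Lemma f_decay r phi J : 0 < r -> omega < phi < theta -> in_S J ->
  qnorm (f (slice_pt (r * cos phi) (r * sin phi) J)) <= C * decay a r.
Proof.
  intros Hr Hphi HJ. destruct (polar_region r phi Hr Hphi) as [_ H2].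
  rewrite <- (sqrt_polar r phi) at 3 by lra. rewrite <- (qnorm_slice _ _ J HJ).
  apply Hdecay. now apply H2.
Qed.

(** The values of [f] at [u + e1 v] and [u - e1 v] are [al + z] and [al - z] with [|z| = |be|]; half
    sum and half difference inherit the bound. *)
Lemma al_be_decay r phi : 0 < r -> omega < phi < theta ->
  qnorm (al (r * cos phi) (r * sin phi)) <= C * decay a r /\
  qnorm (be (r * cos phi) (r * sin phi)) <= C * decay a r.
Proof.
  intros Hr Hphi. destruct (polar_region r phi Hr Hphi) as [_ H2].
  pose proof in_S_e1 as H1. pose proof (in_S_opp _ H1) as H1'.
  pose proof (f_decay r phi e1 Hr Hphi H1) as B1.
  pose proof (f_decay r phi (qopp e1) Hr Hphi H1') as B2.
  rewrite (Hf _ _ H2 _ H1) in B1. rewrite (Hf _ _ H2 _ H1') in B2.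
  set (x := al _ _) in *. set (y := be _ _) in *.
  assert (forall p q : quat, qnorm p <= C * decay a r -> qnorm q <= C * decay a r ->
    qnorm (qscale (/2) (qadd p q)) <= C * decay a r) as Hh.
  { intros p q Hp Hq. rewrite qnorm_scale, Rabs_right by lra.
    pose proof (qnorm_add p q). lra. }
  set (z := if left then qmul e1 y else qmul y e1).
  assert ((if left then qmul (qopp e1) y else qmul y (qopp e1)) = qopp z) as Ez
    by (unfold z; destruct left; quat_ring).
  rewrite Ez in B2. split.
  - replace x with (qscale (/2) (qadd (qadd x z) (qadd x (qopp z)))) by quat_ring.
    now apply Hh.
  - assert (qnorm z = qnorm y) as <-.
    { unfold z; destruct left; rewrite qnorm_mul, qnorm_e1; ring. }
    replace z with (qscale (/2) (qadd (qadd x z) (qopp (qadd x (qopp z))))) by quat_ring.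
    apply Hh; auto. now rewrite qnorm_opp.
Qed.

(** One constant serves all angles from [phi0] on, since these rays lie outside the open sector of
    angle [phi0]; the rotation argument needs this uniformity. *)
Lemma Qinv_polar_bound phi0 : omega < phi0 < theta -> exists M, 0 <= M /\
  forall r phi J, 0 < r -> phi0 <= phi < theta -> in_S J ->
    forall v, norm (Res (slice_pt (r * cos phi) (r * sin phi) J) v) <= M / r ^ 2 * norm v.
Proof.
  intros H. pose proof theta_bounds as [H1 H2].
  destruct (Qinv_bound lm rm HV dom T0 T1 T2 T3 HT omega Htype Htype' phi0) as (M & HM & HB); [lra|].
  exists M. split; auto. intros r phi J Hr Hphi HJ v.
  destruct (HB (slice_pt (r * cos phi) (r * sin phi) J)) as [_ Hb].
  - rewrite q0_slice, qnorm_slice, sqrt_polar by (auto; lra).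
    assert (cos phi <= cos phi0); [|nra].
    destruct (proj1 Hphi) as [Hlt|<-]; [left; apply cos_decreasing_1|right]; lra.
  - intros E. apply (f_equal qnorm) in E.
    rewrite qnorm_slice, sqrt_polar, qnorm_qreal, Rabs_R0 in E by (auto; lra). lra.
  - destruct (Hb v) as [Hb1 _]. now rewrite qnorm_slice, sqrt_polar in Hb1 by (auto; lra).
Qed.

Lemma ray_bound phi J : omega < phi < theta -> in_S J -> exists B, 0 <= B /\
  forall r v, 0 < r -> norm (ray phi J r v) <= B / r ^ 2 * decay a r * norm v.
Proof.
  intros Hphi HJ. destruct (Qinv_polar_bound phi Hphi) as (M & HM & HB).
  exists (M * C). split; [now apply Rmult_le_pos|]. intros r v Hr.
  pose proof (f_decay r phi J Hr Hphi HJ) as Bf.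
  assert (forall w, norm (Res (slice_pt (r * cos phi) (r * sin phi) J) w) <= M / r ^ 2 * norm w)
    as BR by (intros; apply HB; auto; lra).
  pose proof (norm_ge_0 v) as Hv. pose proof (decay_ge0 a r) as Hd.
  assert (0 <= M / r ^ 2) as HMr by (apply Rdiv_le_0_compat; nra).
  replace (M * C / r ^ 2 * decay a r * norm v) with
    (M / r ^ 2 * (C * decay a r * norm v)) by (field; lra).
  assert (qnorm J = 1) as EJ by apply HJ.
  unfold ray. cbv zeta. destruct left.
  - eapply Rle_trans; [apply BR|]. apply Rmult_le_compat_l; auto.
    rewrite (norm_lm lm rm HV), !qnorm_mul, qnorm_qexpJ, EJ by auto.
    apply Rmult_le_compat_r; auto. lra.
  - rewrite (norm_lm lm rm HV), !qnorm_mul, qnorm_qexpJ, EJ, !Rmult_1_r by auto.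
    replace (M / r ^ 2 * (C * decay a r * norm v)) with
      (C * decay a r * (M / r ^ 2 * norm v)) by ring.
    apply Rmult_le_compat; auto; [apply qnorm_ge0|apply norm_ge_0].
Qed.

Lemma re_ray_bound phi0 : omega < phi0 < theta -> forall v, exists B, 0 <= B /\
  forall r phi, 0 < r -> phi0 <= phi < theta ->
    norm (scal r (re_ray (prod_re v) (prod_im v) r phi)) <= B / r * decay a r.
Proof.
  intros Hphi0 v. destruct (Qinv_polar_bound phi0 Hphi0) as (M & HM & HB).
  (* [re_ray] contains four products of [al] or [be] with the even or odd part. *)
  exists (4 * M * C * norm v). pose proof (norm_ge_0 v) as Hv.
  split; [repeat apply Rmult_le_pos; auto; lra|].
  intros r phi Hr Hphi. pose proof theta_bounds as [Ho Ht].
  assert (omega < phi < theta) as Hphi' by lra.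
  destruct (al_be_decay r phi Hr Hphi') as [Ba Bb].
  pose proof in_S_e1 as H1. pose proof (in_S_opp _ H1) as H1'.
  unfold re_ray, prod_re, prod_im.
  set (u := r * cos phi) in *. set (w := r * sin phi) in *.
  assert (norm (Res (slice_pt u w e1) v) <= M / r ^ 2 * norm v) as R1 by now apply HB.
  assert (norm (Res (slice_pt u w (qopp e1)) v) <= M / r ^ 2 * norm v) as R2 by now apply HB.
  assert (norm (Even u w v) <= M / r ^ 2 * norm v) as BE.
  { unfold Res_even. eapply Rle_trans; [apply vnorm_scal|]. rewrite Rabs_right by lra.
    pose proof (vnorm_plus (Res (slice_pt u w e1) v) (Res (slice_pt u w (qopp e1)) v)). lra. }
  assert (norm (Odd u w v) <= M / r ^ 2 * norm v) as BO.
  { unfold Res_odd. eapply Rle_trans; [apply vnorm_scal|]. rewrite Rabs_left by lra.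
    rewrite (norm_lm lm rm HV), qnorm_e1.
    pose proof (vnorm_minus (Res (slice_pt u w e1) v) (Res (slice_pt u w (qopp e1)) v)). lra. }
  set (X := M / r ^ 2 * norm v) in *. set (Y := C * decay a r) in *.
  assert (forall q x, qnorm q <= Y -> norm x <= X -> norm (lm q x) <= Y * X) as Hq.
  { intros q x Hq Hx. rewrite (norm_lm lm rm HV).
    apply Rmult_le_compat; auto; [apply qnorm_ge0|apply norm_ge_0]. }
  assert (forall c (x y : V), Rabs c <= 1 -> norm x <= Y * X -> norm y <= Y * X ->
    norm (scal c (minus x y)) <= 2 * (Y * X) /\ norm (scal c (plus x y)) <= 2 * (Y * X)) as Hc.
  { intros c x y Hc Hx Hy. pose proof (vnorm_minus x y). pose proof (vnorm_plus x y).
    pose proof (norm_ge_0 x). pose proof (norm_ge_0 y). pose proof (Rabs_pos c).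
    split; (eapply Rle_trans; [apply vnorm_scal|]);
    (eapply Rle_trans; [apply Rmult_le_compat_r; [apply norm_ge_0|exact Hc]|]); lra. }
  assert (forall x, -1 <= x <= 1 -> Rabs x <= 1) as Hab by (intros; now apply Rabs_le).
  destruct (Hc (cos phi) (lm (al u w) (Even u w v)) (lm (be u w) (Odd u w v))) as [F1 _];
    auto using COS_bound.
  destruct (Hc (sin phi) (lm (be u w) (Even u w v)) (lm (al u w) (Odd u w v))) as [_ F2];
    auto using SIN_bound.
  eapply Rle_trans; [apply vnorm_scal|]. rewrite Rabs_right by lra.
  replace (4 * M * C * norm v / r * decay a r) with (r * (4 * (Y * X)))
    by (unfold X, Y; field; lra).
  apply Rmult_le_compat_l; [lra|]. eapply Rle_trans; [apply vnorm_minus|]. lra.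
Qed.

Lemma opcont_Res phi J r : omega < phi < theta -> in_S J -> 0 < r ->
  exists K, 0 <= K /\
  opcont (fun t => Res (slice_pt (t * cos phi) (t * sin phi) J)) r /\
  locally r (fun t => 0 < t /\ forall v,
    norm (Res (slice_pt (t * cos phi) (t * sin phi) J) v) <= K * norm v).
Proof.
  intros Hphi HJ Hr. destruct (polar_region r phi Hr Hphi) as [H1 _].
  set (s := slice_pt (r * cos phi) (r * sin phi) J).
  assert (q0 s < cos omega * qnorm s) as Hs by (unfold s; now rewrite q0_slice, qnorm_slice).
  destruct (Qinv_local_lipschitz lm rm HV dom T0 T1 T2 T3 HT omega Htype Htype' s Hs)
    as (d & K & Hd & HK & HB).
  assert (forall t, qnorm (qsub (slice_pt (t * cos phi) (t * sin phi) J) s) = Rabs (t - r)) as Ed.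
  { intros t. replace (qsub _ s) with (qscale (t - r) (qexpJ J phi)) by (unfold s; quat_ring).
    rewrite qnorm_scale, qnorm_qexpJ by auto. ring. }
  exists K. split; auto. split.
  - intros eps Heps. assert (0 < Rmin d (eps / (K + 1))) as Hm.
    { apply Rmin_pos; auto. apply Rdiv_lt_0_compat; lra. }
    exists (mkposreal _ Hm). intros t Ht v.
    assert (Rabs (t - r) < Rmin d (eps / (K + 1))) as Ht' by exact Ht.
    assert (Rabs (t - r) < d) as B1 by (eapply Rlt_le_trans; [exact Ht'|apply Rmin_l]).
    assert (Rabs (t - r) < eps / (K + 1)) as B2 by (eapply Rlt_le_trans; [exact Ht'|apply Rmin_r]).
    rewrite <- Ed in B1. destruct (HB _ B1) as [_ Hb]. destruct (Hb v) as (_ & _ & B3 & _).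
    rewrite Ed in B3. eapply Rle_trans; [exact B3|].
    apply Rmult_le_compat_r; [apply norm_ge_0|].
    apply (Rmult_lt_compat_r (K + 1)) in B2; [|lra].
    unfold Rdiv in B2. rewrite Rmult_assoc, Rinv_l in B2 by lra.
    pose proof (Rabs_pos (t - r)). nra.
  - assert (0 < Rmin d r) as Hm by now apply Rmin_pos.
    exists (mkposreal _ Hm). intros t Ht.
    assert (Rabs (t - r) < Rmin d r) as Ht' by exact Ht.
    assert (Rabs (t - r) < d) as B1 by (eapply Rlt_le_trans; [exact Ht'|apply Rmin_l]).
    assert (Rabs (t - r) < r) as B2 by (eapply Rlt_le_trans; [exact Ht'|apply Rmin_r]).
    apply Rabs_lt_between in B2. split; [lra|]. intros v.
    rewrite <- Ed in B1. destruct (HB _ B1) as [_ Hb]. now destruct (Hb v).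
Qed.

Lemma qcont_f phi J r : omega < phi < theta -> in_S J -> 0 < r ->
  qcont (fun t => f (slice_pt (t * cos phi) (t * sin phi) J)) r.
Proof.
  intros Hphi HJ Hr. pose proof theta_bounds as [Ho Ht].
  destruct (qcont_slice_pair theta al be r phi Ht Hpair Hr) as [Ca Cb];
    [rewrite Rabs_right; lra|].
  assert (qcont (fun t => if left then qmul J (be (t * cos phi) (t * sin phi))
                          else qmul (be (t * cos phi) (t * sin phi)) J) r) as Cb'.
  { destruct left.
    - apply (qcont_ext (fun t => qmul (qmul J (be (t * cos phi) (t * sin phi))) qone));
      [intros; quat_ring|now apply (qcont_mul J _ qone)].
    - apply (qcont_ext (fun t => qmul (qmul qone (be (t * cos phi) (t * sin phi))) J));
      [intros; quat_ring|now apply (qcont_mul qone _ J)]. }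
  intros eps Heps.
  assert (locally r (fun t => 0 < t)) as Hpos.
  { exists (mkposreal r Hr). intros t Ht'. assert (Rabs (t - r) < r) as H by exact Ht'.
    apply Rabs_lt_between in H. lra. }
  generalize (filter_and _ _ Hpos (qcont_add _ _ r Ca Cb' eps Heps)).
  apply filter_imp. intros t [Ht' H].
  rewrite (Hf _ _ (proj2 (polar_region t phi Ht' Hphi)) J HJ).
  now rewrite (Hf _ _ (proj2 (polar_region r phi Hr Hphi)) J HJ).
Qed.

Lemma ray_opcont phi J r : omega < phi < theta -> in_S J -> 0 < r -> opcont (ray phi J) r.
Proof.
  intros Hphi HJ Hr. destruct (opcont_Res phi J r Hphi HJ Hr) as (K & HK & HR & Hloc).
  pose proof (qcont_f phi J r Hphi HJ Hr) as Hq.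
  assert (qcont (fun t => if left
     then qmul (qmul (qexpJ J phi) J) (f (slice_pt (t * cos phi) (t * sin phi) J))
     else qmul (f (slice_pt (t * cos phi) (t * sin phi) J)) (qmul (qexpJ J phi) J)) r) as Hc.
  { destruct left.
    - apply (qcont_ext (fun t => qmul (qmul (qmul (qexpJ J phi) J)
        (f (slice_pt (t * cos phi) (t * sin phi) J))) qone));
      [intros; quat_ring|now apply (qcont_mul _ _ qone)].
    - apply (qcont_ext (fun t => qmul (qmul qone
        (f (slice_pt (t * cos phi) (t * sin phi) J))) (qmul (qexpJ J phi) J)));
      [intros; quat_ring|now apply (qcont_mul qone)]. }
  pose proof (opcont_lm lm rm HV _ _ Hc) as Hl.
  assert (forall t v w, 0 < t -> Res (slice_pt (t * cos phi) (t * sin phi) J) (minus v w) =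
    minus (Res (slice_pt (t * cos phi) (t * sin phi) J) v)
          (Res (slice_pt (t * cos phi) (t * sin phi) J) w)) as Hmin.
  { intros t v w Ht. destruct (polar_region t phi Ht Hphi) as [H1 _].
    unfold minus. rewrite (Qinv_plus lm rm HV dom T0 T1 T2 T3 HT), (Qinv_opp lm rm HV dom T0 T1 T2 T3 HT);
    auto; apply (rho_outside lm dom T0 T1 T2 T3 omega Htype Htype'); auto. }
  unfold ray. cbv zeta. destruct left.
  - apply (opcont_comp lm rm HV
      (fun t => Res (slice_pt (t * cos phi) (t * sin phi) J))
      (fun t => lm (qmul (qmul (qexpJ J phi) J) (f (slice_pt (t * cos phi) (t * sin phi) J))))
      r K (qnorm (qmul (qmul (qexpJ J phi) J) (f (slice_pt (r * cos phi) (r * sin phi) J))))); auto.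
    + apply qnorm_ge0.
    + generalize Hloc. apply filter_imp. intros t [Ht Hb]. split; auto.
    + intros v. right. apply (norm_lm lm rm HV).
  - set (c := fun t => qmul (f (slice_pt (t * cos phi) (t * sin phi) J)) (qmul (qexpJ J phi) J)) in *.
    apply (opcont_comp lm rm HV (fun t => lm (c t))
      (fun t => Res (slice_pt (t * cos phi) (t * sin phi) J)) r (qnorm (c r) + 1) K); auto.
    + pose proof (qnorm_ge0 (c r)). lra.
    + generalize (Hc 1 Rlt_0_1). apply filter_imp. intros t Ht. split.
      * intros v. rewrite (norm_lm lm rm HV). apply Rmult_le_compat_r; [apply norm_ge_0|].
        pose proof (qnorm_sub_le (c t) (c r)). lra.
      * intros v w. hmod HV.
    + apply (locally_singleton _ _ Hloc).
Qed.

Lemma ex_RInt_gen_ray phi J v : omega < phi < theta -> in_S J ->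
  ex_RInt_gen (fun r => ray phi J r v) (at_right 0) (Rbar_locally p_infty).
Proof.
  intros Hphi HJ. destruct (ray_bound phi J Hphi HJ) as (B & HB & Hb).
  pose proof (norm_ge_0 v) as Hv.
  apply (ex_RInt_gen_dominated _ (majorant a (4 * (B * norm v) / a))
    (dmajorant a (4 * (B * norm v) / a)) 0 (4 * (B * norm v) / a)).
  - intros r Hr. apply opcont_continuous. now apply ray_opcont.
  - intros. now apply is_derive_majorant.
  - intros. now apply continuous_dmajorant.
  - intros r Hr. eapply Rle_trans; [now apply Hb|].
    replace (B / r ^ 2 * decay a r * norm v) with (B * norm v / r ^ 2 * decay a r) by (field; lra).
    apply decay_le_dmajorant; auto. now apply Rmult_le_pos.
  - now apply majorant_lim_0.
  - now apply majorant_lim_infty.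
Qed.

Lemma ex_RInt_gen_opnorm_ray phi J : omega < phi < theta -> in_S J ->
  ex_RInt_gen (fun r => opnorm (ray phi J r)) (at_right 0) (Rbar_locally p_infty).
Proof.
  intros Hphi HJ. destruct (ray_bound phi J Hphi HJ) as (B & HB & Hb).
  assert (forall t, 0 < t -> 0 <= B / t ^ 2 * decay a t /\
    forall v, norm (ray phi J t v) <= B / t ^ 2 * decay a t * norm v) as Hm.
  { intros t Ht. split; auto. apply Rmult_le_pos; [apply Rdiv_le_0_compat; nra|apply decay_ge0]. }
  apply (ex_RInt_gen_dominated (V := R_CompleteNormedModule) _ (majorant a (4 * B / a))
    (dmajorant a (4 * B / a)) 0 (4 * B / a)).
  - intros r Hr. apply (opcont_opnorm lm rm HV _ r _ Hm Hr). now apply ray_opcont.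
  - intros. now apply is_derive_majorant.
  - intros. now apply continuous_dmajorant.
  - intros r Hr. destruct (Hm r Hr) as [H1 H2].
    destruct (opnorm_bounds (ray phi J r) _ H2 H1) as [H3 H4].
    change (Rabs (opnorm (ray phi J r)) <= dmajorant a (4 * B / a) r).
    rewrite Rabs_right by lra. eapply Rle_trans; [exact H4|].
    now apply decay_le_dmajorant.
  - now apply majorant_lim_0.
  - now apply majorant_lim_infty.
Qed.

Definition path_op : quat -> R -> R -> V -> V :=
  fun J phi => if left then KL lm dom T0 T1 T2 T3 f phi J else KR lm dom T0 T1 T2 T3 f phi J.

Lemma path_op_neg phi J r v : 0 < r -> in_S J -> path_op J phi (- r) v = ray phi J r v.
Proof.
  intros Hr HJ. unfold path_op, ray, KL, KR. cbv zeta.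
  destruct left; unfold gamma, dgamma; (destruct (Rlt_dec (- r) 0) as [_|]; [|lra]);
  rewrite Ropp_involutive, qinv_J, slice_polar by auto; [f_equal; f_equal|f_equal]; quat_ring.
Qed.

Lemma path_op_pos phi J r v : 0 < r -> in_S J -> path_op J phi r v = ray phi (qopp J) r v.
Proof.
  intros Hr HJ. unfold path_op, ray, KL, KR. cbv zeta.
  assert (qexpJ J (- phi) = qexpJ (qopp J) phi) as E.
  { unfold qexpJ. rewrite cos_neg, sin_neg. quat_ring. }
  destruct left; unfold gamma, dgamma; (destruct (Rlt_dec r 0) as [|_]; [lra|]);
  rewrite E, qinv_J, slice_polar by auto; [f_equal; f_equal|f_equal]; quat_ring.
Qed.

Lemma path_op_abs_conv phi J : omega < phi < theta -> in_S J -> abs_conv (path_op J phi).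
Proof.
  intros Hphi HJ. pose proof (in_S_opp J HJ) as HJ'. split; [|split].
  - intros t Ht.
    assert (0 < t \/ 0 < - t) as [Hpos|Hneg] by lra.
    + destruct (ray_bound phi _ Hphi HJ') as (B & HB & Hb).
      exists (B / t ^ 2 * decay a t). intros v. rewrite path_op_pos; auto.
    + destruct (ray_bound phi _ Hphi HJ) as (B & HB & Hb).
      exists (B / (- t) ^ 2 * decay a (- t)). intros v.
      rewrite <- (Ropp_involutive t) at 1. rewrite path_op_neg; auto.
  - destruct (ex_RInt_gen_opnorm_ray phi J Hphi HJ) as [l Hl]. exists l.
    apply (is_RInt_gen_reflect (V := R_CompleteNormedModule)) in Hl. revert Hl.
    apply infty_at_left_ext. intros r Hr. apply opnorm_ext. intros v.
    rewrite <- path_op_neg by (auto; lra). now rewrite Ropp_involutive.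
  - destruct (ex_RInt_gen_opnorm_ray phi _ Hphi HJ') as [l Hl]. exists l. revert Hl.
    apply at_right_infty_ext. intros r Hr. apply opnorm_ext. intros v.
    symmetry. now apply path_op_pos.
Qed.

Lemma path_op_integrals phi J v : omega < phi < theta -> in_S J -> exists a1 a2 : V,
  is_RInt_gen (fun t => path_op J phi t v) (Rbar_locally m_infty) (at_left 0) a1 /\
  is_RInt_gen (fun t => path_op J phi t v) (at_right 0) (Rbar_locally p_infty) a2 /\
  is_RInt_gen (fun r => im_ray (prod_re v) (prod_im v) r phi)
    (at_right 0) (Rbar_locally p_infty) (scal (- / 2) (plus a1 a2)).
Proof.
  intros Hphi HJ. pose proof (in_S_opp J HJ) as HJ'.
  destruct (ex_RInt_gen_ray phi J v Hphi HJ) as [a1 H1].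
  destruct (ex_RInt_gen_ray phi _ v Hphi HJ') as [a2 H2].
  exists a1, a2. split; [|split].
  - apply is_RInt_gen_reflect in H1. revert H1. apply infty_at_left_ext.
    intros r Hr. rewrite <- path_op_neg by (auto; lra). now rewrite Ropp_involutive.
  - revert H2. apply at_right_infty_ext. intros r Hr. symmetry. now apply path_op_pos.
  (* [- / 2] undoes the factor [-2] of [ray_sum]. *)
  - pose proof (is_RInt_gen_scal _ (- / 2) _ (is_RInt_gen_plus _ _ _ _ H1 H2)) as H.
    revert H. apply at_right_infty_ext. intros r Hr.
    change (scal (- / 2) (plus (ray phi J r v) (ray phi (qopp J) r v)) =
      im_ray (prod_re v) (prod_im v) r phi).
    rewrite ray_sum by auto. hmod HV.
Qed.

Lemma im_ray_integral_unique phi phi' v l l' : omega < phi < theta -> omega < phi' < theta ->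
  is_RInt_gen (fun r => im_ray (prod_re v) (prod_im v) r phi)
    (at_right 0) (Rbar_locally p_infty) l ->
  is_RInt_gen (fun r => im_ray (prod_re v) (prod_im v) r phi')
    (at_right 0) (Rbar_locally p_infty) l' -> l = l'.
Proof.
  assert (forall phi phi' l l', phi <= phi' -> omega < phi < theta -> omega < phi' < theta ->
    is_RInt_gen (fun r => im_ray (prod_re v) (prod_im v) r phi)
      (at_right 0) (Rbar_locally p_infty) l ->
    is_RInt_gen (fun r => im_ray (prod_re v) (prod_im v) r phi')
      (at_right 0) (Rbar_locally p_infty) l' -> l = l') as H.
  { clear phi phi' l l'. intros phi phi' l l' Hle H H' I I'.
    destruct (CR_pair_prod v) as (Pu & Nu & HCR).
    destruct (re_ray_bound phi H v) as (B & HB & Hb).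
    apply (rotation_invariance lm rm HV _ _ _ _ _ HCR phi phi' (fun r => B / r * decay a r));
      auto.
    - exists omega, theta. split; [lra|split; [lra|]]. intros r p Hr Hp.
      now apply polar_region.
    - intros r p Hr Hp. apply Hb; auto. lra.
    - now apply decay_lim_0.
    - now apply decay_lim_infty. }
  intros H1 H2 I1 I2. destruct (Rle_dec phi phi') as [Hle|Hle].
  - now apply (H phi phi').
  - symmetry. apply (H phi' phi); auto. lra.
Qed.

Lemma path_op_value : exists A : V -> V, forall phi J, omega < phi < theta -> in_S J ->
  abs_conv (path_op J phi) /\ int_value (path_op J phi) A.
Proof.
  set (phi0 := (omega + theta) / 2).
  assert (omega < phi0 < theta) as H0 by (unfold phi0; lra).
  (* The value at a reference angle; [2 / PI] is [-1 / PI] times the [-2] of the summed rays. *)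
  exists (fun v => scal (2 / PI) (RInt_gen (fun r => im_ray (prod_re v) (prod_im v) r phi0)
    (at_right 0) (Rbar_locally p_infty))).
  intros phi J Hphi HJ. split; [now apply path_op_abs_conv|].
  intros v. destruct (path_op_integrals phi J v Hphi HJ) as (a1 & a2 & I1 & I2 & I).
  exists a1, a2. split; [exact I1|split; [exact I2|]].
  destruct (path_op_integrals phi0 e1 v H0 in_S_e1) as (b1 & b2 & _ & _ & I').
  rewrite (is_RInt_gen_unique _ _ I').
  rewrite (im_ray_integral_unique phi0 phi v _ _ H0 Hphi I' I).
  pose proof PI_neq0. hmod HV.
Qed.

End Data.
End Rays.

(** * The Cauchy-Fueter operator determines the function *)

Lemma Rabs_component_le qk p : component_map qk -> Rabs (qk p) <= qnorm p.
Proof.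
  intros Hk. pose proof (qnorm_ge0 p). pose proof (qnorm_sqr p) as E. unfold qnorm2 in E.
  destruct Hk as [-> | [-> | [-> | ->]]]; apply Rabs_le; split; nra.
Qed.

Definition is_qderive (F : R -> quat) (t : R) (d : quat) : Prop :=
  forall qk, component_map qk -> is_derive (fun h => qk (F h)) t (qk d).

Lemma qpartial_unique e f q d :
  is_qderive (fun h => f (qadd q (qscale h e))) 0 d -> qpartial e f q = d.
Proof.
  intros H. unfold qpartial. apply quat_ext; simpl; apply is_derive_unique;
  [apply (H q0)|apply (H q1)|apply (H q2)|apply (H q3)]; red; auto.
Qed.

Lemma is_qderive_ext_loc F G t d : locally t (fun h => F h = G h) ->
  is_qderive F t d -> is_qderive G t d.
Proof.
  intros E H qk Hk. apply (is_derive_ext_loc (fun h => qk (F h))); [|now apply H].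
  generalize E. apply filter_imp. now intros h ->.
Qed.

Lemma is_qderive_add F G t d d' : is_qderive F t d -> is_qderive G t d' ->
  is_qderive (fun h => qadd (F h) (G h)) t (qadd d d').
Proof.
  intros H H' qk Hk. pose proof (is_derive_plus _ _ _ _ _ (H qk Hk) (H' qk Hk)) as E.
  destruct Hk as [-> | [-> | [-> | ->]]]; exact E.
Qed.

Lemma is_qderive_mul F G t d d' : is_qderive F t d -> is_qderive G t d' ->
  is_qderive (fun h => qmul (F h) (G h)) t (qadd (qmul d (G t)) (qmul (F t) d')).
Proof.
  intros H H'.
  assert (forall q1 q2, component_map q1 -> component_map q2 ->
    is_derive (fun h => q1 (F h) * q2 (G h)) t (q1 d * q2 (G t) + q1 (F t) * q2 d')) as M.
  { intros p q Hp Hq. apply (is_derive_mult (fun h => p (F h)) (fun h => q (G h)));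
    [now apply H|now apply H'|exact Rmult_comm]. }
  assert (component_map q0) as C0 by (red; auto). assert (component_map q1) as C1 by (red; auto).
  assert (component_map q2) as C2 by (red; auto). assert (component_map q3) as C3 by (red; auto).
  pose proof (fun f g df dg => is_derive_plus (V := R_NormedModule) f g t df dg) as P.
  pose proof (fun f g df dg => is_derive_minus (V := R_NormedModule) f g t df dg) as N.
  intros qk Hk. destruct Hk as [-> | [-> | [-> | ->]]].
  - pose proof (N _ _ _ _ (N _ _ _ _ (N _ _ _ _ (M _ _ C0 C0) (M _ _ C1 C1)) (M _ _ C2 C2)) (M _ _ C3 C3)) as E.
    evar_last; [exact E|]. cbv [minus plus opp]; simpl. ring.
  - pose proof (N _ _ _ _ (P _ _ _ _ (P _ _ _ _ (M _ _ C0 C1) (M _ _ C1 C0)) (M _ _ C2 C3)) (M _ _ C3 C2)) as E.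
    evar_last; [exact E|]. cbv [minus plus opp]; simpl. ring.
  - pose proof (P _ _ _ _ (P _ _ _ _ (N _ _ _ _ (M _ _ C0 C2) (M _ _ C1 C3)) (M _ _ C2 C0)) (M _ _ C3 C1)) as E.
    evar_last; [exact E|]. cbv [minus plus opp]; simpl. ring.
  - pose proof (P _ _ _ _ (N _ _ _ _ (P _ _ _ _ (M _ _ C0 C3) (M _ _ C1 C2)) (M _ _ C2 C1)) (M _ _ C3 C0)) as E.
    evar_last; [exact E|]. cbv [minus plus opp]; simpl. ring.
Qed.

Record slice_data (left : bool) (th : R) (f : quat -> quat) (al be : R -> R -> quat) (a C : R) : Prop := {
  sd_pair : slice_pair th al be;
  sd_eq : forall u v, sector_dom th u v -> forall J, in_S J ->
    f (slice_pt u v J) = qadd (al u v) (if left then qmul J (be u v) else qmul (be u v) J);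
  sd_a : 0 < a;
  sd_C : 0 <= C;
  sd_decay : forall s, in_sector th s -> qnorm (f s) <= C * decay a (qnorm s) }.

Lemma slice_data_of_Psi left th f :
  slice_holo_core th f left -> decay_bound th f -> exists al be a C, slice_data left th f al be a C.
Proof.
  intros (al & be & Ha & Hb & H) (a & C & Ha0 & HC & Hd).
  exists al, be, a, C. split; auto.
  - split; [auto|split; [auto|]]. intros u v HD. destruct (H u v HD) as (_ & _ & H1 & H2 & _). auto.
  - intros u v HD. now destruct (H u v HD) as (_ & _ & _ & _ & H3).
  - intros s Hs. eapply Rle_trans; [now apply Hd|]. right. unfold decay, Rdiv. ring.
Qed.

Section CauchyFueter.
Variables (left : bool) (th : R) (f : quat -> quat) (al be : R -> R -> quat) (a C : R).
Hypothesis Hth : 0 < th < PI.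
Hypothesis Hd : slice_data left th f al be a C.

Lemma is_qderive_pair h x y t x' y' : h = al \/ h = be -> sector_dom th (x t) (y t) ->
  is_derive x t x' -> is_derive y t y' ->
  is_qderive (fun s => h (x s) (y s)) t
    (qadd (qscale x' (dU h (x t) (y t))) (qscale y' (dV h (x t) (y t)))).
Proof.
  intros Hh HD Hx Hy qk Hk. pose proof (sd_pair _ _ _ _ _ _ _ Hd) as (Ha & Hb & _).
  assert (C1_on (sector_dom th) (fun u v => qk (h u v))) as HC.
  { destruct Hh as [-> | ->]; destruct Hk as [-> | [-> | [-> | ->]]]; first [apply Ha|apply Hb]. }
  pose proof (C1_diff2 _ _ _ _ (locally_sector_dom th _ _ Hth HD) HC) as D2.
  pose proof (diff2_comp (W := R_NormedModule) _ x y t x' y' _ _ D2 Hx Hy) as E.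
  evar_last; [exact E|]. destruct Hk as [-> | [-> | [-> | ->]]]; reflexivity.
Qed.

(** Moving along [e] changes the slice coordinates and may also rotate the imaginary unit; allowing
    all three to vary lets one formula serve the four directions. *)
Lemma is_qderive_slice q e x y Jf x' y' J' :
  (forall h, qadd q (qscale h e) = slice_pt (x h) (y h) (Jf h)) ->
  (forall h, in_S (Jf h)) -> sector_dom th (x 0) (y 0) ->
  is_derive x 0 x' -> is_derive y 0 y' -> is_qderive Jf 0 J' ->
  qpartial e f q =
    let A := qadd (qscale x' (dU al (x 0) (y 0))) (qscale y' (dV al (x 0) (y 0))) in
    let B := qadd (qscale x' (dU be (x 0) (y 0))) (qscale y' (dV be (x 0) (y 0))) in
    qadd A (if left then qadd (qmul J' (be (x 0) (y 0))) (qmul (Jf 0) B)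
            else qadd (qmul B (Jf 0)) (qmul (be (x 0) (y 0)) J')).
Proof.
  intros Hq HJ HD Hx Hy HJ'. apply qpartial_unique. cbv zeta.
  assert (locally 0 (fun h => sector_dom th (x h) (y h))) as Hloc.
  { destruct (locally_sector_dom th _ _ Hth HD) as [eps He].
    assert (continuous x 0) as Cx by (apply (ex_derive_continuous x); eexists; exact Hx).
    assert (continuous y 0) as Cy by (apply (ex_derive_continuous y); eexists; exact Hy).
    generalize (filter_and _ _ (proj1 (filterlim_locally x (x 0)) Cx eps)
                               (proj1 (filterlim_locally y (y 0)) Cy eps)).
    apply filter_imp. intros h [H1 H2]. apply (He (x h, y h)). now split. }
  pose proof (is_qderive_pair al x y 0 x' y' (or_introl eq_refl) HD Hx Hy) as DA.
  pose proof (is_qderive_pair be x y 0 x' y' (or_intror eq_refl) HD Hx Hy) as DB.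
  apply (is_qderive_ext_loc (fun h => qadd (al (x h) (y h))
    (if left then qmul (Jf h) (be (x h) (y h)) else qmul (be (x h) (y h)) (Jf h)))).
  - generalize Hloc. apply filter_imp. intros h Hh. rewrite Hq. symmetry.
    now apply (sd_eq _ _ _ _ _ _ _ Hd).
  - apply is_qderive_add; auto. destruct left.
    + exact (is_qderive_mul Jf (fun s => be (x s) (y s)) 0 _ _ HJ' DB).
    + exact (is_qderive_mul (fun s => be (x s) (y s)) Jf 0 _ _ DB HJ').
Qed.

Lemma is_qderive_const c t : is_qderive (fun _ => c) t (qreal 0).
Proof.
  intros qk Hk. evar_last; [apply is_derive_const|].
  destruct Hk as [-> | [-> | [-> | ->]]]; reflexivity.
Qed.

(** A displacement orthogonal to the slice changes the distance to the real axis only to second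
    order. *)
Lemma is_derive_hypot v : 0 < v -> is_derive (fun h => sqrt (v ^ 2 + h ^ 2)) 0 0.
Proof.
  intros Hv. evar_last.
  - auto_derive; [|reflexivity]. nra.
  - ring.
Qed.

Lemma is_derive_hypot_inv v : 0 < v -> is_derive (fun h => v / sqrt (v ^ 2 + h ^ 2)) 0 0 /\
  is_derive (fun h => h / sqrt (v ^ 2 + h ^ 2)) 0 (/ v).
Proof.
  intros Hv. assert (sqrt (v ^ 2 + 0 ^ 2) = v) as E.
  { replace (v ^ 2 + 0 ^ 2) with (v * v) by ring. now apply sqrt_square; lra. }
  pose proof (is_derive_hypot v Hv) as H.
  assert (sqrt (v ^ 2 + 0 ^ 2) <> 0) as Hn by (rewrite E; lra).
  split.
  - pose proof (is_derive_div (fun _ => v) _ 0 0 0 (is_derive_const v 0) H Hn) as D.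
    evar_last; [exact D|]. cbv beta. rewrite E. field. lra.
  - pose proof (is_derive_div (fun h => h) _ 0 1 0 (is_derive_id 0) H Hn) as D.
    evar_last; [exact D|]. cbv beta. rewrite E. field. lra.
Qed.

Lemma sqrt_hypot v h : 0 < v -> 0 < sqrt (v ^ 2 + h ^ 2) /\ sqrt (v ^ 2 + h ^ 2) ^ 2 = v ^ 2 + h ^ 2.
Proof.
  intros Hv. split; [apply sqrt_lt_R0; nra|]. apply pow2_sqrt. nra.
Qed.

(* Transversally to the slice only the imaginary unit rotates, with speed [1/v]; the two
   transversal directions therefore contribute [e2 e2 be/v + e3 e3 be/v], while the
   contribution of the slice itself vanishes by the Cauchy-Riemann equations. *)
Lemma CF_slice u v : 0 < v -> sector_dom th u v ->
  (if left then CF_left else CF_right) f (slice_pt u v e1) = qscale (- 2 / v) (be u v).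
Proof.
  intros Hv HD. pose proof (sd_pair _ _ _ _ _ _ _ Hd) as (_ & _ & Hcr).
  destruct (Hcr u v HD) as [E1 E2]. clear Hcr.
  assert (sqrt (v ^ 2 + 0 ^ 2) = v) as E.
  { replace (v ^ 2 + 0 ^ 2) with (v * v) by ring. now apply sqrt_square; lra. }
  destruct (is_derive_hypot_inv v Hv) as [D1 D2].
  assert (is_derive (fun h : R => u + h) 0 1) as Iu by (auto_derive; auto; ring).
  assert (is_derive (fun h : R => v + h) 0 1) as Iv by (auto_derive; auto; ring).
  assert (forall c : R, is_derive (fun h : R => c) 0 0) as Ic by (intros; apply (is_derive_const c)).
  assert (forall p : R, is_qderive (fun _ => mkQ 0 p 0 0) 0 (qreal 0)) as Kc
    by (intros; apply is_qderive_const).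
  (* The unit vector along [v e1 + h e2], hence the imaginary unit of the point displaced by [h e2];
     [J3] is its analogue for [e3]. *)
  set (J2 := fun h => mkQ 0 (v / sqrt (v ^ 2 + h ^ 2)) (h / sqrt (v ^ 2 + h ^ 2)) 0).
  set (J3 := fun h => mkQ 0 (v / sqrt (v ^ 2 + h ^ 2)) 0 (h / sqrt (v ^ 2 + h ^ 2))).
  assert (is_qderive J2 0 (qscale (/ v) e2)) as K2.
  { intros qk Hk. destruct Hk as [-> | [-> | [-> | ->]]];
    (evar_last; [first [exact D1|exact D2|exact (Ic 0)]|simpl; ring]). }
  assert (is_qderive J3 0 (qscale (/ v) e3)) as K3.
  { intros qk Hk. destruct Hk as [-> | [-> | [-> | ->]]];
    (evar_last; [first [exact D1|exact D2|exact (Ic 0)]|simpl; ring]). }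
  assert (forall h, in_S (J2 h)) as S2.
  { intros h. destruct (sqrt_hypot v h Hv) as [H1 H2]. split; [reflexivity|].
    apply qnorm_unique; [lra|]. unfold qnorm2, J2. cbn [q0 q1 q2 q3].
    field_simplify_eq; [|lra]. rewrite H2. ring. }
  assert (forall h, in_S (J3 h)) as S3.
  { intros h. destruct (sqrt_hypot v h Hv) as [H1 H2]. split; [reflexivity|].
    apply qnorm_unique; [lra|]. unfold qnorm2, J3. cbn [q0 q1 q2 q3].
    field_simplify_eq; [|lra]. rewrite H2. ring. }
  assert (forall h, qadd (slice_pt u v e1) (qscale h e2) =
    slice_pt u (sqrt (v ^ 2 + h ^ 2)) (J2 h)) as Q2.
  { intros h. destruct (sqrt_hypot v h Hv) as [H1 _]. unfold J2.
    apply quat_ext; cbn [q0 q1 q2 q3 qadd qscale slice_pt qreal e1 e2 e3]; field; lra. }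
  assert (forall h, qadd (slice_pt u v e1) (qscale h e3) =
    slice_pt u (sqrt (v ^ 2 + h ^ 2)) (J3 h)) as Q3.
  { intros h. destruct (sqrt_hypot v h Hv) as [H1 _]. unfold J3.
    apply quat_ext; cbn [q0 q1 q2 q3 qadd qscale slice_pt qreal e1 e2 e3]; field; lra. }
  assert (J2 0 = e1) as J20 by (unfold J2; rewrite E; apply quat_ext; simpl; field; lra).
  assert (J3 0 = e1) as J30 by (unfold J3; rewrite E; apply quat_ext; simpl; field; lra).
  set (X := dU al u v) in *. set (Y := dU be u v) in *. set (b := be u v).
  pose proof (is_qderive_slice (slice_pt u v e1) qone (fun h => u + h) (fun _ => v) (fun _ => e1)
    1 0 (qreal 0) ltac:(intros; quat_ring) (fun _ => in_S_e1)) as P0.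
  pose proof (is_qderive_slice (slice_pt u v e1) e1 (fun _ => u) (fun h => v + h) (fun _ => e1)
    0 1 (qreal 0) ltac:(intros; quat_ring) (fun _ => in_S_e1)) as P1.
  pose proof (is_qderive_slice (slice_pt u v e1) e2 (fun _ => u)
    (fun h => sqrt (v ^ 2 + h ^ 2)) J2 0 0 (qscale (/ v) e2)) as P2.
  pose proof (is_qderive_slice (slice_pt u v e1) e3 (fun _ => u)
    (fun h => sqrt (v ^ 2 + h ^ 2)) J3 0 0 (qscale (/ v) e3)) as P3.
  cbv beta zeta in P0, P1, P2, P3.
  rewrite Rplus_0_r in P0, P1. rewrite E in P2, P3. rewrite J20 in P2. rewrite J30 in P3.
  specialize (P0 HD Iu (Ic v) (is_qderive_const e1 0)).
  specialize (P1 HD (Ic u) Iv (is_qderive_const e1 0)).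
  specialize (P2 Q2 S2 HD (Ic u) (is_derive_hypot v Hv) K2).
  specialize (P3 Q3 S3 HD (Ic u) (is_derive_hypot v Hv) K3).
  fold X Y b in P0, P1, P2, P3. rewrite E2 in *. rewrite <- E1 in *.
  destruct left; unfold CF_left, CF_right; rewrite P0, P1, P2, P3; quat_ring.
Qed.

(** A shift by [x - u] changes the modulus by at most [x - u] in either direction, and
    [|cos th| <= 1] covers both signs of [cos th]. *)
Lemma sector_dom_right u v x : u <= x -> sector_dom th u v -> sector_dom th x v.
Proof.
  intros Hx H. apply (sector_dom_cos th u v Hth) in H. apply sector_dom_cos; auto.
  pose proof in_S_e1 as HS.
  rewrite <- (qnorm_slice _ _ _ HS) in H. rewrite <- (qnorm_slice _ _ _ HS).
  pose proof (qnorm_slice_sub u v x v e1 HS) as E.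
  replace ((x - u) ^ 2 + (v - v) ^ 2) with ((x - u) * (x - u)) in E by ring.
  rewrite sqrt_square in E by lra.
  pose proof (qnorm_sub_le (slice_pt u v e1) (slice_pt x v e1)) as B1.
  rewrite qnorm_sub_sym in B1.
  pose proof (qnorm_sub_le (slice_pt x v e1) (slice_pt u v e1)) as B2.
  pose proof (COS_bound th). nra.
Qed.

Lemma slice_vanish_infty u v eps : 0 < eps -> sector_dom th u v ->
  exists x0, u <= x0 /\ forall x, x0 <= x -> qnorm (f (slice_pt x v e1)) <= eps.
Proof.
  intros Heps HD. pose proof (sd_C _ _ _ _ _ _ _ Hd) as HC. pose proof (sd_a _ _ _ _ _ _ _ Hd) as Ha.
  assert (0 < eps / (C + 1)) as He by (apply Rdiv_lt_0_compat; lra).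
  destruct (proj1 (filterlim_locally _ 0) (decay_lim_infty_aux a Ha) (mkposreal _ He)) as [N HN].
  exists (Rmax u (Rmax 0 N + 1)). split; [apply Rmax_l|]. intros x Hx.
  pose proof (Rmax_l u (Rmax 0 N + 1)). pose proof (Rmax_r u (Rmax 0 N + 1)).
  pose proof (Rmax_l 0 N). pose proof (Rmax_r 0 N).
  assert (sector_dom th x v) as Hxd by (apply (sector_dom_right u); auto; lra).
  eapply Rle_trans; [apply (sd_decay _ _ _ _ _ _ _ Hd), Hxd, in_S_e1|].
  set (n := qnorm (slice_pt x v e1)).
  assert (N < n) as Hn.
  { pose proof (q0_le_qnorm (slice_pt x v e1)) as Hq. rewrite (q0_slice x v e1 in_S_e1) in Hq.
    unfold n. lra. }
  assert (Rabs (decay a n - 0) < eps / (C + 1)) as B by exact (HN n Hn).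
  pose proof (decay_ge0 a n). rewrite Rminus_0_r, Rabs_right in B by lra.
  apply (Rle_trans _ (C * (eps / (C + 1)))); [apply Rmult_le_compat_l; lra|].
  apply (Rmult_le_reg_r (C + 1)); [lra|]. field_simplify; [nra|lra].
Qed.

End CauchyFueter.

(** The Cauchy-Fueter equation is tested only on the plane of [e1], because [al] and [be] do not
    depend on the unit. The case [v > 0] is the one needed: the rays of the path stay off the real
    axis. *)
Lemma slice_determined left th f g al be a C al' be' a' C' : 0 < th < PI ->
  slice_data left th f al be a C -> slice_data left th g al' be' a' C' ->
  (forall q, in_sector th q ->
    (if left then CF_left else CF_right) f q = (if left then CF_left else CF_right) g q) ->
  forall u v J, 0 < v -> sector_dom th u v -> in_S J -> f (slice_pt u v J) = g (slice_pt u v J).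
Proof.
  intros Hth Hf Hg HCF.
  assert (forall u v, 0 < v -> sector_dom th u v -> be u v = be' u v) as Ebe.
  { intros u v Hv HD. specialize (HCF _ (HD e1 in_S_e1)).
    rewrite (CF_slice left th f al be a C Hth Hf u v Hv HD) in HCF.
    rewrite (CF_slice left th g al' be' a' C' Hth Hg u v Hv HD) in HCF.
    apply (f_equal (qscale (- v / 2))) in HCF.
    transitivity (qscale (- v / 2) (qscale (- 2 / v) (be u v)));
    [apply quat_ext; simpl; field; lra|]. rewrite HCF.
    apply quat_ext; simpl; field; lra. }
  assert (forall u v, 0 < v -> sector_dom th u v -> al u v = al' u v) as Eal.
  { intros u v Hv HD.
    assert (forall qk, component_map qk -> qk (al u v) = qk (al' u v)) as Hk;
    [|apply quat_ext; apply Hk; red; auto].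
    intros qk Hk.
    set (d := fun x => qk (al x v) - qk (al' x v)).
    assert (forall x, u <= x -> is_derive d x 0) as Hder.
    { intros x Hx. pose proof (sector_dom_right th Hth u v x Hx HD) as Hxd.
      pose proof (sd_pair _ _ _ _ _ _ _ Hf) as (Ha & _ & Hcr).
      pose proof (sd_pair _ _ _ _ _ _ _ Hg) as (Ha' & _ & Hcr').
      destruct (Hcr x v Hxd) as [E _]. destruct (Hcr' x v Hxd) as [E' _].
      assert (dV be x v = dV be' x v) as Eb.
      { assert (locally v (fun y => be x y = be' x y)) as Hl.
        { destruct (locally_sector_dom th x v Hth Hxd) as [eps He].
          (* The radius is capped by [v] to stay in the upper half-plane, where [be = be'] is
             known. *)
          assert (0 < Rmin eps v) as Hm by (apply Rmin_pos; auto; apply cond_pos).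
          exists (mkposreal _ Hm). intros y Hy.
          assert (Rabs (y - v) < Rmin eps v) as Hy' by exact Hy.
          assert (Rabs (y - v) < eps) as B1 by (eapply Rlt_le_trans; [exact Hy'|apply Rmin_l]).
          assert (Rabs (y - v) < v) as B2 by (eapply Rlt_le_trans; [exact Hy'|apply Rmin_r]).
          apply Rabs_lt_between in B2. apply Ebe; [lra|].
          apply (He (x, y)). split; [apply ball_center|exact B1]. }
        unfold dV. f_equal; apply Derive_ext_loc; generalize Hl; apply filter_imp;
        now intros y ->. }
      rewrite <- E, <- E' in Eb. apply (f_equal qk) in Eb.
      assert (ex_derive (fun x => qk (al x v)) x /\ ex_derive (fun x => qk (al' x v)) x) as [X X'].
      { destruct Ha as (A0 & A1 & A2 & A3). destruct Ha' as (A0' & A1' & A2' & A3').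
        destruct Hk as [-> | [-> | [-> | ->]]]; split;
        first [apply (A0 x v Hxd)|apply (A1 x v Hxd)|apply (A2 x v Hxd)|apply (A3 x v Hxd)
              |apply (A0' x v Hxd)|apply (A1' x v Hxd)|apply (A2' x v Hxd)|apply (A3' x v Hxd)]. }
      assert (Derive (fun x => qk (al x v)) x = Derive (fun x => qk (al' x v)) x) as ED
        by (destruct Hk as [-> | [-> | [-> | ->]]]; exact Eb).
      pose proof (is_derive_minus _ _ _ _ _ (Derive_correct _ _ X) (Derive_correct _ _ X')) as D.
      evar_last; [exact D|].
      change (Derive (fun x => qk (al x v)) x - Derive (fun x => qk (al' x v)) x = 0).
      rewrite ED. ring. }
    assert (forall eps, 0 < eps -> Rabs (d u) <= 2 * eps) as Hsmall.
    { intros eps Heps.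
      destruct (slice_vanish_infty left th f al be a C Hth Hf u v eps Heps HD) as (x1 & Hx1 & B1).
      destruct (slice_vanish_infty left th g al' be' a' C' Hth Hg u v eps Heps HD) as (x2 & Hx2 & B2).
      set (x := Rmax x1 x2).
      assert (x1 <= x /\ x2 <= x) as [Le1 Le2] by (split; [apply Rmax_l|apply Rmax_r]).
      specialize (B1 x Le1). specialize (B2 x Le2).
      assert (sector_dom th x v) as Hxd by (apply (sector_dom_right th Hth u v); auto; lra).
      assert (d u = d x) as ->.
      { destruct (MVT_gen d u x (fun _ => 0)) as (c & _ & Ec).
        - rewrite Rmin_left by lra. intros y Hy. apply Hder; lra.
        - rewrite Rmin_left by lra. intros y Hy. apply continuity_pt_filterlim.
          apply (ex_derive_continuous d). eexists. apply Hder; lra.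
        - lra. }
      (* The terms with [be] and [be'] cancel, so the decay of [f] and [g] passes to the difference
         of [al] and [al']. *)
      assert (d x = qk (f (slice_pt x v e1)) - qk (g (slice_pt x v e1))) as ->.
      { rewrite (sd_eq _ _ _ _ _ _ _ Hf x v Hxd e1 in_S_e1).
        rewrite (sd_eq _ _ _ _ _ _ _ Hg x v Hxd e1 in_S_e1).
        rewrite (Ebe x v Hv Hxd). set (z := if left then _ else _). unfold d.
        destruct Hk as [-> | [-> | [-> | ->]]]; simpl; ring. }
      pose proof (Rabs_component_le qk (f (slice_pt x v e1)) Hk).
      pose proof (Rabs_component_le qk (g (slice_pt x v e1)) Hk).
      unfold Rminus. eapply Rle_trans; [apply Rabs_triang|]. rewrite Rabs_Ropp. lra. }
    apply Rminus_diag_uniq. change (d u = 0).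
    destruct (Req_dec (d u) 0) as [|Hn]; auto.
    pose proof (Rabs_pos_lt _ Hn). specialize (Hsmall (Rabs (d u) / 4)). lra. }
  intros u v J Hv HD HJ.
  rewrite (sd_eq _ _ _ _ _ _ _ Hf u v HD J HJ), (sd_eq _ _ _ _ _ _ _ Hg u v HD J HJ).
  now rewrite Ebe, Eal.
Qed.

(** * Uniqueness of the integral values and conclusion *)

Section Values.
Context {V : CompleteNormedModule R_AbsRing}.

Lemma int_value_unique (K : R -> V -> V) A B :
  int_value K A -> int_value K B -> forall v, A v = B v.
Proof.
  intros HA HB v. destruct (HA v) as (a1 & a2 & I1 & I2 & ->).
  destruct (HB v) as (b1 & b2 & K1 & K2 & ->).
  rewrite <- (is_RInt_gen_unique _ _ I1), <- (is_RInt_gen_unique _ _ I2).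
  now rewrite <- (is_RInt_gen_unique _ _ K1), <- (is_RInt_gen_unique _ _ K2).
Qed.

Lemma int_value_ext (K K' : R -> V -> V) A : (forall t v, t <> 0 -> K t v = K' t v) ->
  int_value K A -> int_value K' A.
Proof.
  intros E HA v. destruct (HA v) as (a1 & a2 & I1 & I2 & Ev).
  exists a1, a2. split; [|split; [|exact Ev]].
  - revert I1. apply infty_at_left_ext. intros r Hr. apply E. lra.
  - revert I2. apply at_right_infty_ext. intros r Hr. apply E. lra.
Qed.

End Values.

Lemma gamma_slice phi J t : t <> 0 -> in_S J ->
  exists r K, 0 < r /\ in_S K /\ gamma phi J t = slice_pt (r * cos phi) (r * sin phi) K.
Proof.
  intros Ht HJ. unfold gamma. destruct (Rlt_dec t 0) as [Hneg|Hpos].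
  - exists (- t), J. split; [lra|split; [auto|]]. apply slice_polar.
  - exists t, (qopp J). split; [lra|split; [now apply in_S_opp|]].
    rewrite slice_polar, cos_neg, sin_neg. quat_ring.
Qed.

Section Main.
Context {V : CompleteNormedModule R_AbsRing}.
Variables (lm : quat -> V -> V) (rm : V -> quat -> V).
Hypothesis HV : two_sided lm rm.
Variables (dom : V -> Prop) (T0 T1 T2 T3 : V -> V).
Hypothesis HT : is_KC lm rm dom T0 T1 T2 T3.
Variables omega theta : R.
Hypothesis Htype : of_type lm dom T0 T1 T2 T3 omega.
Hypothesis Htype' : of_type lm dom T0 (fun v => opp (T1 v)) (fun v => opp (T2 v))
                      (fun v => opp (T3 v)) omega.
Hypothesis Htheta : omega < theta < PI.

Local Notation op left f := (path_op lm dom T0 T1 T2 T3 left f).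

Lemma functional_exists left f : slice_holo_core theta f left -> decay_bound theta f ->
  exists A : V -> V, forall phi J, omega < phi < theta -> in_S J ->
    abs_conv (op left f J phi) /\ int_value (op left f J phi) A.
Proof.
  intros H1 H2. destruct (slice_data_of_Psi left theta f H1 H2) as (al & be & a & C & [D1 D2 D3 D4 D5]).
  exact (path_op_value lm rm HV dom T0 T1 T2 T3 HT omega Htype Htype' theta Htheta
    left f al be D1 D2 a C D3 D4 D5).
Qed.

(** [Af] is also a value for [g] along one common path, because [f] and [g] agree there;
    independence of the path for each of the two functions does the rest. *)
Lemma functional_determined left f g :
  slice_holo_core theta f left -> decay_bound theta f ->
  slice_holo_core theta g left -> decay_bound theta g ->
  (forall q, in_sector theta q ->
    (if left then CF_left else CF_right) f q = (if left then CF_left else CF_right) g q) ->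
  forall phi J phi' J' (A B : V -> V),
    omega < phi < theta -> in_S J -> omega < phi' < theta -> in_S J' ->
    int_value (op left f J phi) A -> int_value (op left g J' phi') B -> forall v, A v = B v.
Proof.
  intros F1 F2 G1 G2 HCF phi J phi' J' A B Hphi HJ Hphi' HJ' HA HB v.
  destruct (functional_exists left f F1 F2) as [Af Hf].
  destruct (functional_exists left g G1 G2) as [Ag Hg].
  destruct (slice_data_of_Psi left theta f F1 F2) as (al & be & a & C & Df).
  destruct (slice_data_of_Psi left theta g G1 G2) as (al' & be' & a' & C' & Dg).
  destruct (theta_bounds lm dom T0 T1 T2 T3 omega Htype theta Htheta) as [Ho Hth].
  assert (int_value (op left g J phi) Af) as HAg.
  { apply (int_value_ext (op left f J phi)); [|now apply Hf].
    intros t w Ht. destruct (gamma_slice phi J t Ht HJ) as (r & K & Hr & HK & E).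
    assert (f (gamma phi J t) = g (gamma phi J t)) as Efg.
    { rewrite E. apply (slice_determined left theta f g al be a C al' be' a' C'); auto.
      - apply Rmult_lt_0_compat; auto. apply sin_gt_0; lra.
      - apply sector_dom_polar; auto. rewrite Rabs_right; lra. }
    unfold path_op. destruct left; unfold KL, KR; now rewrite Efg. }
  transitivity (Af v); [apply (int_value_unique (op left f J phi)); auto; now apply Hf|].
  transitivity (Ag v); [apply (int_value_unique (op left g J phi)); auto; now apply Hg|].
  apply (int_value_unique (op left g J' phi')); auto. now apply Hg.
Qed.

End Main.

Theorem theorem3p4 (V : CompleteNormedModule R_AbsRing)
  (lm : quat -> V -> V) (rm : V -> quat -> V)
  (dom : V -> Prop) (T0 T1 T2 T3 : V -> V) (omega theta : R) :
  two_sided lm rm ->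
  is_KC lm rm dom T0 T1 T2 T3 ->
  of_type lm dom T0 T1 T2 T3 omega ->
  of_type lm dom T0 (fun v => opp (T1 v)) (fun v => opp (T2 v)) (fun v => opp (T3 v)) omega ->
  omega < theta < PI ->
  (* left version: D f(T) *)
  (forall f, PsiL theta f ->
     exists A : V -> V, forall phi J, omega < phi < theta -> in_S J ->
       abs_conv (KL lm dom T0 T1 T2 T3 f phi J) /\
       int_value (KL lm dom T0 T1 T2 T3 f phi J) A) /\
  (* right version: (f D)(T) *)
  (forall f, PsiR theta f ->
     exists A : V -> V, forall phi J, omega < phi < theta -> in_S J ->
       abs_conv (KR lm dom T0 T1 T2 T3 f phi J) /\
       int_value (KR lm dom T0 T1 T2 T3 f phi J) A) /\
  (* D f = D g on S_theta  implies  D f(T) = D g(T) *)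
  (forall f g, PsiL theta f -> PsiL theta g ->
     (forall q, in_sector theta q -> CF_left f q = CF_left g q) ->
     forall phi J phi' J' (A B : V -> V),
       omega < phi < theta -> in_S J -> omega < phi' < theta -> in_S J' ->
       int_value (KL lm dom T0 T1 T2 T3 f phi J) A ->
       int_value (KL lm dom T0 T1 T2 T3 g phi' J') B ->
       forall v, A v = B v) /\
  (* f D = g D on S_theta  implies  (f D)(T) = (g D)(T) *)
  (forall f g, PsiR theta f -> PsiR theta g ->
     (forall q, in_sector theta q -> CF_right f q = CF_right g q) ->
     forall phi J phi' J' (A B : V -> V),
       omega < phi < theta -> in_S J -> omega < phi' < theta -> in_S J' ->
       int_value (KR lm dom T0 T1 T2 T3 f phi J) A ->
       int_value (KR lm dom T0 T1 T2 T3 g phi' J') B ->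
       forall v, A v = B v).
Proof.
  intros HV HT Htype Htype' Htheta. repeat split.
  - intros f [H1 H2].
    exact (functional_exists lm rm HV dom T0 T1 T2 T3 HT omega theta Htype Htype' Htheta true f H1 H2).
  - intros f [H1 H2].
    exact (functional_exists lm rm HV dom T0 T1 T2 T3 HT omega theta Htype Htype' Htheta false f H1 H2).
  - intros f g [F1 F2] [G1 G2].
    exact (functional_determined lm rm HV dom T0 T1 T2 T3 HT omega theta Htype Htype' Htheta
      true f g F1 F2 G1 G2).
  - intros f g [F1 F2] [G1 G2].
    exact (functional_determined lm rm HV dom T0 T1 T2 T3 HT omega theta Htype Htype' Htheta
      false f g F1 F2 G1 G2).
Qed.
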